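(* Let $(X_{n})_{n\in\mathbb{N}}$ be a Markov chain with transition kernel $K$ and initial distribution $\nu$. Let $\pi$ be a stationary distribution of $K$. For $p\in(2,\infty]$ let $f\in L_p$ and let the probability measure $\nu\in \mathcal{M}_{\max\{2,\frac{p}{p-2}\}}$. Suppose that the Markov operator has an $L_2$-spectral gap, i.e. $1-\beta>0$. Then for all $n\in\mathbb{N}$ and $n_0\in\mathbb{N}\cup\{0\}$ $$e_\nu(S_{n,n_0},f)^2 \leq e_\pi(S_n,f)^2 +\frac{ 64\, p\,\|f\|_{p}^2 }{n^2 (p-2) (1-\beta)^2} \begin{cases} \beta^{2n_0\frac{p-2}{p}} \left\|\frac{d\nu}{d\pi}-1\right\|_{\frac{p}{p-2}}, & p\in(2,4),\\ \beta^{n_0} \left\|\frac{d\nu}{d\pi}-1\right\|_{2}, & p\in[4,\infty], \end{cases}$$ where $$e_\pi(S_n,f)^2 \leq \begin{cases} \frac{2}{n(1-\Lambda)}\|f\|_{p}^2, & \text{if } K \text{ is reversible with respect to }\pi, \\ \frac{2}{n(1-\beta)}\|f\|_{p}^2, & \text{otherwise}. \end{cases}$$ Furthermore, for every fixed $n_0$, $$\lim_{n\to \infty} n\cdot e_\nu(S_{n,n_0},f)^2 =\lim_{n\to \infty} n\cdot e_\pi(S_{n},f)^2,$$ and if $K$ is reversible with respect to $\pi$ then this limit is equal to $\langle (I+P)(I-P)^{-1}g,g\rangle$, where $g=f-S(f)$.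
   Context: $\mathbb{N}=\{1,2,\dots\}$. $(D,\mathcal{D})$ is a measurable space, $K$ a transition (Markov) kernel on it. A probability measure $\pi$ is stationary for $K$ if $\int_D K(x,A)\pi(dx)=\pi(A)$ for all $A\in\mathcal D$; $K$ is reversible with respect to $\pi$ if $\int_B K(x,A)\pi(dx)=\int_A K(x,B)\pi(dx)$ for all $A,B\in\mathcal{D}$. A Markov chain $(X_n)_{n\in\mathbb{N}}$ with kernel $K$ and initial distribution $\nu$ satisfies $X_1\sim\nu$ and $\Pr(X_{n+1}\in A\mid X_1,\dots,X_n)=K(X_n,A)$ a.s. $L_p=L_p(D,\pi)$ is the real $L_p$-space with norm $\|\cdot\|_p$; $\langle f,g\rangle=\int_D fg\,d\pi$; $S(f)=\int_D f\,d\pi$; $Pf(x)=\int_D f(y)K(x,dy)$ is the Markov operator; $L_2^0=\{f\in L_2: S(f)=0\}$; $\beta=\|P\|_{L_2^0\to L_2^0}$. In the reversible case $P$ is self-adjoint on $L_2^0$ and $\Lambda=\sup\{a: a\in\mathrm{spec}(P|L_2^0)\}$, with $\mathrm{spec}(P|L_2^0)$ the spectrum of $P:L_2^0\to L_2^0$ ($L_2^0\ne\{0\}$); $(I-P)^{-1}$ is the inverse on $L_2^0$. For $q\in[1,\infty]$, $\nu\in\mathcal{M}_q$ means that $\nu$ has a density $\frac{d\nu}{d\pi}\in L_q$. For $p=\infty$, the ratio $\frac{p}{p-2}$ is read as $1$. Convention $0^0=1$. $S_{n,n_0}(f)=\frac1n\sum_{j=1}^n f(X_{j+n_0})$, $S_n=S_{n,0}$,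 and $e_\nu(S_{n,n_0},f)=\big(\mathbf{E}_{\nu,K}|S_{n,n_0}(f)-S(f)|^2\big)^{1/2}$ for the chain with kernel $K$ and initial distribution $\nu$; $e_\pi$ is the error when the initial distribution is $\pi$. *)

(* Defs.v *)
From mathcomp Require Import all_boot all_order all_algebra.
From mathcomp Require Import all_classical all_reals all_analysis.
From mathcomp Require Import measurable_realfun.

Set Implicit Arguments.
Unset Strict Implicit.
Unset Printing Implicit Defensive.

Import Order.TTheory GRing.Theory Num.Theory.
Import numFieldNormedType.Exports.

Local Open Scope classical_set_scope.
Local Open Scope ring_scope.

Section markov_chain.
Context (R : realType) (d : measure_display) (D : measurableType d).
Local Open Scope ereal_scope.

Definition stationary (K : R.-pker D ~> D) (pi : probability D R) : Prop :=
  forall A : set D, measurable A -> \int[pi]_x K x A = pi A.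

Definition reversible (K : R.-pker D ~> D) (pi : probability D R) : Prop :=
  forall A B : set D, measurable A -> measurable B ->
    \int[pi]_(x in B) K x A = \int[pi]_(x in A) K x B.

Context (dW : measure_display) (W : measurableType dW) (Pr : probability W R).

(* Z is a version of the conditional probability of the event E given the
   sub-sigma-algebra F. *)
Definition is_cond_prob (F : set_system W) (E : set W) (Z : W -> \bar R)
    : Prop :=
  (forall B : set (\bar R), measurable B -> F (Z @^-1` B)) /\
  (forall G : set W, F G -> \int[Pr]_(w in G) Z w = Pr (G `&` E)).

(* The sigma-algebra generated by X 0, ..., X n. *)
Definition past (X : nat -> {RV Pr >-> D}) (n : nat) : set_system W :=
  <<s \bigcup_(i in [set i | (i <= n)%N])
        preimage_set_system [set: W] (X i) measurable >>.

(* Indices are shifted by one: X k is the state usually written X_{k+1}, so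
   that X 0 has the initial distribution. *)
Definition markov_chain (K : R.-pker D ~> D) (nu : probability D R)
    (X : nat -> {RV Pr >-> D}) : Prop :=
  (forall A : set D, measurable A -> distribution Pr (X 0%N) A = nu A) /\
  (forall (n : nat) (A : set D), measurable A ->
     is_cond_prob (past X n) (X n.+1 @^-1` A) (fun w => K (X n w) A)).

(* With the shifted indices, f(X_{j+n0}) for 1 <= j <= n is f (X (j + n0)) for
   0 <= j < n. *)
Definition mc_mean (X : nat -> {RV Pr >-> D}) (f : D -> R) (n n0 : nat)
    (w : W) : R :=
  (n%:R^-1 * \sum_(j < n) f (X (j + n0)%N w))%R.

(* The chain enters the error only through its law, so e_nu and e_pi are
   obtained from chains with initial distribution nu and pi respectively. *)
Definition mc_error (X : nat -> {RV Pr >-> D}) (pi : probability D R)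
    (f : D -> R) (n n0 : nat) : \bar R :=
  'E_Pr[fun w => (`|mc_mean X f n n0 w - \int[pi]_x f x| ^+ 2)%R] `^ (2^-1).

End markov_chain.

(* Elements of L_p are represented by functions, and equality in L_p is
   equality pi-almost everywhere. *)
Section operators.
Context (R : realType) (d : measure_display) (D : measurableType d).
Variable pi : probability D R.

Definition L2_inner (u v : D -> R) : R := \int[pi]_x (u x * v x).

Definition L20 : set (D -> R) :=
  [set u | u \in Lfun pi 2%:E /\ \int[pi]_x u x = 0].

Definition L20_nontrivial : Prop :=
  exists2 u : D -> R, L20 u & ~ (u = cst 0 %[ae pi]).

Definition L20_bounded_linear (B : (D -> R) -> (D -> R)) : Prop :=
  [/\ forall u, L20 u -> L20 (B u),
      forall (a : R) u v, L20 u -> L20 v ->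
        B (fun x => a * u x + v x) = (fun x => a * B u x + B v x) %[ae pi]
    & exists C : R, forall u, L20 u ->
        ('N[pi]_(2%:E)[EFin \o B u] <= C%:E * 'N[pi]_(2%:E)[EFin \o u])%E].

(* B represents the inverse of A in the algebra of bounded linear operators on
   L20. *)
Definition L20_inverse (A B : (D -> R) -> (D -> R)) : Prop :=
  [/\ L20_bounded_linear B,
      forall u, L20 u -> B (A u) = u %[ae pi]
    & forall u, L20 u -> A (B u) = u %[ae pi]].

(* Real spectrum; for a self-adjoint operator this is the whole spectrum. *)
Definition L20_spectrum (A : (D -> R) -> (D -> R)) : set R :=
  [set a | ~ exists B, L20_inverse (fun u x => a * u x - A u x) B].

(* Finite when A is bounded on L20. *)
Definition L20_opnorm (A : (D -> R) -> (D -> R)) : R :=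
  fine (ereal_sup [set 'N[pi]_(2%:E)[EFin \o A u] |
    u in [set u | L20 u /\ ('N[pi]_(2%:E)[EFin \o u] <= 1)%E]]%E).

(* For u in L_2(pi) and pi stationary, u is K x-integrable for pi-almost every
   x; elsewhere Rintegral takes an arbitrary finite value. *)
Definition markov_op (K : R.-pker D ~> D) (u : D -> R) : D -> R :=
  fun x => \int[K x]_y u y.

Definition beta (K : R.-pker D ~> D) : R := L20_opnorm (markov_op K).

Definition Lambda (K : R.-pker D ~> D) : R := sup (L20_spectrum (markov_op K)).

End operators.

Section densities.
Context (R : realType) (d : measure_display) (D : measurableType d).
Local Open Scope ereal_scope.
Local Open Scope charge_scope.

Definition density (nu pi : probability D R) : D -> \bar R :=
  'd (charge_of_finite_measure nu) '/d pi.

Definition in_M (pi : probability D R) (q : \bar R) (nu : probability D R)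
    : Prop :=
  nu `<< pi /\ 'N[pi]_q[density nu pi] < +oo.

End densities.

(* p / (p - 2), read as 1 for p = +oo. *)
Definition pratio (R : realType) (p : \bar R) : R :=
  if p is r%:E then r / (r - 2) else 1.

(* Main.v *)
From HB Require Import structures.
Require Import Defs.
From mathcomp Require Import all_boot all_order all_algebra.
From mathcomp Require Import all_classical all_reals all_analysis.
From mathcomp Require Import measurable_realfun ess_sup_inf.
From mathcomp Require Import ring lra zify.

Set Implicit Arguments.
Unset Strict Implicit.
Unset Printing Implicit Defensive.

Import Order.TTheory GRing.Theory Num.Theory.
Import numFieldNormedType.Exports.

Local Open Scope classical_set_scope.
Local Open Scope ring_scope.

(* The Markov operator [P] and its adjoint are contractions of L_oo and have norm
   [beta] on mean-zero L_2. Cutting functions at a height [s] and integrating over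
   [s] interpolates between the two: on mean-zero functions in L_r, 2 <= r, the
   operators [P^m] and [(P^* )^m] have norm at most [2 beta^(2m/r)].

   The density [rho_a] of [X_a] satisfies [rho_a - 1 = (P^* )^a (dnu/dpi - 1)]. Let
   [r] be the minimum of p and 4, and [2/r + 1/q = 1]. The covariance of [g(X_a)] and
   [g(X_{a+m})] under nu exceeds the stationary one by
   [int g (P^m g) (rho_a - 1) dpi], which Hoelder's inequality for (r, r, q) bounds
   by a multiple of [beta^(2m/r) beta^(2a/q)]. The geometric double sum over all
   pairs of times and [1 - beta^t >= t (1 - beta)] give the comparison of the errors.

   In the stationary case, solving [h - P h = g] by a Neumann series telescopes the
   covariances:
   [n^2 e_pi^2 = n (2 <h, g> - <g, g>) - 2 sum_(1 <= m <= n) <P^m h, g>],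
   which yields the limit. If [P] is self-adjoint, then
   [<g, g> + 2 <P^m h, g> >= 0] gives [n e_pi^2 <= 2 <h, g>], and Lambda, being the
   supremum of the numerical range of [P], gives [(1 - Lambda) <h, g> <= <g, g>]. *)

(** * L2 of a probability space *)

Section L2_space.
Context (R : realType) (d : measure_display) (D : measurableType d).
Variable mu : probability D R.
Implicit Types u v w : D -> R.
Local Notation L2 := (Lfun mu 2%:E).
Local Notation ip := (L2_inner mu).

Lemma Lfun_measurable (p : \bar R) u : u \in Lfun mu p -> measurable_fun setT u.
Proof. by rewrite inE => /andP[]; rewrite inE. Qed.

Lemma L2P u : u \in L2 <-> measurable_fun setT u /\
  mu.-integrable setT (EFin \o (fun x => u x ^+ 2)).
Proof.
split=> [u2|[mu_ iu]].
  by split; [exact: Lfun_measurable u2|exact: Lfun2_integrable_sqr].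
rewrite inE; apply/andP; split; first by rewrite inE.
rewrite inE/= /finite_norm unlock /Lnorm poweR_lty//.
move/integrableP : iu => [_]; apply: le_lt_trans.
rewrite le_eqVlt; apply/orP; left; apply/eqP; apply: eq_integral => x _ /=.
by rewrite normrX powR_mulrn.
Qed.

Lemma L2_lin (a : R) u v : u \in L2 -> v \in L2 ->
  (fun x => a * u x + v x) \in L2.
Proof.
move=> u2 v2; have h1 : (1 <= 2%:E :> \bar R)%E by rewrite lee_fin ler1n.
exact: (Lfun_submod_closed mu h1).2.
Qed.

Lemma L2_cst (c : R) : (fun=> c) \in L2.
Proof. exact: Lfun_cst. Qed.

Lemma L2Z (a : R) u : u \in L2 -> (fun x => a * u x) \in L2.
Proof.
by move=> u2; have := L2_lin a u2 (L2_cst 0); under eq_fun do rewrite addr0.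
Qed.

Lemma L2D u v : u \in L2 -> v \in L2 -> (fun x => u x + v x) \in L2.
Proof.
by move=> u2 v2; have := L2_lin 1 u2 v2; under eq_fun do rewrite mul1r.
Qed.

Lemma L2B u v : u \in L2 -> v \in L2 -> (fun x => u x - v x) \in L2.
Proof.
move=> u2 v2; have := L2_lin (-1) v2 u2.
by under eq_fun do rewrite mulN1r addrC.
Qed.

Lemma L2_sum (I : Type) (s : seq I) (F : I -> D -> R) :
  (forall i, F i \in L2) -> (fun x => \sum_(i <- s) F i x) \in L2.
Proof.
move=> F2; elim: s => [|i s ih].
  by under eq_fun do rewrite big_nil; exact: L2_cst.
by under eq_fun do rewrite big_cons; exact: L2D.
Qed.

Lemma L2_integrable u : u \in L2 -> mu.-integrable setT (EFin \o u).
Proof.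
move=> u2; apply/Lfun1_integrable; apply: Lfun_subset12 => //.
exact: fin_num_measure.
Qed.

Lemma L2_mul_integrable u v : u \in L2 -> v \in L2 ->
  mu.-integrable setT (fun x => (u x * v x)%:E).
Proof. by move=> u2 v2; have /Lfun1_integrable := Lfun2_mul_Lfun1 u2 v2. Qed.

Lemma L2_dom u v : measurable_fun setT u -> v \in L2 ->
  (\forall x \ae mu, `|u x| <= `|v x|) -> u \in L2.
Proof.
move=> mu_ /L2P[mv /integrableP[_ iv]] uv; apply/L2P; split => //.
apply/integrableP; split.
  by apply/measurable_EFinP; exact: measurable_funX.
apply: le_lt_trans iv; apply: ae_ge0_le_integral => //.
- by apply: measurableT_comp => //; apply/measurable_EFinP; exact: measurable_funX.
- by apply: measurableT_comp => //; apply/measurable_EFinP; exact: measurable_funX.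
apply: filterS uv => x uvx _ /=.
by rewrite lee_fin !normrX lerXn2r ?nnegrE.
Qed.

Lemma L2_ae u v : measurable_fun setT u -> v \in L2 ->
  u = v %[ae mu] -> u \in L2.
Proof. by move=> m v2 uv; apply: L2_dom v2 _ => //; apply: filterS uv => x /(_ I) ->. Qed.

Lemma L2_bounded u (s : R) : measurable_fun setT u ->
  (forall x, `|u x| <= s) -> u \in L2.
Proof.
move=> m us; apply: (L2_dom m (L2_cst s)); apply/nearW => x.
by rewrite (le_trans (us x))// ler_norm.
Qed.

Lemma Rintegral_ae u v : measurable_fun setT u -> measurable_fun setT v ->
  u = v %[ae mu] -> \int[mu]_x u x = \int[mu]_x v x.
Proof.
move=> mu_ mv uv; congr fine; apply: ae_eq_integral => //.
- exact/measurable_EFinP.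
- exact/measurable_EFinP.
by apply: filterS uv => x + xT => /(_ xT) ->.
Qed.

Lemma le_Rintegral_ae u v : mu.-integrable setT (EFin \o u) ->
  mu.-integrable setT (EFin \o v) -> (\forall x \ae mu, u x <= v x) ->
  \int[mu]_x u x <= \int[mu]_x v x.
Proof.
move=> iu iv uv.
have mu_ : measurable_fun setT u by apply/measurable_EFinP; exact: measurable_int iu.
have mv : measurable_fun setT v by apply/measurable_EFinP; exact: measurable_int iv.
have -> : \int[mu]_x u x = \int[mu]_x (Num.min (u x) (v x)).
  apply: Rintegral_ae => //; first exact: measurable_minr.
  by apply: filterS uv => x uvx _; rewrite min_l.
apply: le_Rintegral => // [|x _]; last by rewrite ge_min lexx orbT.
apply: (@le_integrable _ _ _ mu _ measurableT _ (fun x => (`|u x| + `|v x|)%:E)) => //.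
- by apply/measurable_EFinP; exact: measurable_minr.
- move=> x _ /=; rewrite lee_fin (ger0_norm (addr_ge0 _ _))//.
  by rewrite /Num.min; case: ifPn => _; rewrite ?lerDl ?lerDr.
- have := @integrableD _ _ _ mu _ measurableT _ _ (integrable_norm iu) (integrable_norm iv).
  by apply: eq_integrable.
Qed.

Lemma ip_ae u u' v v' : u \in L2 -> u' \in L2 -> v \in L2 -> v' \in L2 ->
  u = u' %[ae mu] -> v = v' %[ae mu] -> ip u v = ip u' v'.
Proof.
move=> /Lfun_measurable ? /Lfun_measurable ? /Lfun_measurable ? /Lfun_measurable ?.
move=> h1 h2; apply: Rintegral_ae; [exact: measurable_funM..|].
by apply: filterS2 h1 h2 => x + + xT => /(_ xT) -> /(_ xT) ->.
Qed.

Lemma ipC u v : ip u v = ip v u.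
Proof. by apply: eq_Rintegral => x _; rewrite mulrC. Qed.

Lemma ip_linl (a : R) u v w : u \in L2 -> v \in L2 -> w \in L2 ->
  ip (fun x => a * u x + v x) w = a * ip u w + ip v w.
Proof.
move=> u2 v2 w2; have iu := L2_mul_integrable u2 w2; have iv := L2_mul_integrable v2 w2.
rewrite /L2_inner -RintegralZl// -RintegralD//.
- by apply: eq_Rintegral => x _; rewrite mulrDl mulrA.
- have := @integrableZl _ _ _ mu _ measurableT a _ iu.
  exact: eq_integrable.
Qed.

Lemma ip_linr (a : R) u v w : u \in L2 -> v \in L2 -> w \in L2 ->
  ip w (fun x => a * u x + v x) = a * ip w u + ip w v.
Proof. by move=> *; rewrite ipC ip_linl// !(ipC _ w). Qed.

Lemma ipDl u v w : u \in L2 -> v \in L2 -> w \in L2 ->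
  ip (fun x => u x + v x) w = ip u w + ip v w.
Proof.
move=> u2 v2 w2; rewrite -[ip u w]mul1r -ip_linl//.
by under eq_fun do rewrite -[u _]mul1r.
Qed.

Lemma ipBl u v w : u \in L2 -> v \in L2 -> w \in L2 ->
  ip (fun x => u x - v x) w = ip u w - ip v w.
Proof.
move=> u2 v2 w2; have := ip_linl (-1) v2 u2 w2.
by under eq_fun do rewrite mulN1r addrC; move=> ->; rewrite mulN1r addrC.
Qed.

Lemma ipBr u v w : u \in L2 -> v \in L2 -> w \in L2 ->
  ip w (fun x => u x - v x) = ip w u - ip w v.
Proof. by move=> *; rewrite ipC ipBl// !(ipC _ w). Qed.

Lemma ipZl (a : R) u w : u \in L2 -> w \in L2 ->
  ip (fun x => a * u x) w = a * ip u w.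
Proof.
move=> u2 w2; rewrite /L2_inner -RintegralZl//; last exact: L2_mul_integrable.
by apply: eq_Rintegral => x _; rewrite mulrA.
Qed.

Lemma ip_ge0 u : 0 <= ip u u.
Proof. by apply: Rintegral_ge0 => x _; rewrite -expr2 sqr_ge0. Qed.

Definition L2norm u : R := Num.sqrt (ip u u).
Local Notation n2 := L2norm.

Lemma L2norm_ge0 u : 0 <= n2 u. Proof. exact: sqrtr_ge0. Qed.

Lemma sqr_L2norm u : n2 u ^+ 2 = ip u u.
Proof. by rewrite sqr_sqrtr// ip_ge0. Qed.

Lemma le_L2norm u (c : R) : 0 <= c -> ip u u <= c ^+ 2 -> n2 u <= c.
Proof. by move=> c0 /ler_wsqrtr; rewrite sqrtr_sqr ger0_norm. Qed.

Lemma L2norm_ae u v : u \in L2 -> v \in L2 -> u = v %[ae mu] -> n2 u = n2 v.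
Proof. by move=> u2 v2 uv; rewrite /n2 (ip_ae u2 v2 u2 v2). Qed.

Lemma L2normZ (a : R) u : u \in L2 -> n2 (fun x => a * u x) = `|a| * n2 u.
Proof.
move=> u2; rewrite /n2 ipZl//; last exact: L2Z.
by rewrite ipC ipZl// mulrA -expr2 sqrtrM ?sqr_ge0// sqrtr_sqr.
Qed.

Lemma Lnorm2E u : u \in L2 -> 'N[mu]_2%:E[EFin \o u]%E = (n2 u)%:E.
Proof.
move=> /[dup] u2 /L2P[_ iu]; rewrite unlock /Lnorm /n2 -powR12_sqrt ?ip_ge0//.
rewrite -poweR_EFin; congr (_ `^ _)%E; rewrite /L2_inner /Rintegral fineK.
  by apply: eq_integral => x _ /=; rewrite powR_mulrn// real_normK ?num_real// expr2.
by have := integrable_fin_num measurableT iu.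
Qed.

Lemma L2norm_eq0 u : u \in L2 -> n2 u = 0 -> u = cst 0 %[ae mu].
Proof.
move=> u2 u0; have := @Lnorm_eq0_eq0 _ _ _ mu (EFin \o u) 2%:E.
rewrite Lnorm2E// u0 => h.
have /measurable_EFinP mu_ := Lfun_measurable u2.
by apply: filterS (h mu_ _ erefl) => [x + xT|]; [move=> /(_ xT) []|rewrite lte_fin].
Qed.

Lemma cauchy_schwarz u v : u \in L2 -> v \in L2 -> `|ip u v| <= n2 u * n2 v.
Proof.
move=> u2 v2; have iuv := L2_mul_integrable u2 v2.
have := @hoelder _ _ _ mu u v 2 2 (Lfun_measurable u2) (Lfun_measurable v2).
rewrite !Lnorm2E// Lnorm1 -EFinM => h.
have {}h := h ltac:(done) ltac:(done) (ltac:(by rewrite [RHS]splitr !div1r)).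
rewrite -lee_fin (le_trans _ h)// /L2_inner EFin_normr_Rintegral//.
by apply: le_abse_integral => //; exact: measurable_int iuv.
Qed.

Lemma ip_le_L2norm u v : u \in L2 -> v \in L2 -> ip u v <= n2 u * n2 v.
Proof. by move=> u2 v2; apply: le_trans (ler_norm _) _; exact: cauchy_schwarz. Qed.

Lemma L2normD u v : u \in L2 -> v \in L2 -> n2 (fun x => u x + v x) <= n2 u + n2 v.
Proof.
move=> u2 v2; apply: le_L2norm; first by rewrite addr_ge0 ?L2norm_ge0.
have uv2 := L2D u2 v2.
rewrite ipDl// ![ip _ (fun x => u x + v x)]ipC !ipDl// (ipC v u) sqrrD !sqr_L2norm.
by have := ip_le_L2norm u2 v2; lra.
Qed.

Lemma L2normB u v : u \in L2 -> v \in L2 -> n2 (fun x => u x - v x) <= n2 u + n2 v.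
Proof.
move=> u2 v2; have := L2normD u2 (L2Z (-1) v2); rewrite L2normZ// normrN1 mul1r.
by under eq_fun do rewrite mulN1r.
Qed.

Lemma Rintegral_prob_cst (c : R) : \int[mu]__ c = c.
Proof. by rewrite Rintegral_cst//= probability_setT/= mulr1. Qed.

Lemma L2norm_cst (c : R) : n2 (fun=> c) = `|c|.
Proof.
rewrite /n2 /L2_inner Rintegral_prob_cst -expr2.
exact: sqrtr_sqr.
Qed.

Lemma norm_int_le_L2norm u : u \in L2 -> `|\int[mu]_x u x| <= n2 u.
Proof.
move=> u2; have := cauchy_schwarz u2 (L2_cst 1); rewrite L2norm_cst normr1 mulr1.
by rewrite /L2_inner; under eq_Rintegral do rewrite mulr1.
Qed.

Lemma L2norm_le u v : u \in L2 -> v \in L2 ->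
  (\forall x \ae mu, `|u x| <= `|v x|) -> n2 u <= n2 v.
Proof.
move=> u2 v2 uv; apply: ler_wsqrtr; apply: le_Rintegral_ae.
- exact: L2_mul_integrable.
- exact: L2_mul_integrable.
apply: filterS uv => x uvx.
by rewrite -!expr2 -[leLHS]real_normK ?num_real// -[leRHS]real_normK ?num_real// lerXn2r ?nnegrE.
Qed.

Lemma L2norm_sum (I : Type) (s : seq I) (F : I -> D -> R) : (forall i, F i \in L2) ->
  n2 (fun x => \sum_(i <- s) F i x) <= \sum_(i <- s) n2 (F i).
Proof.
move=> F2; elim: s => [|i s ih].
  by under eq_fun do rewrite big_nil; rewrite big_nil L2norm_cst normr0.
under eq_fun do rewrite big_cons; rewrite big_cons.
by rewrite (le_trans (L2normD _ _))// ?lerD2l//; exact: L2_sum.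
Qed.

End L2_space.

(** * Integration against kernels *)

Section weighted_kernel_integral.
Context (R : realType) (d : measure_display) (D : measurableType d).
Local Open Scope ereal_scope.
Import HBNNSimple.

Lemma weighted_kernel_integral_cvg (dW : measure_display) (W : measurableType dW)
    (m : {measure set W -> \bar R}) (w : W -> R)
    (k : W -> {measure set D -> \bar R}) (u : D -> \bar R)
    (mu : measurable_fun setT u) :
  measurable_fun setT w -> (forall x, 0 <= w x)%R ->
  (forall A, measurable A -> measurable_fun setT (k ^~ A)) ->
  (forall x, 0 <= u x) ->
  \sum_(r \in range (nnsfun_approx measurableT mu n))
    r%:E * \int[m]_x ((w x)%:E * k x (nnsfun_approx measurableT mu n @^-1` [set r]))
    @[n --> \oo] --> \int[m]_x ((w x)%:E * \int[k x]_y u y).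
Proof.
move=> mw w0 mk u0; pose g := nnsfun_approx measurableT mu.
have mEw : measurable_fun setT (EFin \o w) by exact/measurable_EFinP.
have mg n : measurable_fun setT (fun x => \int[k x]_y (g n y)%:E).
  by apply: measurable_fun_integral_kernel => //; [move=> z; rewrite lee_fin|exact/measurable_EFinP].
have g0 n y : 0 <= (g n y)%:E by rewrite lee_fin.
have mgE n : measurable_fun setT (fun y => (g n y)%:E) by exact/measurable_EFinP.
have ndg y : {homo (fun n => (g n y)%:E) : a b / (a <= b)%O >-> a <= b}.
  by move=> a b ab; rewrite lee_fin; exact/lefP/nd_nnsfun_approx.
rewrite (_ : (fun n => _) = (fun n => \int[m]_x ((w x)%:E * \int[k x]_y (g n y)%:E))).
  rewrite [X in _ --> X](_ : _ = \int[m]_x limn (fun n => (w x)%:E * \int[k x]_y (g n y)%:E)).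
    apply: cvg_monotone_convergence => //.
    - by move=> n; exact: emeasurable_funM.
    - by move=> n x _; rewrite mule_ge0 ?lee_fin// integral_ge0// => y _.
    - move=> x _ a b ab; rewrite lee_wpmul2l ?lee_fin//; apply: ge0_le_integral => //.
      by move=> y _; exact: ndg.
  apply: eq_integral => x _; apply/esym/cvg_lim => //.
  apply: cvgeZl => //.
  rewrite [X in _ --> X](_ : _ = \int[k x]_y limn (fun n => (g n y)%:E)).
    by apply: cvg_monotone_convergence => // y _; exact: ndg.
  by apply: eq_integral => y _; apply/esym/cvg_lim => //; exact: cvg_nnsfun_approx.
apply/funext => n.
transitivity (\int[m]_x \sum_(r \in range (g n)) ((w x)%:E * (r%:E * k x (g n @^-1` [set r])))).
  have mp r : measurable_fun setT (fun x => k x (g n @^-1` [set r])) by exact: mk.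
  rewrite ge0_integral_fsum//.
  - apply: eq_fsbigr => r /[!inE] -[y _ <-].
    rewrite -ge0_integralZl//.
    + by apply: eq_integral => x _; rewrite muleCA.
    + exact: emeasurable_funM.
    + by move=> x _; rewrite mule_ge0// lee_fin.
  - by move=> r; apply: emeasurable_funM => //; exact: emeasurable_funM.
  - by move=> r x _; rewrite mule_ge0 ?lee_fin//; exact: nnsfun_mulemu_ge0.
apply: eq_integral => x _; rewrite integralT_nnsfun sintegralE ge0_mule_fsumr//.
by move=> r; exact: nnsfun_mulemu_ge0.
Qed.

(* Monotone-class principle: an identity between two weighted kernel integrals
   only has to be checked on indicator functions. *)
Lemma eq_weighted_kernel_integral (d1 d2 : measure_display)
    (W1 : measurableType d1) (W2 : measurableType d2)
    (m1 : {measure set W1 -> \bar R}) (m2 : {measure set W2 -> \bar R})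
    (w1 : W1 -> R) (w2 : W2 -> R)
    (k1 : W1 -> {measure set D -> \bar R}) (k2 : W2 -> {measure set D -> \bar R})
    (u : D -> \bar R) :
  measurable_fun setT w1 -> (forall x, 0 <= w1 x)%R ->
  (forall A, measurable A -> measurable_fun setT (k1 ^~ A)) ->
  measurable_fun setT w2 -> (forall x, 0 <= w2 x)%R ->
  (forall A, measurable A -> measurable_fun setT (k2 ^~ A)) ->
  (forall A, measurable A -> \int[m1]_x ((w1 x)%:E * k1 x A) =
                             \int[m2]_x ((w2 x)%:E * k2 x A)) ->
  measurable_fun setT u -> (forall x, 0 <= u x) ->
  \int[m1]_x ((w1 x)%:E * \int[k1 x]_y u y) =
  \int[m2]_x ((w2 x)%:E * \int[k2 x]_y u y).
Proof.
move=> mw1 w10 mk1 mw2 w20 mk2 h mu u0.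
have h1 := @weighted_kernel_integral_cvg _ _ m1 w1 k1 u mu mw1 w10 mk1 u0.
have h2 := @weighted_kernel_integral_cvg _ _ m2 w2 k2 u mu mw2 w20 mk2 u0.
apply: (cvg_unique _ h1 _) => //; apply: cvg_trans h2; apply: near_eq_cvg.
apply: nearW => n; apply: eq_fsbigr => r _; congr (_ * _); apply/esym/h.
exact: measurable_funPTI.
Qed.

Lemma eq_kernel_integral_eval (d1 d2 : measure_display)
    (W1 : measurableType d1) (W2 : measurableType d2)
    (m1 : {measure set W1 -> \bar R}) (m2 : {measure set W2 -> \bar R})
    (w1 : W1 -> R) (w2 : W2 -> R)
    (k1 : W1 -> {measure set D -> \bar R}) (phi : W2 -> D) (u : D -> \bar R) :
  measurable_fun setT w1 -> (forall x, 0 <= w1 x)%R ->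
  (forall A, measurable A -> measurable_fun setT (k1 ^~ A)) ->
  measurable_fun setT w2 -> (forall x, 0 <= w2 x)%R ->
  measurable_fun setT phi ->
  (forall A, measurable A -> \int[m1]_x ((w1 x)%:E * k1 x A) =
                             \int[m2]_x ((w2 x)%:E * (\1_A (phi x))%:E)) ->
  measurable_fun setT u -> (forall x, 0 <= u x) ->
  \int[m1]_x ((w1 x)%:E * \int[k1 x]_y u y) = \int[m2]_x ((w2 x)%:E * u (phi x)).
Proof.
move=> mw1 w10 mk1 mw2 w20 mphi h mu u0.
have -> : \int[m2]_x ((w2 x)%:E * u (phi x)) =
    \int[m2]_x ((w2 x)%:E * \int[\d_(phi x)]_y u y).
  by apply: eq_integral => x _; rewrite integral_dirac// diracT mul1e.
apply: (@eq_weighted_kernel_integral _ _ _ _ m1 m2 w1 w2 k1 (fun x => \d_(phi x))) => // A mA.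
exact: (measurableT_comp (measurable_fun_dirac mA)).
Qed.

End weighted_kernel_integral.

(** * Interpolation between L2 and bounded functions *)

Section power_representation.
Context (R : realType).
Implicit Types (r a t : R).

Definition excess (a s : R) : R := Num.max (a - s) 0.

Lemma excess_ge0 a s : 0 <= excess a s.
Proof. by rewrite /excess le_max lexx orbT. Qed.

Lemma cvg_expRNM_y (c : R) : 0 < c -> expR (- (c * t)) @[t --> +oo] --> (0 : R).
Proof.
move=> c0; apply: (@cvg_comp _ _ _ (fun t => c * t) (fun t => expR (- t))).
  exact: (gt0_cvgMry c0 cvg_id).
exact: cvgr_expR.
Qed.

Definition power_const r : R := (r - 2)^-1 - 2 / (r - 1) + r^-1.

Lemma power_constE r : 2 < r -> power_const r = 2 / (r * (r - 1) * (r - 2)).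
Proof.
move=> r2; rewrite /power_const; field.
by apply/and3P; split; rewrite gt_eqF// ?subr_gt0; lra.
Qed.

(* Taylor's formula with integral remainder for [a `^ r], up to the
   substitution [s = expR (- t)]. *)
Lemma integral_excess_power r a : 2 < r -> 0 <= a ->
  (\int[lebesgue_measure]_t
     (expR (- ((r - 2) * t)) * excess a (expR (- t)) ^+ 2)%:E =
   (power_const r * a `^ r)%:E)%E.
Proof.
move=> r2; rewrite le_eqVlt => /predU1P[<-|a0].
  rewrite powR0 ?mulr0; last by rewrite gt_eqF//; lra.
  rewrite integral0_eq// => t _; rewrite /excess.
  by rewrite max_r ?expr0n ?mulr0// subr_le0 expR_ge0.
pose F t : R := - a ^+ 2 / (r - 2) * expR (- ((r - 2) * t))
  + 2 * a / (r - 1) * expR (- ((r - 1) * t)) - r^-1 * expR (- (r * t)).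
pose f t := expR (- ((r - 2) * t)) * (a - expR (- t)) ^+ 2.
have dF t : is_derive t 1 F (f t).
  have dE (c : R) : is_derive t 1 (fun t => expR (- (c * t))) (- c * expR (- (c * t))).
    have dl : is_derive t 1 (fun t => - (c * t)) (- c).
      apply: is_derive_eq.
      by rewrite /GRing.scale/= mulr1.
    by rewrite mulrC; exact: (is_derive1_comp (is_derive_expR _) dl).
  have d1 := dE (r - 2); have d2 := dE (r - 1); have d3 := dE r.
  have e2 : expR (- ((r - 1) * t)) = expR (- ((r - 2) * t)) * expR (- t).
    by rewrite -expRD; congr expR; ring.
  have e3 : expR (- (r * t)) = expR (- ((r - 2) * t)) * expR (- t) ^+ 2.
    by rewrite expr2 mulrA -!expRD; congr expR; ring.
  apply: is_derive_eq.
  rewrite /f e2 e3 /GRing.scale/=; field.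
  by apply/and3P; split; rewrite gt_eqF// ?subr_gt0; lra.
have -> : (\int[lebesgue_measure]_t
     (expR (- ((r - 2) * t)) * excess a (expR (- t)) ^+ 2)%:E =
     \int[lebesgue_measure]_(t in `[(- ln a)%R, +oo[) (f t)%:E)%E.
  rewrite [RHS]integral_mkcond; apply: eq_integral => t _.
  rewrite patchE; case: ifPn => [|].
    rewrite inE/= in_itv/= andbT => h; congr (_ * _ ^+ 2)%:E.
    by rewrite /excess max_l// subr_ge0 -[leRHS]lnK ?posrE// ler_expR; lra.
  move/negP; rewrite inE/= in_itv/= andbT => /negP; rewrite -ltNge => h.
  rewrite /excess max_r ?expr0n ?mulr0// subr_le0 -[leLHS]lnK ?posrE// ler_expR; lra.
rewrite (@ge0_continuous_FTC2y _ f F (- ln a) 0).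
- rewrite -EFinB sub0r; congr EFin.
  have e (c : R) : expR (- (c * - ln a)) = a `^ c.
    by rewrite mulrN opprK /powR gt_eqF.
  have p1 : a `^ (r - 1) = a `^ r / a.
    by rewrite powRB ?(gt_eqF a0) ?implybT// powRr1// ltW.
  rewrite /F !e p1 powRB ?(gt_eqF a0) ?implybT//.
  have a2 : a `^ 2 = a ^+ 2 by rewrite powR_mulrn// ltW.
  rewrite a2 /power_const; field.
  by apply/and4P; split; rewrite gt_eqF// ?subr_gt0; lra.
- by move=> t _; rewrite mulr_ge0 ?expR_ge0// sqr_ge0.
- have cf : continuous f.
    move=> t; apply: cvgM.
      by apply: continuous_comp; [apply: cvgN; exact: mulrl_continuous|exact: continuous_expR].
    rewrite /continuous_at; apply: cvgM; (apply: cvgB; first exact: cvg_cst);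
      by apply: continuous_comp; [exact: opp_continuous|exact: continuous_expR].
  exact: continuous_subspaceT.
- rewrite [X in _ --> X](_ : _ = - a ^+ 2 / (r - 2) * 0 + 2 * a / (r - 1) * 0 - r^-1 * 0); last by ring.
  apply: cvgB; first apply: cvgD; (apply: cvgM; [exact: cvg_cst|apply: cvg_expRNM_y; lra]).
- by move=> t _; have := dF t => -[].
- apply: cvg_at_right_filter; apply: differentiable_continuous.
  by apply/derivable1_diffP; have := dF (- ln a) => -[].
- by move=> t _; rewrite derive1E; have := dF t => ?; rewrite derive_val.
Qed.

Lemma power_const_gt0 r : 2 < r -> 0 < power_const r.
Proof. by move=> r2; rewrite power_constE// divr_gt0// !mulr_gt0//; lra. Qed.

End power_representation.

Section markov_like.
Context (R : realType) (d : measure_display) (D : measurableType d).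
Variable mu : probability D R.
Implicit Types u v : D -> R.
Local Notation L2 := (Lfun mu 2%:E).
Local Notation n2 := (L2norm mu).
Local Notation ip := (L2_inner mu).

(* What the Markov operator and its adjoint have in common. *)
Record markov_like (T : (D -> R) -> (D -> R)) (b : R) : Prop := MarkovLike {
  ml_ge0 : 0 <= b;
  ml_L2 : forall u, u \in L2 -> T u \in L2;
  ml_lin : forall (a : R) u v, u \in L2 -> v \in L2 ->
    T (fun x => a * u x + v x) = (fun x => a * T u x + T v x) %[ae mu];
  ml_one : T (cst 1) = cst 1 %[ae mu];
  ml_bound : forall (s : R) u, 0 <= s -> u \in L2 ->
    (\forall x \ae mu, `|u x| <= s) -> \forall x \ae mu, `|T u x| <= s;
  ml_int : forall u, u \in L2 -> \int[mu]_x T u x = \int[mu]_x u x;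
  ml_gap : forall u, L20 mu u -> n2 (T u) <= b * n2 u }.

Lemma L20_L2 u : L20 mu u -> u \in L2. Proof. by case. Qed.

Lemma L20_0 : L20 mu (fun=> 0).
Proof. by split; [exact: L2_cst|rewrite Rintegral_prob_cst]. Qed.

Lemma L20_center u : u \in L2 -> L20 mu (fun x => u x - \int[mu]_y u y).
Proof.
move=> u2; split; first exact: L2B u2 (L2_cst _ _).
rewrite RintegralB//; first by rewrite Rintegral_prob_cst subrr.
- exact: L2_integrable.
- exact: L2_integrable (L2_cst _ _).
Qed.

Lemma L2norm_center u : u \in L2 -> n2 (fun x => u x - \int[mu]_y u y) <= n2 u.
Proof.
move=> u2; apply: ler_wsqrtr; set c := \int[mu]_y u y.
have c2 := L2_cst mu c; have uc2 := L2B u2 c2.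
rewrite (ipBl u2 c2 uc2) !(ipBr _ c2) ?u2 ?c2//.
have e v : v \in L2 -> ip (fun=> c) v = c * \int[mu]_y v y.
  by move=> v2; rewrite /L2_inner RintegralZl//; exact: L2_integrable.
rewrite (ipC mu u (fun=> c)) !e// -/c Rintegral_prob_cst.
by rewrite subrr subr0 gerBl -expr2 sqr_ge0.
Qed.

Lemma L20_lin (a : R) u v : L20 mu u -> L20 mu v -> L20 mu (fun x => a * u x + v x).
Proof.
move=> [u2 u0] [v2 v0]; split; first exact: L2_lin.
rewrite RintegralD ?RintegralZl ?u0 ?v0 ?mulr0 ?addr0//; try exact: L2_integrable.
exact: L2_integrable (L2Z _ _).
Qed.

Section operations.
Variables (T : (D -> R) -> (D -> R)) (b : R).
Hypothesis hT : markov_like T b.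

Lemma ml_L20 u : L20 mu u -> L20 mu (T u).
Proof. by move=> [u2 u0]; split; [exact: (ml_L2 hT)|rewrite (ml_int hT)]. Qed.

Lemma mlB u v : u \in L2 -> v \in L2 ->
  T (fun x => u x - v x) = (fun x => T u x - T v x) %[ae mu].
Proof.
move=> u2 v2; have := ml_lin hT (-1) v2 u2.
under [X in T X]eq_fun do rewrite mulN1r addrC.
by apply: filterS => x + xT => /(_ xT) ->; rewrite mulN1r addrC.
Qed.

Lemma ml_cst (c : R) : T (fun=> c) = (fun=> c) %[ae mu].
Proof.
have T0 : T (fun=> 0) = (fun=> 0) %[ae mu].
  have /(_ 0 (lexx 0) (L2_cst _ _)) h := ml_bound hT (u := fun=> 0).
  apply: filterS (h _); last by apply/nearW => x; rewrite normr0.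
  by move=> x + _; rewrite normr_le0 => /eqP.
have := ml_lin hT c (L2_cst mu 1) (L2_cst mu 0).
under [X in T X]eq_fun do rewrite mulr1 addr0.
apply: filterS3 T0 (ml_one hT) => x h1 h2 + xT => /(_ xT) ->.
by rewrite h1// h2// mulr1 addr0.
Qed.

Lemma ml_ae u v : u \in L2 -> v \in L2 -> u = v %[ae mu] -> T u = T v %[ae mu].
Proof.
move=> u2 v2 uv; have uv2 := L2B u2 v2.
have /(_ 0 (lexx 0) uv2) h := ml_bound hT (u := (fun x => u x - v x)).
have {}h : \forall x \ae mu, `|T (fun x => u x - v x) x| <= 0.
  by apply: h; apply: filterS uv => x /(_ I) ->; rewrite subrr normr0.
apply: filterS2 h (mlB u2 v2) => x + h2 xT.
by rewrite h2// normr_le0 subr_eq0 => /eqP.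
Qed.

Definition centered_op u : D -> R := fun x => T u x - \int[mu]_y u y.
Local Notation cT := centered_op.

Lemma centered_op_L2 u : u \in L2 -> cT u \in L2.
Proof. by move=> u2; exact: L2B (ml_L2 hT u2) (L2_cst _ _). Qed.

Lemma centered_opD u v : u \in L2 -> v \in L2 ->
  cT (fun x => u x + v x) = (fun x => cT u x + cT v x) %[ae mu].
Proof.
move=> u2 v2; have := ml_lin hT 1 u2 v2.
under [X in T X]eq_fun do rewrite mul1r.
apply: filterS => x + xT => /(_ xT) h; rewrite /cT h mul1r RintegralD//; try exact: L2_integrable.
by rewrite opprD addrACA.
Qed.

Lemma centered_op_gap u : u \in L2 -> n2 (cT u) <= b * n2 u.
Proof.
move=> u2; have uc := L20_center u2.
apply: (le_trans _ (ler_wpM2l (ml_ge0 hT) (L2norm_center u2))).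
apply: le_trans (ml_gap hT uc).
rewrite le_eqVlt; apply/orP; left; apply/eqP; apply: L2norm_ae.
- exact: centered_op_L2.
- exact: (ml_L2 hT (L20_L2 uc)).
apply: filterS2 (mlB u2 (L2_cst mu (\int[mu]_y u y))) (ml_cst (\int[mu]_y u y)).
by move=> x h1 h2 xT; rewrite h1// h2.
Qed.

Lemma centered_op_bound (s : R) u : 0 <= s -> u \in L2 ->
  (\forall x \ae mu, `|u x| <= s) -> \forall x \ae mu, `|cT u x| <= 2 * s.
Proof.
move=> s0 u2 us.
have h : `|\int[mu]_y u y| <= s.
  rewrite (le_trans (norm_int_le_L2norm u2))// -[leRHS](ger0_norm s0) -(L2norm_cst mu s).
  apply: L2norm_le => //; first exact: L2_cst.
  by apply: filterS us => x; rewrite (ger0_norm s0).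
apply: filterS (ml_bound hT s0 u2 us) => x hx.
by rewrite (le_trans (ler_normB _ _))// mulr_natl mulr2n lerD.
Qed.

End operations.

Lemma markov_like_id : markov_like id 1.
Proof. by split => // *; rewrite ?mul1r//; apply/nearW. Qed.

Lemma markov_like_comp T1 T2 b1 b2 : markov_like T1 b1 -> markov_like T2 b2 ->
  markov_like (T1 \o T2) (b1 * b2).
Proof.
move=> h1 h2; split.
- by rewrite mulr_ge0 ?(ml_ge0 h1) ?(ml_ge0 h2).
- by move=> u u2; exact: (ml_L2 h1 (ml_L2 h2 u2)).
- move=> a u v u2 v2.
  have Tu2 := ml_L2 h2 u2; have Tv2 := ml_L2 h2 v2.
  apply: filterS2 (ml_ae h1 (ml_L2 h2 (L2_lin a u2 v2)) (L2_lin a Tu2 Tv2) (ml_lin h2 a u2 v2))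
    (ml_lin h1 a Tu2 Tv2).
  by move=> x /= e1 e2 xT; rewrite e1// e2.
- apply: filterS2 (ml_ae h1 (ml_L2 h2 (L2_cst _ 1)) (L2_cst _ 1) (ml_one h2)) (ml_one h1).
  by move=> x /= e1 e2 xT; rewrite e1// e2.
- move=> s u s0 u2 us; exact: (ml_bound h1 s0 (ml_L2 h2 u2) (ml_bound h2 s0 u2 us)).
- by move=> u u2; rewrite /= (ml_int h1 (ml_L2 h2 u2)) (ml_int h2).
- move=> u u0; rewrite -mulrA (le_trans (ml_gap h1 (ml_L20 h2 u0)))//.
  by rewrite ler_wpM2l ?(ml_ge0 h1) ?(ml_gap h2).
Qed.

Lemma markov_like_iter T b m : markov_like T b -> markov_like (iter m T) (b ^+ m).
Proof.
move=> hT; elim: m => [|m ih]; first exact: markov_like_id.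
by rewrite exprS; exact: (markov_like_comp hT ih).
Qed.

End markov_like.

Section interpolation.
Context (R : realType) (d : measure_display) (D : measurableType d).
Variable mu : probability D R.
Implicit Types u v : D -> R.
Local Notation L2 := (Lfun mu 2%:E).
Local Notation n2 := (L2norm mu).
Local Notation ip := (L2_inner mu).
Variables (T : (D -> R) -> (D -> R)) (b : R).
Hypothesis hT : markov_like mu T b.
Local Notation cT := (centered_op mu T).

Lemma measurable_excess u (s : R) : measurable_fun setT u ->
  measurable_fun setT (fun x => excess `|u x| s).
Proof.
move=> mu_; apply: measurable_maxr => //; apply: measurable_funB => //.
exact: measurableT_comp.
Qed.

Lemma excess_L2 u (s : R) : 0 <= s -> u \in L2 -> (fun x => excess `|u x| s) \in L2.
Proof.
move=> s0 u2; apply: (L2_dom _ u2); first exact/measurable_excess/(Lfun_measurable u2).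
apply/nearW => x; rewrite ger0_norm ?excess_ge0// /excess ge_max normr_ge0 andbT.
by rewrite gerBl.
Qed.

(* Splitting [u] at height [s], the bounded part is mapped below [2 * s], so
   only the excess of [u] contributes to the excess of [cT u] over [2 * s]. *)
Lemma excess_centered_op u (s : R) : 0 <= s -> u \in L2 ->
  n2 (fun x => excess `|cT u x| (2 * s)) <= b * n2 (fun x => excess `|u x| s).
Proof.
move=> s0 u2; have mu_ := Lfun_measurable u2.
pose u1 x := Num.max (- s) (Num.min s (u x)).
have mu1 : measurable_fun setT u1.
  by apply: measurable_maxr => //; exact: measurable_minr.
have u1s x : `|u1 x| <= s.
  by rewrite ler_norml /u1 le_max lexx/= ge_max ge_min lexx/= andbT; lra.
have u12 : u1 \in L2 by exact: L2_bounded mu1 u1s.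
pose u0 x := u x - u1 x; have u02 : u0 \in L2 by exact: L2B.
have u0e x : `|u0 x| = excess `|u x| s.
  rewrite /u0 /u1 /excess.
  case: (lerP (u x) s) => h1; case: (lerP (- s) _) => h2;
    case: (ger0P (u x)) => h3; case: (lerP _ 0) => h4;
    try (rewrite ger0_norm; lra); try (rewrite ler0_norm; lra); try lra.
have cT2 := centered_op_L2 hT u2.
apply: (@le_trans _ _ (n2 (cT u0))); last first.
  rewrite (le_trans (centered_op_gap hT u02))// ler_wpM2l ?(ml_ge0 hT)//.
  apply: L2norm_le => //; first exact: excess_L2.
  by apply/nearW => x; rewrite u0e [leRHS]ger0_norm ?excess_ge0.
apply: L2norm_le; [apply: excess_L2 => //; lra|exact: (centered_op_L2 hT)|].
have e : cT u = (fun x => cT u1 x + cT u0 x) %[ae mu].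
  have := centered_opD hT u12 u02.
  rewrite (_ : (fun x => u1 x + u0 x) = u)//.
  by apply/funext => x; rewrite /u0 addrC subrK.
apply: filterS2 e (centered_op_bound hT s0 u12 (nearW _ u1s)) => x /(_ I) -> h.
rewrite ger0_norm ?excess_ge0// /excess ge_max normr_ge0 andbT.
by rewrite lerBlDl (le_trans (ler_normD _ _))// lerD2r.
Qed.

Lemma centered_op_power (r : R) u : 2 < r -> u \in L2 ->
  (\int[mu]_x (`|cT u x| `^ r)%:E <=
   (2 `^ r * b ^+ 2)%:E * \int[mu]_x (`|u x| `^ r)%:E)%E.
Proof.
move=> r2 u2; have cT2 := centered_op_L2 hT u2.
pose phi (v : D -> R) (z : D * R) : R :=
  expR (- ((r - 2) * z.2)) * excess `|v z.1| (expR (- z.2)) ^+ 2.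
have phi0 v z : 0 <= phi v z by rewrite mulr_ge0 ?expR_ge0// sqr_ge0.
have mphi v : measurable_fun setT v -> measurable_fun setT (EFin \o phi v).
  move=> mv; apply/measurable_EFinP; apply: measurable_funM.
    apply: (measurableT_comp (@measurable_expR R)).
    by apply: measurableT_comp => //; apply: measurable_funM => //; exact: measurable_snd.
  apply: measurable_funX; apply: measurable_maxr => //; apply: measurable_funB => //.
    by apply: measurableT_comp => //; apply: measurableT_comp => //; exact: measurable_fst.
  apply: (measurableT_comp (@measurable_expR R)).
  by apply: measurableT_comp => //; exact: measurable_snd.
have key v : measurable_fun setT v ->
    (\int[lebesgue_measure]_t \int[mu]_x (phi v (x, t))%:E =
     (power_const r)%:E * \int[mu]_x (`|v x| `^ r)%:E)%E.
  move=> mv.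
  rewrite -(@fubini_tonelli _ _ _ _ _ mu (@lebesgue_measure R) (EFin \o phi v) (mphi _ mv)); last first.
    by move=> z; rewrite lee_fin.
  rewrite -ge0_integralZl//.
  - by apply: eq_integral => x _; rewrite -EFinM -integral_excess_power.
  - apply/measurable_EFinP; apply: (@measurableT_comp _ _ _ _ _ _ (@powR R ^~ r)) => //.
    exact: measurableT_comp.
  - by rewrite lee_fin ltW// power_const_gt0.
have inner v t : v \in L2 -> (\int[mu]_x (phi v (x, t))%:E =
     (expR (- ((r - 2) * t)) * n2 (fun x => excess `|v x| (expR (- t))) ^+ 2)%:E)%E.
  move=> v2; have e2 := excess_L2 (expR_ge0 (- t)) v2.
  rewrite sqr_L2norm /L2_inner EFinM /Rintegral fineK; last first.
    exact: (integrable_fin_num measurableT (L2_mul_integrable e2 e2)).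
  rewrite -ge0_integralZl//.
  - by apply: measurable_int (L2_mul_integrable e2 e2).
  - by move=> x _; rewrite lee_fin -expr2 sqr_ge0.
have mT := Lfun_measurable cT2; have mu_ := Lfun_measurable u2.
have mv2 : measurable_fun setT (fun x => 2^-1 * cT u x) by exact: measurable_funM.
have pc0 := power_const_gt0 r2.
have tw : 2 `^ r * 2^-1 `^ r = 1 :> R.
  by rewrite -powRM ?invr_ge0// mulfV ?powR1// gt_eqF.
suff : ((power_const r)%:E * \int[mu]_x (`|2^-1 * cT u x| `^ r)%:E <=
    (b ^+ 2)%:E * ((power_const r)%:E * \int[mu]_x (`|u x| `^ r)%:E))%E.
  rewrite muleCA lee_pmul2l ?lte_fin ?fin_numE//.
  under eq_integral do rewrite normrM powRM// ger0_norm ?invr_ge0// EFinM.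
  rewrite ge0_integralZl//; last first.
    apply/measurable_EFinP; apply: (@measurableT_comp _ _ _ _ _ _ (@powR R ^~ r)) => //.
    exact: measurableT_comp.
  move=> h; rewrite EFinM -muleA; apply: (le_trans _ (lee_wpmul2l _ h)); last first.
    by rewrite lee_fin powR_ge0.
  by rewrite muleA -EFinM tw mul1e.
have mG v : measurable_fun setT v ->
    measurable_fun setT (fun t : R => \int[mu]_x (phi v (x, t))%:E)%E.
  move=> mv; apply: (@measurable_fun_fubini_tonelli_G _ _ _ _ _ mu (EFin \o phi v)) => //.
    exact: mphi.
  by move=> z; rewrite lee_fin.
have G0 v t : (0 <= \int[mu]_x (phi v (x, t))%:E)%E.
  by apply: integral_ge0 => x _; rewrite lee_fin.
rewrite -(key _ mv2) -(key _ mu_) -ge0_integralZl//; last 2 first.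
- exact: mG.
- by rewrite lee_fin sqr_ge0.
apply: ge0_le_integral => //.
- exact: mG.
- by apply: emeasurable_funM => //; exact: mG.
move=> t _; rewrite !inner//; last exact: L2Z.
suff : n2 (fun x => excess `|2^-1 * cT u x| (expR (- t))) <=
    b * n2 (fun x => excess `|u x| (expR (- t))).
  move: (n2 _) (L2norm_ge0 mu (fun x => excess `|2^-1 * cT u x| (expR (- t)))) => N1 N10 N12.
  rewrite -EFinM lee_fin (_ : b ^+ 2 * _ = expR (- ((r - 2) * t)) *
    (b * n2 (fun x => excess `|u x| (expR (- t)))) ^+ 2); last by ring.
  by rewrite ler_wpM2l ?expR_ge0// lerXn2r ?nnegrE// (le_trans N10).
apply: le_trans (excess_centered_op (expR_ge0 (- t)) u2).
apply: L2norm_le.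
- by apply: excess_L2; [exact: expR_ge0|exact: L2Z].
- by apply: excess_L2 => //; rewrite mulr_ge0 ?expR_ge0.
apply/nearW => x; rewrite [leLHS]ger0_norm ?excess_ge0// [leRHS]ger0_norm ?excess_ge0//.
rewrite /excess normrM (@ger0_norm _ 2^-1) ?invr_ge0//.
have e0 := expR_ge0 (- t); have n0 := normr_ge0 (cT u x).
by rewrite ge_max le_max le_max lexx orbT andbT; case: (lerP _ 0) => //=; lra.
Qed.

End interpolation.

(** * The Markov operator and its adjoint *)

Section kernel_probability.
Context (R : realType) (d : measure_display) (D : measurableType d).
Variable K : R.-pker D ~> D.

Definition kernel_prob (x : D) : set D -> \bar R := K x.

HB.instance Definition _ x := Measure.copy (kernel_prob x) (K x).

HB.instance Definition _ x :=
  Measure_isProbability.Build _ _ _ (kernel_prob x) (prob_kernel x).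

End kernel_probability.

Section markov_operator.
Context (R : realType) (d : measure_display) (D : measurableType d).
Variables (K : R.-pker D ~> D) (pi : probability D R).
Hypothesis hpi : stationary K pi.
Implicit Types u v : D -> R.
Local Notation L2 := (Lfun pi 2%:E).
Local Notation n2 := (L2norm pi).
Local Notation ip := (L2_inner pi).
Local Notation P := (markov_op K).

Lemma integral_kernel_stationary (u : D -> \bar R) :
  measurable_fun setT u -> (forall x, (0 <= u x)%E) ->
  (\int[pi]_x \int[K x]_y u y = \int[pi]_x u x)%E.
Proof.
move=> mu u0.
have := @eq_kernel_integral_eval _ _ _ _ _ _ _ pi pi (cst 1) (cst 1) (fun x => K x) id u.
under eq_integral do rewrite mul1e; under [in RHS]eq_integral do rewrite mul1e.
apply => //.
  by move=> A mA; exact: measurable_kernel.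
move=> A mA; under eq_integral do rewrite mul1e.
under [in RHS]eq_integral do rewrite mul1e.
by rewrite hpi// integral_indic// setIT.
Qed.

Lemma ae_kernel (Q : set D) : (\forall y \ae pi, Q y) ->
  \forall x \ae pi, \forall y \ae K x, Q y.
Proof.
move=> [N [mN piN QN]].
have : (\int[pi]_x `|K x N| = 0)%E.
  by under eq_integral do rewrite gee0_abs//; rewrite hpi.
move/(ae_eq_integral_abs pi measurableT (measurable_kernel K N mN)).
by apply: filterS => x /(_ I) KN; exists N.
Qed.

Lemma ae_Lfun_kernel u : u \in L2 -> \forall x \ae pi, u \in Lfun (kernel_prob K x) 2%:E.
Proof.
move=> /L2P[mu iu].
have m2 : measurable_fun setT (fun y => ((u y) ^+ 2)%:E).
  by apply/measurable_EFinP; exact: measurable_funX.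
have mK : measurable_fun setT (fun x => \int[K x]_y ((u y) ^+ 2)%:E)%E.
  apply: measurable_fun_integral_kernel => //.
    by move=> A mA; exact: measurable_kernel.
  by move=> y; rewrite lee_fin sqr_ge0.
have : pi.-integrable setT (fun x => \int[K x]_y ((u y) ^+ 2)%:E)%E.
  apply/integrableP; split => //.
  have i0 x : (0 <= \int[K x]_y ((u y) ^+ 2)%:E)%E.
    by apply: integral_ge0 => y _; rewrite lee_fin sqr_ge0.
  under eq_integral do rewrite gee0_abs//.
  rewrite integral_kernel_stationary//; last by move=> y; rewrite lee_fin sqr_ge0.
  move/integrableP : iu => [_]; under eq_integral do rewrite gee0_abs ?lee_fin ?sqr_ge0//.
  by [].
move/(integrable_ae measurableT); apply: filterS => x /(_ I) fx.
apply/L2P; split => //; apply/integrableP; split => //.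
under eq_integral do rewrite gee0_abs ?lee_fin ?sqr_ge0//.
by rewrite -ge0_fin_numE// integral_ge0// => y _; rewrite lee_fin sqr_ge0.
Qed.

Lemma measurable_markov_op u : measurable_fun setT u -> measurable_fun setT (P u).
Proof.
move=> mu; apply: (measurableT_comp (fine_measurable measurableT)).
under eq_fun do rewrite integralE.
apply: emeasurable_funB; apply: measurable_fun_integral_kernel => //.
- by move=> A mA; exact: measurable_kernel.
- exact/measurable_funepos/measurable_EFinP.
- by move=> A mA; exact: measurable_kernel.
- exact/measurable_funeneg/measurable_EFinP.
Qed.

Lemma sqr_markov_op_le u : u \in L2 ->
  \forall x \ae pi, ((P u x ^+ 2)%:E <= \int[K x]_y (u y ^+ 2)%:E)%E.
Proof.
move=> u2; apply: filterS (ae_Lfun_kernel u2) => x ux2.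
have /L2P[_ /integrable_fin_num] := ux2; move=> /(_ measurableT) f.
rewrite -[leRHS]fineK// lee_fin -[leLHS]real_normK ?num_real//.
rewrite [leRHS](_ : _ = L2norm (kernel_prob K x) u ^+ 2); last first.
  by rewrite sqr_L2norm; congr fine; apply: eq_integral => y _; rewrite expr2.
rewrite lerXn2r ?nnegrE ?L2norm_ge0//.
exact: (norm_int_le_L2norm ux2).
Qed.

Lemma integral_sqr_markov_op u : u \in L2 ->
  (\int[pi]_x (P u x ^+ 2)%:E <= \int[pi]_x (u x ^+ 2)%:E)%E.
Proof.
move=> u2; have mu := Lfun_measurable u2.
have m2 : measurable_fun setT (fun y => ((u y) ^+ 2)%:E).
  by apply/measurable_EFinP; exact: measurable_funX.
rewrite -[leRHS]integral_kernel_stationary//; last by move=> x; rewrite lee_fin sqr_ge0.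
apply: ae_ge0_le_integral => //.
- by move=> x _; rewrite lee_fin sqr_ge0.
- by apply/measurable_EFinP/measurable_funX; exact: measurable_markov_op.
- by move=> x _; apply: integral_ge0 => y _; rewrite lee_fin sqr_ge0.
- apply: measurable_fun_integral_kernel => //.
    by move=> A mA; exact: measurable_kernel.
  by move=> y; rewrite lee_fin sqr_ge0.
by apply: filterS (sqr_markov_op_le u2) => x + _.
Qed.

Lemma markov_op_L2 u : u \in L2 -> P u \in L2.
Proof.
move=> u2; have /L2P[mu /integrableP[_ iu]] := u2.
apply/L2P; split; first exact: measurable_markov_op.
apply/integrableP; split.
  by apply/measurable_EFinP/measurable_funX; exact: measurable_markov_op.
apply: le_lt_trans iu.
under eq_integral do rewrite gee0_abs ?lee_fin ?sqr_ge0//.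
under [leRHS]eq_integral do rewrite gee0_abs ?lee_fin ?sqr_ge0//.
exact: integral_sqr_markov_op.
Qed.

Lemma L2norm_markov_op u : u \in L2 -> n2 (P u) <= n2 u.
Proof.
move=> u2; apply: ler_wsqrtr; rewrite /L2_inner /Rintegral fine_le//.
- exact: (integrable_fin_num measurableT (L2_mul_integrable (markov_op_L2 u2) (markov_op_L2 u2))).
- exact: (integrable_fin_num measurableT (L2_mul_integrable u2 u2)).
under eq_integral do rewrite -expr2.
under [leRHS]eq_integral do rewrite -expr2.
exact: integral_sqr_markov_op.
Qed.

Lemma markov_op_lin (a : R) u v : u \in L2 -> v \in L2 ->
  P (fun x => a * u x + v x) = (fun x => a * P u x + P v x) %[ae pi].
Proof.
move=> u2 v2; apply: filterS2 (ae_Lfun_kernel u2) (ae_Lfun_kernel v2) => x ux vx _.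
rewrite /markov_op; have iu := L2_integrable ux; have iv := L2_integrable vx.
rewrite (@RintegralD _ _ _ (K x))//; last exact: (L2_integrable (L2Z a ux)).
by rewrite (@RintegralZl _ _ _ (K x)).
Qed.

Lemma markov_op_cst (c : R) : P (cst c) = cst c.
Proof.
apply/funext => x.
exact: (@Rintegral_prob_cst _ _ _ (kernel_prob K x)).
Qed.

Lemma markov_op_bound (s : R) u : 0 <= s -> u \in L2 ->
  (\forall x \ae pi, `|u x| <= s) -> \forall x \ae pi, `|P u x| <= s.
Proof.
move=> s0 u2 us; apply: filterS2 (ae_Lfun_kernel u2) (ae_kernel us) => x ux usx.
have iu := L2_integrable ux.
apply: (le_trans (@le_normr_Rintegral _ _ _ (K x) _ _ measurableT iu)).
rewrite -[leRHS](@Rintegral_prob_cst _ _ _ (kernel_prob K x)).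
apply: (@le_Rintegral_ae _ _ _ (kernel_prob K x)) => //.
  exact: integrable_norm.
exact: (L2_integrable (L2_cst _ s)).
Qed.

Lemma markov_op_ge0 u x : (forall y, 0 <= u y) -> 0 <= P u x.
Proof. by move=> u0; apply: Rintegral_ge0. Qed.

Lemma EFin_markov_op u : u \in L2 ->
  (fun x => (P u x)%:E) = (fun x => \int[K x]_y (u y)%:E)%E %[ae pi].
Proof.
move=> u2; apply: filterS (ae_Lfun_kernel u2) => x ux _.
rewrite /markov_op /Rintegral fineK//.
exact: (integrable_fin_num measurableT (L2_integrable ux)).
Qed.

Lemma L2_pos u : u \in L2 -> (fun x => Num.max (u x) 0) \in L2.
Proof.
move=> u2; apply: L2_dom (u2) _.
  by apply: measurable_maxr => //; exact: Lfun_measurable u2.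
by apply/nearW => x; case: (lerP 0 (u x)) => h; rewrite ?normr0// max_l.
Qed.

Lemma L2_neg u : u \in L2 -> (fun x => Num.max (- u x) 0) \in L2.
Proof.
move=> u2; have := L2_pos (L2Z (-1) u2).
by under eq_fun do rewrite mulN1r.
Qed.

Lemma pos_subr_neg (a : R) : Num.max a 0 - Num.max (- a) 0 = a.
Proof. by case: (lerP a 0); case: (lerP (- a) 0); lra. Qed.

Lemma markov_op_int_ge0 u : u \in L2 -> (forall x, 0 <= u x) ->
  \int[pi]_x P u x = \int[pi]_x u x.
Proof.
move=> u2 u0; congr fine; have mu := Lfun_measurable u2.
rewrite -[RHS]integral_kernel_stationary//.
- apply: ae_eq_integral => //.
  + by apply/measurable_EFinP; exact: measurable_markov_op.
  + apply: measurable_fun_integral_kernel => //.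
      by move=> A mA; exact: measurable_kernel.
    exact/measurable_EFinP.
  + exact: EFin_markov_op.
- exact/measurable_EFinP.
Qed.

Lemma markov_opB u v : u \in L2 -> v \in L2 ->
  P (fun x => u x - v x) = (fun x => P u x - P v x) %[ae pi].
Proof.
move=> u2 v2; have := markov_op_lin (-1) v2 u2.
under [X in P X]eq_fun do rewrite mulN1r addrC.
by apply: filterS => x + xT => /(_ xT) ->; rewrite mulN1r addrC.
Qed.

Lemma markov_op_int u : u \in L2 -> \int[pi]_x P u x = \int[pi]_x u x.
Proof.
move=> u2; have p2 := L2_pos u2; have m2 := L2_neg u2.
have -> : \int[pi]_x u x = \int[pi]_x (Num.max (u x) 0 - Num.max (- u x) 0).
  by apply: eq_Rintegral => x _; rewrite pos_subr_neg.
rewrite RintegralB//; try exact: L2_integrable.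
have max0 (a : R) : 0 <= Num.max a 0 by rewrite le_max lexx orbT.
rewrite -(markov_op_int_ge0 p2 (fun x => max0 (u x))).
rewrite -(markov_op_int_ge0 m2 (fun x => max0 (- u x))).
rewrite -RintegralB//; [|exact: (L2_integrable (markov_op_L2 p2))|exact: (L2_integrable (markov_op_L2 m2))].
apply: Rintegral_ae.
- exact: Lfun_measurable (markov_op_L2 u2).
- apply: measurable_funB; first exact: Lfun_measurable (markov_op_L2 p2).
  exact: Lfun_measurable (markov_op_L2 m2).
have := markov_opB p2 m2.
by under [X in P X]eq_fun do rewrite pos_subr_neg.
Qed.

Lemma opnorm_sup_ge0 (T : (D -> R) -> (D -> R)) :
  (0 <= ereal_sup [set 'N[pi]_(2%:E)[EFin \o T u] |
    u in [set u | L20 pi u /\ ('N[pi]_(2%:E)[EFin \o u] <= 1)%E]])%E.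
Proof.
apply: ereal_sup_ge; exists ('N[pi]_2%:E[EFin \o T (fun=> 0%R)])%E; last exact: Lnorm_ge0.
exists (fun=> 0) => //; split; first exact: (L20_0 pi).
by rewrite (Lnorm2E (L2_cst _ _)) L2norm_cst normr0 lee_fin.
Qed.

Lemma opnorm_ge0 (T : (D -> R) -> (D -> R)) : 0 <= L20_opnorm pi T.
Proof. by rewrite /L20_opnorm fine_ge0// opnorm_sup_ge0. Qed.

Lemma opnorm_le (T : (D -> R) -> (D -> R)) u :
  (forall u, u \in L2 -> T u \in L2) ->
  (forall (a : R) u v, u \in L2 -> v \in L2 ->
    T (fun x => a * u x + v x) = (fun x => a * T u x + T v x) %[ae pi]) ->
  (forall u, u \in L2 -> n2 (T u) <= n2 u) ->
  L20 pi u -> n2 (T u) <= L20_opnorm pi T * n2 u.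
Proof.
move=> TL2 Tlin T1 u0; have u2 := L20_L2 u0.
rewrite /L20_opnorm; set S := (X in ereal_sup X).
have S1 : ubound S 1%E.
  move=> _ [v [v0 v1] <-]; have v2 := L20_L2 v0.
  rewrite (Lnorm2E (TL2 _ v2)); rewrite (Lnorm2E v2) in v1.
  by rewrite (le_trans _ v1)// lee_fin T1.
have z0 := L20_0 pi.
have Sfin : ereal_sup S \is a fin_num.
  rewrite fin_numE; apply/andP; split.
    by rewrite gt_eqF// (lt_le_trans ltNy0)// opnorm_sup_ge0.
  by rewrite lt_eqF// (le_lt_trans (ge_ereal_sup S1))// ltry.
have := L2norm_ge0 pi u; rewrite le_eqVlt => /predU1P[u00|u_gt0].
  by rewrite -u00 mulr0 u00 T1.
have iu0 : 0 <= (n2 u)^-1 by rewrite invr_ge0 L2norm_ge0.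
pose v x := (n2 u)^-1 * u x.
have v0 : L20 pi v.
  have := L20_lin (n2 u)^-1 u0 z0; by under eq_fun do rewrite addr0.
have v1 : n2 v = 1 by rewrite L2normZ// ger0_norm// mulVf// gt_eqF.
have Tv : n2 (T v) = (n2 u)^-1 * n2 (T u).
  rewrite -[in RHS](ger0_norm iu0) -L2normZ ?TL2//.
  have hz : n2 (T (fun=> 0)) = 0.
    by apply/eqP; rewrite eq_le L2norm_ge0 andbT (le_trans (T1 _ (L2_cst _ _)))// L2norm_cst normr0.
  apply: L2norm_ae; [exact/TL2/L20_L2|exact: L2Z (TL2 _ u2)|].
  have := Tlin (n2 u)^-1 u (fun=> 0) u2 (L2_cst _ _).
  under [X in T X]eq_fun do rewrite addr0.
  apply: filterS2 (L2norm_eq0 (TL2 _ (L2_cst _ _)) hz) => x hx + xT => /(_ xT) ->.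
  by rewrite hx// addr0.
rewrite -ler_pdivrMr// mulrC -Tv -lee_fin fineK// -Lnorm2E ?TL2 ?(L20_L2 v0)//.
apply: ereal_sup_ubound; exists v => //; split => //.
by rewrite (Lnorm2E (L20_L2 v0)) v1.
Qed.

Lemma markov_like_markov_op : markov_like pi P (beta pi K).
Proof.
split.
- exact: opnorm_ge0.
- exact: markov_op_L2.
- exact: markov_op_lin.
- by rewrite markov_op_cst; exact/nearW.
- exact: markov_op_bound.
- exact: markov_op_int.
- move=> u u0; apply: opnorm_le => //.
  + exact: markov_op_L2.
  + exact: markov_op_lin.
  + exact: L2norm_markov_op.
Qed.

End markov_operator.

Section weighted_kernel_measure.
Context (R : realType) (d : measure_display) (D : measurableType d).
Variables (K : R.-pker D ~> D) (pi : probability D R) (v : D -> R).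
Hypotheses (iv : pi.-integrable setT (EFin \o v)) (v0 : forall x, 0 <= v x).
Local Open Scope ereal_scope.

(* The proofs are arguments so that the instances below can be inferred. *)
Definition weighted_kernel of pi.-integrable setT (EFin \o v)
  & (forall x, 0 <= v x)%R := fun A => \int[pi]_x ((v x)%:E * K x A).

Local Notation wk := (weighted_kernel iv v0).

Let mv : measurable_fun setT (EFin \o v). Proof. exact: measurable_int iv. Qed.

Let wk0 : wk set0 = 0.
Proof. by apply: integral0_eq => x _; rewrite measure0 mule0. Qed.

Let wk_ge0 A : 0 <= wk A.
Proof. by apply: integral_ge0 => x _; rewrite mule_ge0// lee_fin. Qed.

Let wk_sigma_additive : semi_sigma_additive wk.
Proof.
move=> U mU tU mUU; rewrite [X in _ --> X](_ : _ =
  \int[pi]_x (\sum_(n <oo) ((v x)%:E * K x (U n)))); last first.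
  apply: eq_integral => x _; rewrite nneseriesZl//; congr (_ * _).
  by apply/esym/cvg_lim => //; exact/measure_semi_sigma_additive.
apply/cvg_closeP; split.
  by apply: is_cvg_nneseries => n _ _; exact: wk_ge0.
rewrite closeE// integral_nneseries//.
- by move=> n; apply: emeasurable_funM => //; exact: measurable_kernel.
- by move=> n x _; rewrite mule_ge0// lee_fin.
Qed.

HB.instance Definition _ := isMeasure.Build _ _ R wk wk0 wk_ge0
  wk_sigma_additive.

Let wk_fin : fin_num_fun wk.
Proof.
move=> A mA; rewrite ge0_fin_numE//; move/integrableP : iv => [_].
apply: le_lt_trans; apply: ge0_le_integral => //.
- by move=> x _; rewrite mule_ge0// lee_fin.
- by apply: emeasurable_funM => //; exact: measurable_kernel.
- exact: measurableT_comp.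
move=> x _; rewrite gee0_abs ?lee_fin//= -[leRHS]mule1 lee_wpmul2l ?lee_fin//.
by rewrite -(@prob_kernel _ _ _ _ _ K x) le_measure// inE.
Qed.

HB.instance Definition _ := Measure_isFinite.Build _ _ _ wk wk_fin.

Lemma weighted_kernel_density : stationary K pi -> exists w : D -> R,
  [/\ measurable_fun setT w, forall x, (0 <= w x)%R &
    forall u : D -> \bar R, measurable_fun setT u -> (forall x, 0 <= u x) ->
      \int[pi]_x ((v x)%:E * \int[K x]_y u y) = \int[pi]_x ((w x)%:E * u x)].
Proof.
move=> hpi; have wk_pi : wk `<< pi.
  apply/null_content_dominatesP => A mA piA.
  rewrite /weighted_kernel; have : \int[pi]_x `|K x A| = 0.
    by under eq_integral do rewrite gee0_abs//; rewrite hpi.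
  move/(ae_eq_integral_abs pi measurableT (measurable_kernel K A mA)) => KA.
  rewrite (ae_eq_integral (cst 0)) ?integral0//.
    by apply: emeasurable_funM => //; exact: measurable_kernel.
  by apply: filterS KA => x + xT => /(_ xT) ->; rewrite mule0.
have [g [g0 ig gE]] := radon_nikodym_finite wk_pi.
have mg := measurable_int _ ig.
have gfin := integrable_ae measurableT ig.
exists (fine \o g); split.
- exact: (measurableT_comp (fine_measurable measurableT)).
- by move=> x; rewrite fine_ge0.
move=> u mu u0; have mfg : measurable_fun setT (fine \o g).
  exact: (measurableT_comp (fine_measurable measurableT)).
apply: (@eq_kernel_integral_eval _ _ _ _ _ _ _ pi pi v (fine \o g) (fun x => K x) id) => //.
- exact/measurable_EFinP.
- by move=> A mA; exact: measurable_kernel.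
- by move=> x; rewrite fine_ge0.
move=> A mA; rewrite -[LHS]/(wk A) gE// [LHS]integral_mkcond.
apply: ae_eq_integral => //.
- exact: (measurable_restrictT g mA).1 (measurable_funTS mg).
- by apply: emeasurable_funM; apply/measurable_EFinP.
apply: filterS gfin => x /(_ I) gx xT.
rewrite patchE /= indicE; case: ifPn => _; last by rewrite mule0.
by rewrite mule1 fineK.
Qed.

End weighted_kernel_measure.

Section adjoint.
Context (R : realType) (d : measure_display) (D : measurableType d).
Variables (K : R.-pker D ~> D) (pi : probability D R).
Hypothesis hpi : stationary K pi.
Implicit Types u v w : D -> R.
Local Notation L2 := (Lfun pi 2%:E).
Local Notation n2 := (L2norm pi).
Local Notation ip := (L2_inner pi).
Local Notation P := (markov_op K).

Definition is_adjoint v w : Prop :=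
  [/\ measurable_fun setT w, forall x, 0 <= w x &
    forall u : D -> \bar R, measurable_fun setT u -> (forall x, (0 <= u x)%E) ->
      (\int[pi]_x ((v x)%:E * \int[K x]_y u y) = \int[pi]_x ((w x)%:E * u x))%E].

Definition adjoint0 v : D -> R := xget (fun=> 0) [set w | is_adjoint v w].

Lemma adjoint0P v : v \in L2 -> (forall x, 0 <= v x) -> is_adjoint v (adjoint0 v).
Proof.
move=> v2 v0; apply: xgetPex.
exact: (weighted_kernel_density (K := K) (L2_integrable v2) v0).
Qed.

Lemma is_adjoint_pair v w u : v \in L2 -> is_adjoint v w -> u \in L2 ->
  (forall x, 0 <= u x) ->
  (\int[pi]_x (w x * u x)%:E = (ip v (P u))%:E)%E.
Proof.
move=> v2 [_ _ h] u2 u0.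
under eq_integral do rewrite EFinM.
have mu := Lfun_measurable u2; have mv := Lfun_measurable v2.
rewrite -[LHS]h; [|exact/measurable_EFinP|by move=> x; rewrite lee_fin].
have Pu2 := markov_op_L2 hpi u2.
rewrite /L2_inner /Rintegral fineK; last first.
  exact: (integrable_fin_num measurableT (L2_mul_integrable v2 Pu2)).
apply: ae_eq_integral => //.
- apply: emeasurable_funM; first exact/measurable_EFinP.
  apply: measurable_fun_integral_kernel => //.
    by move=> A mA; exact: measurable_kernel.
  exact/measurable_EFinP.
- by apply/measurable_EFinP; apply: measurable_funM => //; exact: Lfun_measurable Pu2.
apply: filterS (EFin_markov_op hpi u2) => x + xT => /(_ xT) <-.
by rewrite EFinM.
Qed.

Lemma adjoint0_pair v u : v \in L2 -> (forall x, 0 <= v x) -> u \in L2 ->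
  (forall x, 0 <= u x) ->
  (\int[pi]_x ((adjoint0 v x) * u x)%:E = (ip v (P u))%:E)%E.
Proof. by move=> v2 v0; apply: is_adjoint_pair => //; exact: adjoint0P. Qed.

Lemma adjoint0_L2 v : v \in L2 -> (forall x, 0 <= v x) -> adjoint0 v \in L2.
Proof.
move=> v2 v0; have [mw w0 _] := adjoint0P v2 v0; set w := adjoint0 v in mw w0 *.
pose u (n : nat) x := Num.min (w x) n%:R.
have mu n : measurable_fun setT (u n) by exact: measurable_minr.
have u0 n x : 0 <= u n x by rewrite le_min w0 ler0n.
have u2 n : u n \in L2.
  by apply: (@L2_bounded _ _ _ _ _ n%:R) => // x; rewrite ger0_norm// ge_min lexx orbT.
have uv n : n2 (u n) <= n2 v.
  have h : n2 (u n) ^+ 2 <= n2 v * n2 (u n).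
    rewrite sqr_L2norm -lee_fin; apply: (@le_trans _ _ (ip v (P (u n)))%:E); last first.
      rewrite lee_fin (le_trans (ip_le_L2norm v2 (markov_op_L2 hpi (u2 n))))//.
      by rewrite ler_wpM2l ?L2norm_ge0// L2norm_markov_op.
    rewrite -adjoint0_pair// /L2_inner /Rintegral fineK; last first.
      exact: (integrable_fin_num measurableT (L2_mul_integrable (u2 n) (u2 n))).
    apply: ge0_le_integral => //.
    - by move=> x _; rewrite lee_fin mulr_ge0.
    - by apply/measurable_EFinP; exact: measurable_funM.
    - by apply/measurable_EFinP; exact: measurable_funM.
    - by move=> x _; rewrite lee_fin ler_wpM2r// ge_min lexx.
  have := L2norm_ge0 pi (u n); rewrite le_eqVlt => /predU1P[<-|un0]; first exact: L2norm_ge0.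
  by move: h; rewrite expr2 ler_pM2r.
apply/L2P; split => //; apply/integrableP; split.
  by apply/measurable_EFinP; exact: measurable_funX.
under eq_integral do rewrite gee0_abs ?lee_fin ?sqr_ge0//.
apply: (@le_lt_trans _ _ (n2 v ^+ 2)%:E); last exact: ltry.
have cvgu x : (u n x ^+ 2)%:E @[n --> \oo] --> (w x ^+ 2)%:E.
  apply: cvg_EFin; first exact/nearW.
  apply: cvg_near_cst.
  near=> n; rewrite /= /u min_l//; near: n.
  exact: nbhs_infty_ger.
rewrite [leLHS](_ : _ = \int[pi]_x limn (fun n => (u n x ^+ 2)%:E))%E; last first.
  by apply: eq_integral => x _; apply/esym/cvg_lim => //; exact: cvgu.
rewrite monotone_convergence//.
- apply: lime_le.
    apply: ereal_nondecreasing_is_cvgn => a b ab; apply: ge0_le_integral => //.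
    + by move=> x _; rewrite lee_fin sqr_ge0.
    + by apply/measurable_EFinP; exact: measurable_funX.
    + by apply/measurable_EFinP; exact: measurable_funX.
    move=> x _; rewrite lee_fin lerXn2r ?nnegrE// le_min2// ler_nat//.
  apply/nearW => n.
  rewrite [leLHS](_ : _ = (n2 (u n) ^+ 2)%:E).
    by rewrite lee_fin lerXn2r ?nnegrE ?L2norm_ge0.
  rewrite sqr_L2norm /L2_inner /Rintegral fineK; last first.
    exact: (integrable_fin_num measurableT (L2_mul_integrable (u2 n) (u2 n))).
  by under eq_integral do rewrite expr2.
- by move=> n; apply/measurable_EFinP; exact: measurable_funX.
- by move=> n x _; rewrite lee_fin sqr_ge0.
- by move=> x _ a b ab; rewrite lee_fin lerXn2r ?nnegrE// le_min2// ler_nat.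
Unshelve. all: by end_near. Qed.

Lemma ip_adjoint0_ge0 v u : v \in L2 -> (forall x, 0 <= v x) -> u \in L2 ->
  (forall x, 0 <= u x) -> ip (adjoint0 v) u = ip v (P u).
Proof.
move=> v2 v0 u2 u0; apply: EFin_inj.
rewrite -adjoint0_pair// /L2_inner /Rintegral fineK//.
exact: (integrable_fin_num measurableT (L2_mul_integrable (adjoint0_L2 v2 v0) u2)).
Qed.

Let max0 (a : R) : 0 <= Num.max a 0.
Proof. by rewrite le_max lexx orbT. Qed.

Lemma ip_adjoint0 v u : v \in L2 -> (forall x, 0 <= v x) -> u \in L2 ->
  ip (adjoint0 v) u = ip v (P u).
Proof.
move=> v2 v0 u2; have p2 := L2_pos u2; have m2 := L2_neg u2.
have w2 := adjoint0_L2 v2 v0.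
have h := markov_opB hpi p2 m2.
have e : (fun x => Num.max (u x) 0 - Num.max (- u x) 0) = u.
  by apply/funext => x; rewrite pos_subr_neg.
rewrite e in h; have Pp2 := markov_op_L2 hpi p2; have Pm2 := markov_op_L2 hpi m2.
rewrite (ip_ae v2 v2 (markov_op_L2 hpi u2) (L2B Pp2 Pm2) _ h); last exact: ae_eq_refl.
by rewrite -[in LHS]e !ipBr// !ip_adjoint0_ge0// => x; exact: max0.
Qed.

Definition adjoint v : D -> R := fun x =>
  adjoint0 (fun y => Num.max (v y) 0) x - adjoint0 (fun y => Num.max (- v y) 0) x.

Lemma adjoint_L2 v : v \in L2 -> adjoint v \in L2.
Proof.
by move=> v2; apply: L2B; apply: adjoint0_L2; [exact: L2_pos| |exact: L2_neg|] => x.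
Qed.

Lemma ip_adjoint v u : v \in L2 -> u \in L2 -> ip (adjoint v) u = ip v (P u).
Proof.
move=> v2 u2; have p2 := L2_pos v2; have m2 := L2_neg v2.
have P2 := markov_op_L2 hpi u2.
have p0 x : 0 <= Num.max (v x) 0 by exact: max0.
have m0 x : 0 <= Num.max (- v x) 0 by exact: max0.
rewrite (ipBl (adjoint0_L2 p2 p0) (adjoint0_L2 m2 m0) u2).
rewrite (ip_adjoint0 p2 p0 u2) (ip_adjoint0 m2 m0 u2) -(ipBl p2 m2 P2).
by congr ip; apply/funext => x; rewrite pos_subr_neg.
Qed.

Lemma ip_ext u v : u \in L2 -> v \in L2 -> (forall w, w \in L2 -> ip u w = ip v w) ->
  u = v %[ae pi].
Proof.
move=> u2 v2 h; have w2 := L2B u2 v2.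
have : n2 (fun x => u x - v x) = 0.
  by rewrite /L2norm ipBl// h// subrr sqrtr0.
move/(L2norm_eq0 w2); apply: filterS => x + xT => /(_ xT)/eqP.
by rewrite subr_eq0 => /eqP.
Qed.

Lemma adjoint_lin (a : R) u v : u \in L2 -> v \in L2 ->
  adjoint (fun x => a * u x + v x) = (fun x => a * adjoint u x + adjoint v x) %[ae pi].
Proof.
move=> u2 v2; have uv2 := L2_lin a u2 v2.
have A2 := adjoint_L2 u2; have B2 := adjoint_L2 v2.
apply: ip_ext => [||w w2]; [exact: adjoint_L2|exact: L2_lin|].
have P2 := markov_op_L2 hpi w2.
rewrite (ip_adjoint uv2 w2) (ip_linl a u2 v2 P2) (ip_linl a A2 B2 w2).
by rewrite (ip_adjoint u2 w2) (ip_adjoint v2 w2).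
Qed.

Lemma ip_one u : ip (cst 1) u = \int[pi]_x u x.
Proof. by apply: eq_Rintegral => x _; rewrite mul1r. Qed.

Lemma adjoint_one : adjoint (cst 1) = cst 1 %[ae pi].
Proof.
have one2 := L2_cst pi 1.
apply: ip_ext => [||w w2]; [exact: adjoint_L2|exact: one2|].
by rewrite ip_adjoint// !ip_one markov_op_int.
Qed.

Lemma adjoint_le (s : R) v : 0 <= s -> v \in L2 ->
  (\forall x \ae pi, v x <= s) -> \forall x \ae pi, adjoint v x <= s.
Proof.
move=> s0 v2 vs; have w2 := adjoint_L2 v2; set w := adjoint v in w2 *.
have ws2 := L2B w2 (L2_cst pi s); have e2 := L2_pos ws2.
set e := (fun x => Num.max _ 0) in e2.
have Pe2 := markov_op_L2 hpi e2.
have e0 x : 0 <= e x by exact: max0.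
have h : ip w e <= s * \int[pi]_x e x.
  rewrite ip_adjoint// -(markov_op_int hpi e2) -RintegralZl//; last exact: L2_integrable.
  apply: le_Rintegral_ae; first exact: L2_mul_integrable.
    exact: L2_integrable (L2Z s Pe2).
  by apply: filterS vs => x vx; rewrite ler_wpM2r// markov_op_ge0.
have : ip e e <= 0.
  rewrite (_ : ip e e = ip (fun x => w x - s) e); last first.
    by apply: eq_Rintegral => x _; rewrite /e; case: (lerP (w x - s) 0); rewrite ?mulr0.
  rewrite ipBl//; last exact: L2_cst.
  rewrite subr_le0 (le_trans h)// /L2_inner RintegralZl//.
  exact: L2_integrable.
rewrite -sqr_L2norm => h0; have /(L2norm_eq0 e2) : n2 e = 0.
  by apply/eqP; rewrite -sqrf_eq0 eq_le h0 sqr_ge0.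
apply: filterS => x /(_ I) ex; rewrite -subr_le0 leNgt; apply/negP => c.
by move: ex; rewrite /e max_l ?(ltW c)// => /eqP; rewrite gt_eqF.
Qed.

Lemma adjoint_bound (s : R) v : 0 <= s -> v \in L2 ->
  (\forall x \ae pi, `|v x| <= s) -> \forall x \ae pi, `|adjoint v x| <= s.
Proof.
move=> s0 v2 vs; have nv2 := L2Z (-1) v2.
have h1 : \forall x \ae pi, v x <= s.
  by apply: filterS vs => x; exact: le_trans (ler_norm _).
have h2 : \forall x \ae pi, -1 * v x <= s.
  by apply: filterS vs => x; rewrite mulN1r -normrN; exact: le_trans (ler_norm _).
have e : adjoint (fun x => -1 * v x) = (fun x => -1 * adjoint v x) %[ae pi].
  apply: ip_ext => [||w w2]; [exact: adjoint_L2|exact/L2Z/adjoint_L2|].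
  have P2 := markov_op_L2 hpi w2.
  by rewrite ip_adjoint// !ipZl ?ip_adjoint// ?adjoint_L2.
apply: filterS3 (adjoint_le s0 v2 h1) (adjoint_le s0 nv2 h2) e => x h3 h4 /(_ I) ex.
by rewrite ler_norml h3 andbT lerNl -mulN1r -ex.
Qed.

Lemma markov_like_adjoint : markov_like pi adjoint (beta pi K).
Proof.
have hP := markov_like_markov_op hpi.
have aint u : u \in L2 -> \int[pi]_x adjoint u x = \int[pi]_x u x.
  move=> u2; rewrite -!ip_one ipC ip_adjoint//; last exact: L2_cst.
  by rewrite markov_op_cst ipC.
split.
- exact: opnorm_ge0.
- exact: adjoint_L2.
- exact: adjoint_lin.
- exact: adjoint_one.
- exact: adjoint_bound.
- exact: aint.
move=> u u0; have u2 := L20_L2 u0; have w2 := adjoint_L2 u2.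
have w0 : L20 pi (adjoint u) by split => //; rewrite aint//; case: u0.
have h : n2 (adjoint u) ^+ 2 <= beta pi K * n2 u * n2 (adjoint u).
  rewrite sqr_L2norm ip_adjoint// (le_trans (ip_le_L2norm u2 (markov_op_L2 hpi w2)))//.
  rewrite [leRHS](_ : _ = n2 u * (beta pi K * n2 (adjoint u))); last by ring.
  exact: (ler_wpM2l (L2norm_ge0 _ _) (ml_gap hP w0)).
have := L2norm_ge0 pi (adjoint u); rewrite le_eqVlt => /predU1P[<-|w_gt0].
  by rewrite mulr_ge0 ?L2norm_ge0 ?(ml_ge0 hP).
by move: h; rewrite expr2 ler_pM2r.
Qed.

End adjoint.

(** * Laws and covariances of the chain *)

Lemma integral_indic_comp (R : realType) (dW d : measure_display)
    (W : measurableType dW) (D : measurableType d) (m : {measure set W -> \bar R})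
    (phi : W -> D) (A : set D) : measurable_fun setT phi -> measurable A ->
  (\int[m]_w (\1_A (phi w))%:E = m (phi @^-1` A))%E.
Proof.
move=> mphi mA; rewrite -[in RHS](setIT (phi @^-1` A)) -integral_indic//.
  by rewrite -[X in measurable X]setTI; exact: mphi.
Qed.

Section chain.
Context (R : realType) (d : measure_display) (D : measurableType d).
Variables (K : R.-pker D ~> D) (pi : probability D R).
Hypothesis hpi : stationary K pi.
Context (dW : measure_display) (W : measurableType dW) (Pr : probability W R).
Variables (X : nat -> {RV Pr >-> D}) (nu : probability D R).
Hypothesis hX : markov_chain K nu X.
Local Notation P := (markov_op K).
Implicit Types u v : D -> R.

Let mX n : measurable_fun setT (X n). Proof. by []. Qed.

Lemma past_preimage j n (B : set D) : (j <= n)%N -> measurable B ->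
  past X n (X j @^-1` B).
Proof.
move=> jn mB; apply: sub_sigma_algebra; exists j => //.
by exists B => //; rewrite setTI.
Qed.

Lemma markov_step_set j n (A B : set D) : (j <= n)%N -> measurable A -> measurable B ->
  (\int[Pr]_w ((fine (K (X n w) A))%:E * (\1_B (X j w))%:E) =
   \int[Pr]_w ((\1_A (X n.+1 w))%:E * (\1_B (X j w))%:E))%E.
Proof.
move=> jn mA mB; have [_ /(_ n A mA) [_ /(_ _ (past_preimage jn mB))]] := hX.
have mXB : measurable (X j @^-1` B) by exact: measurable_funPTI.
have mXA : measurable (X n.+1 @^-1` A) by exact: measurable_funPTI.
rewrite integral_mkcond => h.
transitivity (Pr (X j @^-1` B `&` X n.+1 @^-1` A)).
  rewrite -h; apply: eq_integral => w _; rewrite patchE indicE.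
  have -> : (X j w \in B) = (w \in X j @^-1` B) by apply/idP/idP; rewrite !inE.
  case: ifPn => _; last by rewrite mule0.
  rewrite mule1 fineK// ge0_fin_numE//.
  rewrite (@le_lt_trans _ _ 1%E) ?ltry//.
  by rewrite -(@prob_kernel _ _ _ _ _ K (X n w)) le_measure// inE.
transitivity (\int[Pr]_w (\1_(X j @^-1` B `&` X n.+1 @^-1` A) w)%:E)%E.
  by rewrite integral_indic ?setIT//; exact: measurableI.
apply: eq_integral => w _; rewrite -EFinM !indicE -natrM mulnb andbC in_setI.
by congr ((_ && _)%:R%:E); apply/idP/idP => /set_mem h; apply/mem_set.
Qed.

Lemma markov_step_ge0 j n (psi : D -> R) (phi : D -> \bar R) : (j <= n)%N ->
  measurable_fun setT psi -> (forall x, 0 <= psi x) ->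
  measurable_fun setT phi -> (forall x, (0 <= phi x)%E) ->
  (\int[Pr]_w ((psi (X j w))%:E * \int[K (X n w)]_y phi y) =
   \int[Pr]_w ((psi (X j w))%:E * phi (X n.+1 w)))%E.
Proof.
move=> jn mpsi psi0 mphi phi0.
have mK A : measurable A -> measurable_fun setT (fun w => K (X n w) A).
  by move=> mA; exact: (measurableT_comp (measurable_kernel K A mA)).
apply: (@eq_kernel_integral_eval _ _ _ _ _ _ _ Pr Pr (psi \o X j) (psi \o X j)
  (fun w => K (X n w)) (X n.+1)) => //.
- exact: measurableT_comp.
- by move=> w; exact: psi0.
- exact: measurableT_comp.
- by move=> w; exact: psi0.
move=> A mA.
have := @eq_kernel_integral_eval _ _ _ _ _ _ _ Pr Pr
  (fun w => fine (K (X n w) A)) (fun w => \1_A (X n.+1 w))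
  (fun w => \d_(X j w)) (X j) (EFin \o psi).
have KE w : (fine (K (X n w) A))%:E = K (X n w) A.
  rewrite fineK// ge0_fin_numE// (@le_lt_trans _ _ 1%E) ?ltry//.
  by rewrite -(@prob_kernel _ _ _ _ _ K (X n w)) le_measure// inE.
have <- : (\int[Pr]_w ((fine (K (X n w) A))%:E * \int[\d_(X j w)]_y (psi y)%:E) =
    \int[Pr]_w ((psi (X j w))%:E * K (X n w) A))%E.
  apply: eq_integral => w _; rewrite integral_dirac//; last exact/measurable_EFinP.
  by rewrite diracT mul1e KE muleC.
move=> ->.
- by apply: eq_integral => w _; rewrite muleC.
- by apply: (measurableT_comp (fine_measurable measurableT)); exact: mK.
- by move=> w; rewrite fine_ge0.
- by move=> B mB; exact: (measurableT_comp (measurable_fun_dirac mB)).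
- by apply: (measurableT_comp (measurable_indic mA)).
- by move=> w.
- exact: mX.
- by move=> B mB; rewrite -(markov_step_set jn mA mB).
- exact/measurable_EFinP.
- by move=> x; rewrite lee_fin.
Qed.

Variable rho : nat -> D -> R.
Hypothesis rho_adj : forall a, is_adjoint K pi (rho a) (rho a.+1).
Hypothesis rho0_ge0 : forall x, 0 <= rho 0 x.
Hypothesis rho0_meas : measurable_fun setT (rho 0).
Hypothesis rho0_nu : forall A, measurable A ->
  (nu A = \int[pi]_x ((rho 0 x)%:E * (\1_A x)%:E))%E.

Lemma rho_ge0 a x : 0 <= rho a x.
Proof. by case: a => [//|a]; have [] := rho_adj a. Qed.

Lemma measurable_rho a : measurable_fun setT (rho a).
Proof. by case: a => [//|a]; have [] := rho_adj a. Qed.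

Lemma chain_law a (u : D -> \bar R) : measurable_fun setT u -> (forall x, (0 <= u x)%E) ->
  (\int[Pr]_w u (X a w) = \int[pi]_x ((rho a x)%:E * u x))%E.
Proof.
elim: a u => [|a ih] u mu u0.
  have := @eq_kernel_integral_eval _ _ _ _ _ _ _ Pr pi (cst 1) (rho 0)
    (fun w => \d_(X 0 w)) id u.
  under eq_integral => w _ do rewrite mul1e integral_dirac// diracT mul1e.
  apply => //.
  - by move=> A mA; exact: (measurableT_comp (measurable_fun_dirac mA)).
  - move=> A mA; rewrite -rho0_nu//; have [/(_ A mA) <- _] := hX.
    under eq_integral do rewrite mul1e.
    exact: (integral_indic_comp _ (mX 0) mA).
have [_ _ <-//] := rho_adj a.
rewrite -ih; last 2 first.
- by apply: measurable_fun_integral_kernel => //; move=> A mA; exact: measurable_kernel.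
- by move=> x; exact: integral_ge0.
have := @markov_step_ge0 0 a (cst 1) u (leq0n _) (measurable_cst _) (fun _ => ler01) mu u0.
under eq_integral do rewrite mul1e.
by under [RHS]eq_integral do rewrite mul1e.
Qed.

Lemma ae_chain a (Q : set D) : (\forall x \ae pi, Q x) -> \forall w \ae Pr, Q (X a w).
Proof.
move=> [N [mN piN QN]]; exists (X a @^-1` N); split => //.
- exact: measurable_funPTI.
- have := @chain_law a (EFin \o \1_N); rewrite /= => h.
  rewrite -(integral_indic_comp _ (mX a) mN) h.
  + rewrite (ae_eq_integral (cst 0%E)) ?integral0//.
      apply: emeasurable_funM; first exact/measurable_EFinP/measurable_rho.
      exact/measurable_EFinP/measurable_indic.
    exists N; split => // x /=; apply: contra_notP => Nx _.
    by rewrite indicE memNset// mule0.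
  + exact/measurable_EFinP/measurable_indic.
  + by move=> x; rewrite lee_fin.
- by move=> w /= Qw; apply: QN.
Qed.

Definition chain_L2 u := u \in Lfun pi 2%:E /\ forall a, (u \o X a) \in Lfun Pr 2%:E.

Lemma chain_L2P u : u \in Lfun pi 2%:E ->
  (forall a, (\int[pi]_x ((rho a x)%:E * (u x ^+ 2)%:E) < +oo)%E) -> chain_L2 u.
Proof.
move=> u2 h; split => // a; have mu := Lfun_measurable u2.
have mua : measurable_fun setT (u \o X a) by exact: measurableT_comp.
apply/L2P; split => //; apply/integrableP; split.
  by apply/measurable_EFinP; exact: measurable_funX.
under eq_integral do rewrite gee0_abs ?lee_fin ?sqr_ge0//.
rewrite (chain_law a (u := fun x => (u x ^+ 2)%:E))//.
- by apply/measurable_EFinP; exact: measurable_funX.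
- by move=> x; rewrite lee_fin sqr_ge0.
Qed.

Lemma chain_L2_sqr u a : chain_L2 u ->
  (\int[pi]_x ((rho a x)%:E * (u x ^+ 2)%:E) < +oo)%E.
Proof.
move=> [u2 /(_ a) /L2P[_ /integrableP[_]]]; have mu := Lfun_measurable u2.
under eq_integral do rewrite gee0_abs ?lee_fin ?sqr_ge0//.
rewrite (chain_law a (u := fun x => (u x ^+ 2)%:E))//.
- by apply/measurable_EFinP; exact: measurable_funX.
- by move=> x; rewrite lee_fin sqr_ge0.
Qed.

Lemma chain_L2_markov_op u : chain_L2 u -> chain_L2 (P u).
Proof.
move=> hu; have [u2 _] := hu; have mu := Lfun_measurable u2.
have m2 : measurable_fun setT (fun y => ((u y) ^+ 2)%:E).
  by apply/measurable_EFinP; exact: measurable_funX.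
have u20 x : (0 <= (u x ^+ 2)%:E)%E by rewrite lee_fin sqr_ge0.
apply: chain_L2P; first exact: markov_op_L2.
move=> a; apply: le_lt_trans (chain_L2_sqr a.+1 hu).
have [_ _ <-//] := rho_adj a.
apply: ae_ge0_le_integral => //.
- by move=> x _; rewrite mule_ge0// lee_fin ?rho_ge0 ?sqr_ge0.
- apply: emeasurable_funM; first exact/measurable_EFinP/measurable_rho.
  by apply/measurable_EFinP/measurable_funX; exact: measurable_markov_op.
- by move=> x _; rewrite mule_ge0 ?lee_fin ?rho_ge0 ?integral_ge0.
- apply: emeasurable_funM; first exact/measurable_EFinP/measurable_rho.
  by apply: measurable_fun_integral_kernel => // A mA; exact: measurable_kernel.
apply: filterS (sqr_markov_op_le hpi u2) => x h _.
by rewrite lee_wpmul2l ?lee_fin ?rho_ge0.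
Qed.

Lemma chain_L2_dom u v : measurable_fun setT u -> chain_L2 v ->
  (forall x, `|u x| <= `|v x|) -> chain_L2 u.
Proof.
move=> mu [v2 vX] uv; split; first by apply: L2_dom v2 _ => //; exact/nearW.
move=> a; apply: L2_dom (vX a) _; first exact: measurableT_comp.
by apply/nearW => w; exact: uv.
Qed.

Lemma chain_L2_pos u : chain_L2 u -> chain_L2 (fun x => Num.max (u x) 0).
Proof.
move=> hu; have [u2 _] := hu; apply: (chain_L2_dom _ hu).
  exact: Lfun_measurable (L2_pos u2).
by move=> x; case: (lerP 0 (u x)) => h; rewrite ?normr0// max_l.
Qed.

Lemma chain_L2_neg u : chain_L2 u -> chain_L2 (fun x => Num.max (- u x) 0).
Proof.
move=> hu; have [u2 _] := hu; apply: (chain_L2_dom _ hu).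
  exact: Lfun_measurable (L2_neg u2).
by move=> x; case: (lerP 0 (- u x)) => h; rewrite ?normr0 ?normrN.
Qed.

Lemma markov_step_ge0_ip j n psi phi : (j <= n)%N -> chain_L2 psi -> chain_L2 phi ->
  (forall x, 0 <= psi x) -> (forall x, 0 <= phi x) ->
  L2_inner Pr (psi \o X j) (phi \o X n.+1) = L2_inner Pr (psi \o X j) (P phi \o X n).
Proof.
move=> jn hpsi hphi psi0 phi0; have [psi2 psiX] := hpsi; have [phi2 phiX] := hphi.
have mpsi := Lfun_measurable psi2; have mphi := Lfun_measurable phi2.
have mP := measurable_markov_op K mphi.
congr fine.
transitivity (\int[Pr]_w ((psi (X j w))%:E * \int[K (X n w)]_y (EFin \o phi) y))%E.
  rewrite (markov_step_ge0 jn mpsi psi0 (phi := EFin \o phi)).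
  - by apply: eq_integral => w _; rewrite /= EFinM.
  - exact/measurable_EFinP.
  - by move=> x; rewrite lee_fin.
apply: ae_eq_integral => //.
- apply: emeasurable_funM; first by apply/measurable_EFinP; exact: measurableT_comp.
  apply: (measurable_fun_integral_kernel (l := fun w => K (X n w))).
  + by move=> A mA; exact: (measurableT_comp (measurable_kernel K A mA)).
  + by move=> x; rewrite lee_fin.
  + exact/measurable_EFinP.
- by apply/measurable_EFinP; apply: measurable_funM; exact: measurableT_comp.
apply: filterS (ae_chain n (EFin_markov_op hpi phi2)) => w /(_ I) h _.
by rewrite /= -h -EFinM.
Qed.

Lemma markov_step_ip j n psi phi : (j <= n)%N -> chain_L2 psi -> chain_L2 phi ->
  L2_inner Pr (psi \o X j) (phi \o X n.+1) = L2_inner Pr (psi \o X j) (P phi \o X n).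
Proof.
move=> jn hpsi hphi.
have max0 (a : R) : 0 <= Num.max a 0 by rewrite le_max lexx orbT.
have pp := chain_L2_pos hpsi; have pm := chain_L2_neg hpsi.
have fp := chain_L2_pos hphi; have fm := chain_L2_neg hphi.
have ppX := pp.2 j; have pmX := pm.2 j.
have fpX := fp.2 n.+1; have fmX := fm.2 n.+1.
have Pp := (chain_L2_markov_op fp).2 n; have Pm := (chain_L2_markov_op fm).2 n.
have epsi : psi \o X j = (fun w => ((fun x => Num.max (psi x) 0) \o X j) w -
    ((fun x => Num.max (- psi x) 0) \o X j) w).
  by apply/funext => w /=; rewrite pos_subr_neg.
have ephi : phi \o X n.+1 = (fun w => ((fun x => Num.max (phi x) 0) \o X n.+1) w -
    ((fun x => Num.max (- phi x) 0) \o X n.+1) w).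
  by apply/funext => w /=; rewrite pos_subr_neg.
have aeP : P phi \o X n = (fun w => (P (fun x => Num.max (phi x) 0) \o X n) w -
    (P (fun x => Num.max (- phi x) 0) \o X n) w) %[ae Pr].
  have := ae_chain n (markov_opB hpi fp.1 fm.1).
  under [X in (\forall w \ae _, _ -> P X _ = _) -> _]eq_fun do rewrite pos_subr_neg.
  by apply: filterS => w /(_ I) h _ /=; rewrite h.
have psiX := hpsi.2 j.
rewrite (ip_ae psiX psiX ((chain_L2_markov_op hphi).2 n) (L2B Pp Pm) (ae_eq_refl _ _ _) aeP).
rewrite ephi (ipBr fpX fmX psiX) (ipBr Pp Pm psiX) epsi.
rewrite (ipBl ppX pmX fpX) (ipBl ppX pmX fmX) (ipBl ppX pmX Pp) (ipBl ppX pmX Pm).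
rewrite (markov_step_ge0_ip jn pp fp)// (markov_step_ge0_ip jn pp fm)//.
by rewrite (markov_step_ge0_ip jn pm fp)// (markov_step_ge0_ip jn pm fm).
Qed.

Lemma chain_L2_iter m u : chain_L2 u -> chain_L2 (iter m P u).
Proof. by elim: m => // m ih /ih /chain_L2_markov_op. Qed.

Lemma chain_covariance a m psi phi : chain_L2 psi -> chain_L2 phi ->
  L2_inner Pr (psi \o X a) (phi \o X (a + m)%N) =
  L2_inner Pr (psi \o X a) (iter m P phi \o X a).
Proof.
move=> hpsi; elim: m phi => [|m ih] phi hphi; first by rewrite addn0.
rewrite addnS (markov_step_ip (leq_addr _ _) hpsi hphi).
by rewrite (ih _ (chain_L2_markov_op hphi)) iterSr.
Qed.

Lemma chain_integral a (w : D -> R) : measurable_fun setT w ->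
  (\int[Pr]_x (w (X a x))%:E = \int[pi]_x (rho a x * w x)%:E)%E.
Proof.
move=> mw; rewrite integralE [RHS]integralE; have mEw : measurable_fun setT (EFin \o w).
  exact/measurable_EFinP.
congr (_ - _)%E.
- transitivity (\int[pi]_x ((rho a x)%:E * ((EFin \o w)^\+) x))%E.
    apply: etrans (chain_law a (measurable_funepos mEw) (fun x => funepos_ge0 _ x)).
    by apply: eq_integral => z _; rewrite !funeposE.
  apply: eq_integral => x _; rewrite !funeposE /= -!EFin_max -EFinM.
  by rewrite -(mulr0 (rho a x)) -maxr_pMr ?rho_ge0// mulr0.
- transitivity (\int[pi]_x ((rho a x)%:E * ((EFin \o w)^\-) x))%E.
    apply: etrans (chain_law a (measurable_funeneg mEw) (fun x => funeneg_ge0 _ x)).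
    by apply: eq_integral => z _; rewrite !funenegE.
  apply: eq_integral => x _; rewrite !funenegE /= -!EFin_max -EFinM -mulrN.
  by rewrite -(mulr0 (rho a x)) -maxr_pMr ?rho_ge0// mulr0.
Qed.

Lemma chain_ip a u v : chain_L2 u -> chain_L2 v ->
  L2_inner Pr (u \o X a) (v \o X a) = \int[pi]_x (rho a x * (u x * v x)).
Proof.
move=> [u2 _] [v2 _]; congr fine; rewrite -chain_integral//.
by apply: measurable_funM; [exact: Lfun_measurable u2|exact: Lfun_measurable v2].
Qed.

End chain.

(** * Poisson equation, variance and spectral gap *)

Section double_sums.
Variable R : realType.

Definition natdist (i j : nat) : nat := (i - j + (j - i))%N.

Lemma natdistC i j : natdist i j = natdist j i.
Proof. by rewrite /natdist addnC. Qed.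

Lemma natdist_lt n (i : 'I_n) : natdist n i = (n - i)%N.
Proof. by rewrite /natdist; have := ltn_ord i; lia. Qed.

Lemma natdistnn n : natdist n n = 0%N. Proof. by rewrite /natdist subnn. Qed.

Lemma double_sumS (F : nat -> nat -> R) n : (forall i j, F i j = F j i) ->
  \sum_(i < n.+1) \sum_(j < n.+1) F i j =
  \sum_(i < n) \sum_(j < n) F i j + 2 * (\sum_(i < n) F n i) + F n n.
Proof.
move=> Fsym; rewrite big_ord_recr/= big_ord_recr/=.
under eq_bigr do rewrite big_ord_recr/=.
rewrite big_split/=.
have -> : \sum_(i < n) F i n = \sum_(i < n) F n i by apply: eq_bigr => i _; exact: Fsym.
by ring.
Qed.

Lemma double_sum_telescope (c q : nat -> R) n : (forall m, c m = q m - q m.+1) ->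
  \sum_(i < n) \sum_(j < n) c (natdist i j) =
  n%:R * (2 * q 0%N - c 0%N) - 2 * \sum_(m < n) q m.+1.
Proof.
move=> cq; elim: n => [|n ih]; first by rewrite !big_ord0; ring.
rewrite (double_sumS (F := fun i j => c (natdist i j))); last first.
  by move=> i j; rewrite natdistC.
rewrite ih big_ord_recr/= natdistnn.
have -> : \sum_(i < n) c (natdist n i) = q 1%N - q n.+1.
  transitivity (\sum_(0 <= i < n) (q (n.+1 - i.+1)%N - q (n.+1 - i)%N)).
    rewrite big_mkord; apply: eq_bigr => i _; rewrite natdist_lt cq subSS.
    by rewrite subSn// ltnW.
  rewrite (telescope_sumr (fun i => q (n.+1 - i)%N))//.
  by rewrite subn0 subSn// subnn.
by rewrite (cq 0%N) -natr1; ring.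
Qed.

Lemma double_sum_geometric (x y : R) n : 0 <= x < 1 -> 0 <= y < 1 ->
  \sum_(i < n) \sum_(j < n) x ^+ natdist i j * y ^+ minn i j <= 2 / ((1 - x) * (1 - y)).
Proof.
move=> /andP[x0 x1] /andP[y0 y1].
have x1' : 1 - x != 0 by rewrite gt_eqF// subr_gt0.
have y1' : 1 - y != 0 by rewrite gt_eqF// subr_gt0.
pose V k := \sum_(i < k) \sum_(j < k) x ^+ natdist i j * y ^+ minn i j.
pose w k := \sum_(i < k) x ^+ (k - i) * y ^+ i.
have VE k : V k + 2 / (1 - x) * w k + (1 + x) / ((1 - x) * (1 - y)) * y ^+ k =
    (1 + x) / ((1 - x) * (1 - y)).
  elim: k => [|k ih]; first by rewrite /V /w !big_ord0; ring.
  rewrite /V (double_sumS (F := fun i j => x ^+ natdist i j * y ^+ minn i j)); last first.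
    by move=> i j; rewrite natdistC minnC.
  rewrite -/(V k) natdistnn minnn expr0 mul1r.
  have -> : \sum_(i < k) x ^+ natdist k i * y ^+ minn k i = w k.
    by apply: eq_bigr => i _; rewrite natdist_lt (minn_idPr _)// ltnW.
  have -> : w k.+1 = x * w k + x * y ^+ k.
    rewrite /w big_ord_recr/= subSn// subnn expr1 mulr_sumr; congr (_ + _).
    by apply: eq_bigr => i _; rewrite subSn ?exprS ?mulrA// ltnW.
  rewrite -[RHS]ih exprS; field.
  by apply/andP.
have w0 : 0 <= w n by apply: sumr_ge0 => i _; rewrite mulr_ge0 ?exprn_ge0.
have d0 : 0 < (1 - x) * (1 - y) by rewrite mulr_gt0 ?subr_gt0.
rewrite -/(V n); apply: (@le_trans _ _ ((1 + x) / ((1 - x) * (1 - y)))).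
  rewrite -[leRHS](VE n) -addrA lerDl addr_ge0// mulr_ge0//.
  - by rewrite divr_ge0// subr_ge0 ltW.
  - by rewrite divr_ge0 ?addr_ge0// ltW.
  - by rewrite exprn_ge0.
by rewrite ler_pM2r ?invr_gt0//; lra.
Qed.

Lemma le_geometric0 (x C t : R) : 0 <= t < 1 -> (forall n : nat, x <= C * t ^+ n) -> x <= 0.
Proof.
move=> /andP[t0 t1] h.
have cv : C * t ^+ n @[n --> \oo] --> C * 0.
  by apply: cvgMr; apply: cvg_expr; rewrite ger0_norm.
rewrite mulr0 in cv; rewrite -(cvg_lim _ cv)//.
apply: limr_ge; first by apply/cvg_ex; exists 0.
exact: nearW.
Qed.

Lemma geometric_partial_sum_le (t : R) N n : 0 <= t < 1 ->
  \sum_(N <= k < n) t ^+ k <= t ^+ N / (1 - t).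
Proof.
move=> /andP[t0 t1]; have d0 : 0 < 1 - t by rewrite subr_gt0.
have [Nn|nN] := leqP N n; last first.
  by rewrite big_geq ?(ltnW nN)// divr_ge0 ?exprn_ge0// ltW.
rewrite ler_pdivlMr// mulr_suml.
under eq_bigr do rewrite mulrBr mulr1 -exprSr -opprB.
rewrite sumrN telescope_sumr// opprB gerBl exprn_ge0//.
Qed.

End double_sums.

Section L2_complete.
Context (R : realType) (d : measure_display) (D : measurableType d).
Variable mu : probability D R.
Local Notation L2 := (Lfun mu 2%:E).
Local Notation n2 := (L2norm mu).
Local Notation ip := (L2_inner mu).

Lemma L2_series_limit (s : nat -> D -> R) (c t : R) : 0 <= c -> 0 <= t < 1 ->
  (forall k, s k \in L2) -> (forall k, n2 (s k) <= c * t ^+ k) ->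
  exists2 h, h \in L2 &
    forall N, n2 (fun x => h x - \sum_(k < N) s k x) <= c * t ^+ N / (1 - t).
Proof.
move=> c0 t01 s2 sb; have [t0 t1] := andP t01.
have ms k : measurable_fun setT (s k) by exact: Lfun_measurable (s2 k).
pose S n x := \sum_(k < n) s k x.
have S2 n : S n \in L2 by exact: L2_sum.
have mS n : measurable_fun setT (S n) by exact: Lfun_measurable (S2 n).
pose G N n : D -> R := fun x => \sum_(N <= k < n + N) `|s k x|.
have abs2 k : (fun x => `|s k x|) \in L2.
  by apply: L2_dom (s2 k) _; [exact: measurableT_comp|apply/nearW => x; rewrite normr_id].
have G2 N n : G N n \in L2.
  exact: (L2_sum (index_iota N (n + N)) (F := fun k x => `|s k x|) abs2).
have mG N n : measurable_fun setT (G N n) by exact: Lfun_measurable (G2 N n).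
have G0 N n x : 0 <= G N n x by exact: sumr_ge0.
have ndG N x : {homo (G N ^~ x) : a b / (a <= b)%N >-> a <= b}.
  apply/nondecreasing_seqP => n; rewrite /G addSn big_nat_recr ?leq_addl//= lerDl//.
have nd2 N x : {homo (fun n => (G N n x ^+ 2)%:E) : a b / (a <= b)%N >-> (a <= b)%E}.
  by move=> a b ab; rewrite lee_fin lerXn2r ?nnegrE ?G0// ndG.
have mG2 N n : measurable_fun setT (fun x => (G N n x ^+ 2)%:E).
  by apply/measurable_EFinP; exact: measurable_funX.
have C0 N : 0 <= c * t ^+ N / (1 - t).
  by apply: divr_ge0; [rewrite mulr_ge0 ?exprn_ge0|rewrite subr_ge0 ltW].
have nG N n : n2 (G N n) <= c * t ^+ N / (1 - t).
  apply: (le_trans (L2norm_sum _ abs2)).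
  apply: (@le_trans _ _ (\sum_(N <= k < n + N) c * t ^+ k)).
    apply: ler_sum => k _; apply: le_trans (sb k); apply: L2norm_le => //.
    by apply/nearW => x; rewrite normr_id.
  by rewrite -mulr_sumr -mulrA ler_wpM2l// geometric_partial_sum_le.
have intG N : (\int[mu]_x limn (fun n => (G N n x ^+ 2)%:E) <=
    ((c * t ^+ N / (1 - t)) ^+ 2)%:E)%E.
  have sq0 n x : (0 <= (G N n x ^+ 2)%:E)%E by rewrite lee_fin sqr_ge0.
  rewrite (monotone_convergence mu measurableT (mG2 N) (fun n x _ => sq0 n x)
    (fun x _ => nd2 N x)).
  apply: lime_le.
    apply: ereal_nondecreasing_is_cvgn => a b ab.
    by apply: ge0_le_integral => // x _; first [exact: sq0|exact: nd2].
  apply: nearW => n.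
  rewrite [leLHS](_ : _ = (n2 (G N n) ^+ 2)%:E).
    by rewrite lee_fin lerXn2r ?nnegrE ?L2norm_ge0.
  rewrite sqr_L2norm /L2_inner /Rintegral fineK; last first.
    exact: (integrable_fin_num measurableT (L2_mul_integrable (G2 N n) (G2 N n))).
  by apply: eq_integral => x _; rewrite expr2.
have mlG N : measurable_fun setT (fun x => limn (fun n => (G N n x ^+ 2)%:E)).
  apply: (emeasurable_fun_cvg (fun n x => (G N n x ^+ 2)%:E)) => // x _.
  exact: ereal_nondecreasing_is_cvgn.
have lim0 N x : (0 <= limn (fun n => (G N n x ^+ 2)%:E))%E.
  apply: lime_ge; first exact: ereal_nondecreasing_is_cvgn.
  by apply: nearW => n; rewrite lee_fin sqr_ge0.
have Gfin : \forall x \ae mu, limn (fun n => (G 0 n x ^+ 2)%:E) \is a fin_num.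
  have : mu.-integrable setT (fun x => limn (fun n => (G 0 n x ^+ 2)%:E)).
    apply/integrableP; split => //.
    under eq_integral do rewrite gee0_abs//.
    by apply: le_lt_trans (intG 0) _; exact: ltry.
  by move/(integrable_ae measurableT); apply: filterS => x; exact.
have Scvg : \forall x \ae mu, cvgn (S ^~ x).
  apply: filterS Gfin => x hx.
  have Sx : S ^~ x = series (fun k => s k x).
    by apply/funext => n; rewrite /S seriesEord.
  rewrite Sx; apply: normed_cvg; rewrite [X in cvgn X](_ : _ = G 0 ^~ x); last first.
    by apply/funext => n; rewrite /G /= addn0.
  apply: nondecreasing_is_cvgn; first by move=> a b ab; exact: ndG.
  set l := limn _ in hx.
  exists (fine l + 1) => _ [n _ <-].
  have : ((G 0 n x ^+ 2)%:E <= l)%E.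
    rewrite /l (cvg_lim _ (ereal_nondecreasing_cvgn (nd2 0 x)))//.
    by apply: ereal_sup_ubound; exists n.
  rewrite -(fineK hx) lee_fin => hh; have := G0 0 n x; nra.
pose h x := fine (limn_esup (fun n => (S n x)%:E)).
have mh : measurable_fun setT h.
  apply: (measurableT_comp (fine_measurable measurableT)).
  apply: (measurable_fun_limn_esup (f := fun n x => (S n x)%:E)) => n.
  exact/measurable_EFinP.
have hE : \forall x \ae mu, S n x @[n --> \oo] --> h x.
  apply: filterS Scvg => x Sx.
  rewrite /h; have e : (S n x)%:E @[n --> \oo] --> (limn (S ^~ x))%:E.
    by apply: cvg_EFin; [exact/nearW|].
  have ce : cvgn (fun n => (S n x)%:E) by apply/cvg_ex; exists (limn (S ^~ x))%:E.
  by rewrite (is_cvg_limn_esupE ce) (cvg_lim _ e).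
have bound N : (\int[mu]_x ((h x - S N x) ^+ 2)%:E <= ((c * t ^+ N / (1 - t)) ^+ 2)%:E)%E.
  apply: le_trans (intG N); apply: ae_ge0_le_integral => //.
  - by move=> x _; rewrite lee_fin sqr_ge0.
  - by apply/measurable_EFinP/measurable_funX; exact: measurable_funB.
  apply: filterS hE => x Sx _.
  have e : ((S (n + N)%N x - S N x) ^+ 2)%:E @[n --> \oo] --> ((h x - S N x) ^+ 2)%:E.
    apply: cvg_EFin; first exact/nearW.
    have SN : S (n + N)%N x @[n --> \oo] --> h x by rewrite (cvg_shiftn N (S ^~ x)).
    have e1 : (S (n + N)%N x - S N x) @[n --> \oo] --> h x - S N x.
      exact: (cvgB SN (cvg_cst _)).
    rewrite expr2; apply: cvg_trans (cvgM e1 e1); apply: near_eq_cvg.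
    by apply: nearW => n /=; rewrite expr2.
  rewrite -(cvg_lim _ e)//; apply: lee_lim.
  - by apply/cvg_ex; exists ((h x - S N x) ^+ 2)%:E.
  - exact: ereal_nondecreasing_is_cvgn.
  apply: nearW => n; rewrite lee_fin -[leLHS]real_normK ?num_real// lerXn2r ?nnegrE//.
  rewrite /S -(big_mkord predT (fun k => s k x)) -(big_mkord predT (fun k => s k x)).
  rewrite (@big_cat_nat _ _ _ N 0 (n + N))//= ?leq_addl// addrAC subrr add0r.
  exact: ler_norm_sum.
have hS2 N : (fun x => h x - S N x) \in L2.
  apply/L2P; split; first exact: measurable_funB.
  apply/integrableP; split.
    by apply/measurable_EFinP/measurable_funX; exact: measurable_funB.
  under eq_integral do rewrite gee0_abs ?lee_fin ?sqr_ge0//.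
  by apply: le_lt_trans (bound N) _; exact: ltry.
exists h.
  apply: L2_ae mh (hS2 0%N) _; apply/nearW => x _.
  by rewrite /S big_ord0 subr0.
move=> N; apply: le_L2norm; first exact: C0.
rewrite -lee_fin; apply: le_trans (bound N).
rewrite /L2_inner /Rintegral fineK; last first.
  exact: (integrable_fin_num measurableT (L2_mul_integrable (hS2 N) (hS2 N))).
rewrite le_eqVlt; apply/orP; left; apply/eqP; apply: eq_integral => x _.
by rewrite expr2.
Qed.

End L2_complete.

Section resolvent.
Context (R : realType) (d : measure_display) (D : measurableType d).
Variable mu : probability D R.
Implicit Types u v h : D -> R.
Local Notation L2 := (Lfun mu 2%:E).
Local Notation n2 := (L2norm mu).
Local Notation ip := (L2_inner mu).
Variables (T : (D -> R) -> (D -> R)) (b a : R).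
Hypotheses (hT : markov_like mu T b) (ba : b < a).

Let b0 : 0 <= b. Proof. exact: ml_ge0 hT. Qed.
Let a0 : 0 < a. Proof. exact: le_lt_trans b0 ba. Qed.

Lemma ml_iter_L20 m u : L20 mu u -> L20 mu (iter m T u).
Proof. by move=> u0; elim: m => //= m ih; exact: (ml_L20 hT ih). Qed.

Lemma L2norm_iter m u : L20 mu u -> n2 (iter m T u) <= b ^+ m * n2 u.
Proof. exact: (ml_gap (markov_like_iter m hT)). Qed.

Lemma resolvent_bound u h : L20 mu u -> L20 mu h ->
  (fun x => a * h x - T h x) = u %[ae mu] -> n2 h <= (a - b)^-1 * n2 u.
Proof.
move=> u0 h0 e; have u2 := L20_L2 u0; have h2 := L20_L2 h0; have Th2 := ml_L2 hT h2.
rewrite mulrC ler_pdivlMr ?subr_gt0//.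
have : a * n2 h <= n2 u + b * n2 h.
  apply: (@le_trans _ _ (n2 u + n2 (T h))); last by rewrite lerD2l (ml_gap hT).
  apply: le_trans (L2normD u2 Th2).
  rewrite -(ger0_norm (ltW a0)) -L2normZ// le_eqVlt; apply/orP; left; apply/eqP.
  apply: L2norm_ae; [exact: L2Z|exact: L2D|].
  by apply: filterS e => x + xT => /(_ xT) <-; rewrite subrK.
by lra.
Qed.

Lemma resolvent_exists u : L20 mu u ->
  exists h, L20 mu h /\ (fun x => a * h x - T h x) = u %[ae mu].
Proof.
move=> u0; have u2 := L20_L2 u0.
pose s k : D -> R := fun x => a ^- k.+1 * iter k T u x.
have s0 k : L20 mu (s k).
  have := L20_lin (a ^- k.+1) (ml_iter_L20 k u0) (L20_0 mu).
  by under eq_fun do rewrite addr0.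
have s2 k := L20_L2 (s0 k).
have t01 : 0 <= b / a < 1 by rewrite divr_ge0 ?(ltW a0)//= ltr_pdivrMr// mul1r.
have c0 : 0 <= a^-1 * n2 u by rewrite mulr_ge0 ?L2norm_ge0// invr_ge0 (ltW a0).
have sb k : n2 (s k) <= a^-1 * n2 u * (b / a) ^+ k.
  rewrite L2normZ ?(L20_L2 (ml_iter_L20 k u0))// ger0_norm ?invr_ge0 ?exprn_ge0 ?(ltW a0)//.
  rewrite (_ : _ * (b / a) ^+ k = a ^- k.+1 * (b ^+ k * n2 u)); last first.
    by rewrite exprS invfM expr_div_n; ring.
  by rewrite ler_wpM2l ?L2norm_iter// invr_ge0 exprn_ge0 ?(ltW a0).
have [h h2 hb] := L2_series_limit c0 t01 s2 sb.
pose S N : D -> R := fun x => \sum_(k < N) s k x.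
have S0 N : L20 mu (S N).
  elim: N => [|N ih].
    by rewrite (_ : S 0%N = fun=> 0); [exact: L20_0|apply/funext => x; rewrite /S big_ord0].
  have := L20_lin 1 ih (s0 N); congr L20; apply/funext => x.
  by rewrite /S big_ord_recr/= mul1r.
have S2 N := L20_L2 (S0 N).
pose C := a^-1 * n2 u / (1 - b / a).
have hC N : n2 (fun x => h x - S N x) <= C * (b / a) ^+ N.
  by rewrite (le_trans (hb N))// /C mulrAC.
have h0 : L20 mu h.
  split => //; apply/eqP; rewrite -normr_le0; apply: (le_geometric0 (C := C) t01) => N.
  apply: le_trans (hC N); have hS2 := L2B h2 (S2 N).
  apply: le_trans (norm_int_le_L2norm hS2).
  by rewrite RintegralB//; [rewrite (S0 N).2 subr0|exact: L2_integrable|exact: L2_integrable].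
have aTS N : (fun x => a * S N x - T (S N) x) =
    (fun x => u x - a ^- N * iter N T u x) %[ae mu].
  elim: N => [|N ih].
    have -> : S 0%N = fun=> 0 by apply/funext => x; rewrite /S big_ord0.
    apply: filterS (ml_cst hT 0) => x h1 xT.
    by rewrite h1// expr0 invr1 mul1r mulr0 !subrr.
  have TN2 := L20_L2 (ml_iter_L20 N u0).
  have := ml_lin hT (a ^- N.+1) TN2 (S2 N).
  rewrite (_ : (fun x => a ^- N.+1 * iter N T u x + S N x) = S N.+1); last first.
    by apply/funext => x; rewrite /S big_ord_recr/= addrC.
  apply: filterS2 ih => x h1 h2' xT; rewrite h2'//.
  have -> : T (S N) x = a * S N x - (u x - a ^- N * iter N T u x) by rewrite -h1//; ring.
  rewrite [S N.+1 x](_ : _ = S N x + a ^- N.+1 * iter N T u x); last first.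
    by rewrite /S big_ord_recr.
  rewrite /= exprS invfM; field.
  by rewrite expf_neq0 gt_eqF.
exists h; split => //.
have Th2 := ml_L2 hT h2.
have ah2 := L2B (L2Z a h2) Th2.
have d2 := L2B ah2 u2.
have : n2 (fun x => a * h x - T h x - u x) = 0.
  apply/eqP; rewrite eq_le L2norm_ge0 andbT.
  apply: (le_geometric0 (C := (a + b) * C + n2 u) t01) => N.
  have hS0 : L20 mu (fun x => h x - S N x).
    have := L20_lin (-1) (S0 N) h0; congr L20; apply/funext => x.
    by rewrite mulN1r addrC.
  have hS2 := L20_L2 hS0.
  have TN2 := L20_L2 (ml_iter_L20 N u0).
  have ThS2 := ml_L2 hT hS2.
  have A2 := L2Z a hS2; have B2 := L2Z (a ^- N) TN2.
  have e : (fun x => a * h x - T h x - u x) =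
      (fun x => (a * (h x - S N x) - T (fun x => h x - S N x) x) - a ^- N * iter N T u x) %[ae mu].
    apply: filterS2 (mlB hT h2 (S2 N)) (aTS N) => x h1 h3 xT; rewrite h1//.
    have -> : a ^- N * iter N T u x = u x - (a * S N x - T (S N) x) by rewrite h3//; ring.
    by ring.
  rewrite (L2norm_ae d2 (L2B (L2B A2 ThS2) B2) e).
  apply: (le_trans (L2normB (L2B A2 ThS2) B2)).
  have e1 := L2normB A2 ThS2.
  have e2 := ml_gap hT hS0.
  have e3 := hC N.
  have e4 : n2 (fun x => a ^- N * iter N T u x) <= n2 u * (b / a) ^+ N.
    rewrite L2normZ// ger0_norm ?invr_ge0 ?exprn_ge0 ?(ltW a0)// expr_div_n mulrA mulrC.
    rewrite ler_wpM2r ?invr_ge0 ?exprn_ge0 ?(ltW a0)// [leRHS]mulrC.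
    exact: L2norm_iter.
  rewrite L2normZ// (ger0_norm (ltW a0)) in e1.
  rewrite mulrDl -mulrA.
  have e5 : (a + b) * n2 (fun x => h x - S N x) <= (a + b) * (C * (b / a) ^+ N).
    by rewrite ler_wpM2l// addr_ge0 ?(ltW a0).
  by lra.
move/(L2norm_eq0 d2); apply: filterS => x + xT => /(_ xT) /eqP.
by rewrite subr_eq0 => /eqP.
Qed.

Lemma resolvent : exists B, L20_inverse mu (fun u x => a * u x - T u x) B.
Proof.
have /choice[B hB] : forall u, exists h, L20 mu u ->
    L20 mu h /\ (fun x => a * h x - T h x) = u %[ae mu].
  move=> u; have [u0|nu0] := pselect (L20 mu u); last by exists u.
  by have [h hh] := resolvent_exists u0; exists h.
have uniq u h1 h2 : L20 mu u -> L20 mu h1 -> L20 mu h2 ->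
    (fun x => a * h1 x - T h1 x) = u %[ae mu] ->
    (fun x => a * h2 x - T h2 x) = u %[ae mu] -> h1 = h2 %[ae mu].
  move=> u0 h10 h20 e1 e2.
  have d0 : L20 mu (fun x => h1 x - h2 x).
    have := L20_lin (-1) h20 h10; congr L20; apply/funext => x.
    by rewrite mulN1r addrC.
  have e : (fun x => a * (h1 x - h2 x) - T (fun x => h1 x - h2 x) x) = (fun=> 0) %[ae mu].
    have := mlB hT (L20_L2 h10) (L20_L2 h20).
    apply: filterS3 e1 e2 => x f1 f2 + xT => /(_ xT) ->.
    rewrite (_ : _ - _ = (a * h1 x - T h1 x) - (a * h2 x - T h2 x)); last by ring.
    by rewrite f1// f2// subrr.
  have := resolvent_bound (L20_0 mu) d0 e; rewrite L2norm_cst normr0 mulr0 => le0.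
  have /(L2norm_eq0 (L20_L2 d0)) : n2 (fun x => h1 x - h2 x) = 0.
    by apply/eqP; rewrite eq_le le0 L2norm_ge0.
  by apply: filterS => x + xT => /(_ xT) /eqP; rewrite subr_eq0 => /eqP.
exists B; split.
- split.
  + by move=> u /hB[].
  + move=> c u v u0 v0; have [Bu eu] := hB _ u0; have [Bv ev] := hB _ v0.
    have w0 := L20_lin c u0 v0; have [Bw ew] := hB _ w0.
    apply: (uniq _ _ _ w0 Bw (L20_lin c Bu Bv) ew).
    have := ml_lin hT c (L20_L2 Bu) (L20_L2 Bv).
    apply: filterS3 eu ev => x f1 f2 + xT => /(_ xT) ->.
    by rewrite -f1// -f2//; ring.
  + exists (a - b)^-1 => u u0; have [Bu eu] := hB _ u0.
    rewrite (Lnorm2E (L20_L2 Bu)) (Lnorm2E (L20_L2 u0)) -EFinM lee_fin.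
    exact: (resolvent_bound u0 Bu eu).
- move=> u u0; have Au0 : L20 mu (fun x => a * u x - T u x).
    have := L20_lin a u0 (L20_lin (-1) (ml_L20 hT u0) (L20_0 mu)); congr L20.
    by apply/funext => x; rewrite mulN1r addr0.
  have [BA eA] := hB _ Au0.
  by apply: (uniq _ _ _ Au0 BA u0 eA); exact: ae_eq_refl.
- by move=> u /hB[].
Qed.

End resolvent.

Section variance.
Context (R : realType) (d : measure_display) (D : measurableType d).
Variable mu : probability D R.
Implicit Types u v : D -> R.
Local Notation L2 := (Lfun mu 2%:E).
Local Notation n2 := (L2norm mu).
Local Notation ip := (L2_inner mu).
Variables (T : (D -> R) -> (D -> R)) (b : R).
Hypotheses (hT : markov_like mu T b) (b1 : b < 1).

Let b0 : 0 <= b. Proof. exact: ml_ge0 hT. Qed.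
Let iter0 := ml_iter_L20 hT.

Definition autocov u (m : nat) : R := ip (iter m T u) u.

(* [n ^+ 2] times the mean square error of the stationary ergodic average. *)
Definition stationary_var u (n : nat) : R :=
  \sum_(i < n) \sum_(j < n) autocov u (natdist i j).

Lemma autocov_le u m : L20 mu u -> `|autocov u m| <= b ^+ m * n2 u ^+ 2.
Proof.
move=> u0; have Tu2 := L20_L2 (iter0 m u0); have u2 := L20_L2 u0.
rewrite (le_trans (cauchy_schwarz Tu2 u2))// expr2 mulrA ler_wpM2r ?L2norm_ge0//.
exact: (L2norm_iter hT).
Qed.

Lemma stationary_var_le u n : L20 mu u ->
  stationary_var u n <= n%:R * (2 / (1 - b)) * n2 u ^+ 2.
Proof.
move=> u0; have b1' : 1 - b != 0 by rewrite gt_eqF// subr_gt0.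
apply: (@le_trans _ _ (\sum_(i < n) \sum_(j < n) b ^+ natdist i j * n2 u ^+ 2)).
  apply: ler_sum => i _; apply: ler_sum => j _.
  by rewrite (le_trans (ler_norm _))// autocov_le.
under eq_bigr do rewrite -mulr_suml.
rewrite -mulr_suml ler_wpM2r ?sqr_ge0//.
rewrite (double_sum_telescope (c := fun m => b ^+ m) (q := fun m => b ^+ m / (1 - b))); last first.
  by move=> m; rewrite exprS; field.
have : 0 <= \sum_(m < n) b ^+ m.+1 / (1 - b).
  by apply: sumr_ge0 => m _; rewrite divr_ge0 ?exprn_ge0// subr_ge0 ltW.
have : 0 <= n%:R :> R by [].
by rewrite !expr0 div1r; nra.
Qed.

Section poisson.
Variables g h : D -> R.
Hypotheses (g0 : L20 mu g) (h0 : L20 mu h).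
Hypothesis poisson : (fun x => h x - T h x) = g %[ae mu].

Lemma iter_poisson m : iter m T g = (fun x => iter m T h x - iter m.+1 T h x) %[ae mu].
Proof.
have hm := markov_like_iter m hT; have Th0 := ml_L20 hT h0.
have d2 := L2B (L20_L2 h0) (L20_L2 Th0).
apply: filterS2 (ml_ae hm d2 (L20_L2 g0) poisson) (mlB hm (L20_L2 h0) (L20_L2 Th0)).
by move=> x f1 f2 xT; rewrite -f1// f2// iterSr.
Qed.

Lemma autocov_poisson m : autocov g m = ip (iter m T h) g - ip (iter m.+1 T h) g.
Proof.
have g2 := L20_L2 g0.
have A2 := L20_L2 (iter0 m h0); have B2 := L20_L2 (iter0 m.+1 h0).
rewrite -(ipBl A2 B2 g2); apply: ip_ae => //.
- exact: L20_L2 (iter0 m g0).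
- exact: L2B.
- exact: iter_poisson.
- exact: ae_eq_refl.
Qed.

Lemma stationary_varE n : stationary_var g n =
  n%:R * (2 * ip h g - ip g g) - 2 * \sum_(m < n) ip (iter m.+1 T h) g.
Proof.
exact: (double_sum_telescope (q := fun m => ip (iter m T h) g) n autocov_poisson).
Qed.

Lemma stationary_var_asymp n :
  `|stationary_var g n - n%:R * (2 * ip h g - ip g g)| <= 2 * (n2 h * n2 g) / (1 - b).
Proof.
have g2 := L20_L2 g0; have b01 : 0 <= b < 1 by rewrite b0.
rewrite stationary_varE addrAC subrr sub0r normrN normrM ger0_norm//.
rewrite -mulrA ler_wpM2l// (le_trans (ler_norm_sum _ _ _))//.
apply: (@le_trans _ _ (\sum_(m < n) b ^+ m * (n2 h * n2 g))).
  apply: ler_sum => m _; rewrite (le_trans (cauchy_schwarz (L20_L2 (iter0 m.+1 h0)) g2))//.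
  rewrite mulrA ler_wpM2r ?L2norm_ge0// (le_trans (L2norm_iter hT m.+1 h0))// ler_wpM2r ?L2norm_ge0//.
  by rewrite exprS ler_piMl ?exprn_ge0// ltW.
rewrite -mulr_suml mulrC ler_wpM2l ?mulr_ge0 ?L2norm_ge0//.
by have := geometric_partial_sum_le 0 n b01; rewrite big_mkord expr0 div1r.
Qed.

Lemma poisson_pair : ip (fun x => h x + T h x) g = 2 * ip h g - ip g g.
Proof.
have h2 := L20_L2 h0; have g2 := L20_L2 g0; have T2 := ml_L2 hT h2.
rewrite (ipDl h2 T2 g2).
have -> : ip g g = ip h g - ip (T h) g by exact: (autocov_poisson 0).
by ring.
Qed.

End poisson.

Section selfadjoint.
Hypothesis sym : forall u v, u \in L2 -> v \in L2 -> ip (T u) v = ip u (T v).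

Lemma ip_iter m u v : u \in L2 -> v \in L2 -> ip (iter m T u) v = ip u (iter m T v).
Proof.
elim: m u v => // m ih u v u2 v2.
have Tu2 := ml_L2 (markov_like_iter m hT) u2.
by rewrite [iter m.+1 T u]/= (sym Tu2 v2) (ih _ _ u2 (ml_L2 hT v2)) -iterSr.
Qed.

(* On the spectrum [(1 - x) ^+ 2 + 2 * x ^+ m * (1 - x) >= 0]. *)
Lemma autocov_poisson_ge0 g h m : L20 mu g -> L20 mu h ->
  (fun x => h x - T h x) = g %[ae mu] -> 0 <= ip g g + 2 * ip (iter m T h) g.
Proof.
move=> g0 h0 pe; have h2 := L20_L2 h0; have g2 := L20_L2 g0.
pose k := m./2.
have A2 := L20_L2 (iter0 k h0); have B2 := L20_L2 (iter0 k.+1 h0).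
have G2 := L20_L2 (iter0 k g0).
have eG := iter_poisson g0 h0 pe k.
have AB2 := L2B A2 B2.
have nB : n2 (iter k.+1 T h) <= n2 (iter k T h).
  rewrite (le_trans (ml_gap hT (iter0 k h0)))// ler_piMl ?L2norm_ge0// ltW//.
have nG : n2 (iter k T g) <= n2 g.
  rewrite (le_trans (L2norm_iter hT k g0))// ler_piMl ?L2norm_ge0//.
  by rewrite exprn_ile1// ltW.
have nA0 := L2norm_ge0 mu (iter k T h); have nB0 := L2norm_ge0 mu (iter k.+1 T h).
have nG0 := L2norm_ge0 mu (iter k T g).
have sG : n2 (iter k T g) ^+ 2 = n2 (iter k T h) ^+ 2 - 2 * ip (iter k T h) (iter k.+1 T h)
    + n2 (iter k.+1 T h) ^+ 2.
  rewrite !sqr_L2norm (ip_ae G2 AB2 G2 AB2 eG eG) (ipBl A2 B2 AB2) (ipBr A2 B2 A2).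
  by rewrite (ipBr A2 B2 B2) (ipC mu (iter k.+1 T h) (iter k T h)); ring.
have m2 : (m = odd m + k + k)%N by rewrite -addnA addnn odd_double_half.
move: m2; case: (odd m) => /= m2.
- have -> : ip (iter m T h) g = ip (iter k T h) (iter k.+1 T h) - n2 (iter k.+1 T h) ^+ 2.
    have -> : m = (k + k.+1)%N by rewrite {1}m2 add1n addSn addnS.
    rewrite iterD (ip_iter k B2 g2).
    rewrite (ip_ae B2 B2 G2 AB2 (ae_eq_refl _ _ _) eG) (ipBr A2 B2 B2) sqr_L2norm.
    by rewrite (ipC mu (iter k.+1 T h) (iter k T h)).
  have -> : ip g g = n2 g ^+ 2 by rewrite sqr_L2norm.
  by nra.
- have -> : ip (iter m T h) g = n2 (iter k T h) ^+ 2 - ip (iter k T h) (iter k.+1 T h).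
    have -> : m = (k + k)%N by rewrite {1}m2 add0n.
    rewrite iterD (ip_iter k A2 g2).
    by rewrite (ip_ae A2 A2 G2 AB2 (ae_eq_refl _ _ _) eG) (ipBr A2 B2 A2) sqr_L2norm.
  have := ip_le_L2norm A2 B2; have := ip_ge0 mu g; nra.
Qed.

Lemma stationary_var_le_gap g n (L : R) : L < 1 -> L20 mu g ->
  (forall u, L20 mu u -> ip (T u) u <= L * ip u u) ->
  stationary_var g n <= n%:R * (2 / (1 - L)) * n2 g ^+ 2.
Proof.
move=> L1 g0 hL; have g2 := L20_L2 g0.
have [h [h0 pe1]] := resolvent_exists hT b1 g0.
have pe : (fun x => h x - T h x) = g %[ae mu].
  by apply: filterS pe1 => x + xT => /(_ xT) <-; rewrite mul1r.
have h2 := L20_L2 h0.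
rewrite (stationary_varE g0 h0 pe).
have hg : ip h g <= n2 g ^+ 2 / (1 - L).
  have T2 := ml_L2 hT h2.
  have e : ip h g = ip h h - ip h (T h).
    by rewrite -(ipBr h2 T2 h2); apply: (ip_ae h2 h2 g2 (L2B h2 T2) (ae_eq_refl _ _ _)); exact: ae_eq_sym.
  have := hL _ h0; rewrite (ipC mu (T h) h) -sqr_L2norm => l1.
  have := ip_le_L2norm h2 g2; rewrite e -sqr_L2norm => l2.
  have nh := L2norm_ge0 mu h; have ng := L2norm_ge0 mu g.
  have l3 : (1 - L) * n2 h <= n2 g.
    have := nh; rewrite le_eqVlt => /predU1P[<-|nh0]; first by rewrite mulr0.
    by rewrite -(ler_pM2r nh0); nra.
  rewrite ler_pdivlMr ?subr_gt0//.
  by nra.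
have sum0 : 0 <= \sum_(m < n) (ip g g + 2 * ip (iter m.+1 T h) g).
  by apply: sumr_ge0 => m _; exact: autocov_poisson_ge0.
rewrite big_split/= sumr_const card_ord -mulr_natl -mulr_sumr in sum0.
have : n%:R * (2 * ip h g) <= n%:R * (2 / (1 - L)) * n2 g ^+ 2.
  rewrite -mulrA ler_wpM2l// mulrAC -mulrA ler_wpM2l//.
by lra.
Qed.

Lemma spectrum_ub a : L20_spectrum mu T a -> a <= b.
Proof. by apply: contra_notP => /negP; rewrite -ltNge => ba; exact: (resolvent hT ba). Qed.

Let numrange := [set ip (T u) u | u in [set u | L20 mu u /\ ip u u = 1]].

Lemma numrange_sup : L20_nontrivial mu -> has_sup numrange.
Proof.
move=> [u u0 un]; have u2 := L20_L2 u0; split; last first.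
  exists b => _ [v [v0 v1] <-]; have v2 := L20_L2 v0.
  rewrite (le_trans (ip_le_L2norm (ml_L2 hT v2) v2))//.
  have nv : n2 v = 1 by rewrite /L2norm v1 sqrtr1.
  by rewrite nv mulr1 (le_trans (ml_gap hT v0))// nv mulr1.
have nu : n2 u != 0 by apply/eqP => /(L2norm_eq0 u2).
pose v : D -> R := fun x => (n2 u)^-1 * u x.
exists (ip (T v) v); exists v => //; split.
  by have := L20_lin (n2 u)^-1 u0 (L20_0 mu); under eq_fun do rewrite addr0.
by rewrite (ipZl _ u2 (L2Z _ u2)) ipC (ipZl _ u2 u2) -sqr_L2norm; field.
Qed.

Lemma numrange_le u : L20_nontrivial mu -> L20 mu u ->
  ip (T u) u <= sup numrange * ip u u.
Proof.
move=> nt u0; have u2 := L20_L2 u0; have [_ ub] := numrange_sup nt.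
have := L2norm_ge0 mu u; rewrite le_eqVlt => /predU1P[/esym nu|nu].
  have := ip_le_L2norm (ml_L2 hT u2) u2; rewrite -(sqr_L2norm mu u) nu mulr0.
  by rewrite expr0n mulr0.
have nu' : n2 u != 0 by rewrite gt_eqF.
pose v : D -> R := fun x => (n2 u)^-1 * u x.
have v0 : L20 mu v.
  by have := L20_lin (n2 u)^-1 u0 (L20_0 mu); under eq_fun do rewrite addr0.
have v2 := L20_L2 v0.
have v1 : ip v v = 1.
  by rewrite (ipZl _ u2 (L2Z _ u2)) ipC (ipZl _ u2 u2) -sqr_L2norm; field.
have Tv : ip (T v) v = (n2 u) ^- 2 * ip (T u) u.
  have Tu2 := ml_L2 hT u2.
  have e : T v = (fun x => (n2 u)^-1 * T u x) %[ae mu].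
    have := ml_lin hT (n2 u)^-1 u2 (L2_cst mu 0).
    under [X in T X]eq_fun do rewrite addr0.
    by apply: filterS2 (ml_cst hT 0) => x f1 + xT => /(_ xT) ->; rewrite f1// addr0.
  rewrite (ip_ae (ml_L2 hT v2) (L2Z _ Tu2) v2 v2 e (ae_eq_refl _ _ _)).
  by rewrite (ipZl _ Tu2 v2) ipC (ipZl _ u2 Tu2) (ipC _ u) mulrA -expr2 exprVn.
have : ip (T v) v <= sup numrange by apply: (sup_upper_bound (numrange_sup nt)); exists v.
by rewrite Tv -sqr_L2norm mulrC ler_pdivrMr// exprn_gt0.
Qed.

(* [A = M - T] is nonnegative, so [<A w, w> >= 0] at [w = u - A u / k] gives
   [|A u|^2 <= k <A u, u>]: an inverse of [A] would keep [<T u, u>] away from its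
   supremum [M] on the unit sphere. *)
Lemma numrange_sup_spectrum : L20_nontrivial mu -> L20_spectrum mu T (sup numrange).
Proof.
move=> nt; set M := sup numrange => -[B [[BL20 _ [C hC]] BA _]].
pose A u : D -> R := fun x => M * u x - T u x.
have A0 u : L20 mu u -> L20 mu (A u).
  move=> u0; have := L20_lin M u0 (L20_lin (-1) (ml_L20 hT u0) (L20_0 mu)); congr L20.
  by apply/funext => x; rewrite mulN1r addr0.
have Ape u : L20 mu u -> ip (A u) u = M * ip u u - ip (T u) u.
  move=> u0; have u2 := L20_L2 u0.
  by rewrite (ipBl (L2Z M u2) (ml_L2 hT u2) u2) (ipZl _ u2 u2).
have Aipge0 u : L20 mu u -> 0 <= ip (A u) u.
  by move=> u0; rewrite Ape// subr_ge0; exact: numrange_le.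
pose k := `|M| + b + 1.
have k0 : 0 < k by rewrite /k -addrA ltr_wpDl// ltr_wpDl.
have nA u : L20 mu u -> n2 (A u) <= k * n2 u.
  move=> u0; have u2 := L20_L2 u0.
  rewrite (le_trans (L2normB (L2Z M u2) (ml_L2 hT u2)))// L2normZ//.
  have := ml_gap hT u0; have := L2norm_ge0 mu u; rewrite /k; nra.
have sqA u : L20 mu u -> n2 (A u) ^+ 2 <= k * ip (A u) u.
  move=> u0; have u2 := L20_L2 u0; have Au0 := A0 _ u0; have Au2 := L20_L2 Au0.
  have AAu2 := L20_L2 (A0 _ Au0).
  pose w : D -> R := fun x => - k^-1 * A u x + u x.
  have w0 : L20 mu w by exact: L20_lin.
  have w2 := L20_L2 w0.
  have eAw : A w = (fun x => - k^-1 * A (A u) x + A u x) %[ae mu].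
    have := ml_lin hT (- k^-1) Au2 u2.
    apply: filterS => x wx xT.
    have {}wx : T w x = - k^-1 * T (A u) x + T u x := wx xT.
    have Ax v : A v x = M * v x - T v x by [].
    have ex : w x = - k^-1 * A u x + u x by [].
    by rewrite (Ax w) wx ex (Ax (A u)) (Ax u); ring.
  have := Aipge0 _ w0.
  rewrite (ip_ae (L20_L2 (A0 _ w0)) (L2_lin _ AAu2 Au2) w2 w2 eAw (ae_eq_refl _ _ _)).
  rewrite (ip_linl _ AAu2 Au2 w2) (ip_linr _ Au2 u2 AAu2) (ip_linr _ Au2 u2 Au2).
  have -> : ip (A (A u)) u = ip (A u) (A u).
    have TAu2 := ml_L2 hT Au2; have Tu2 := ml_L2 hT u2.
    rewrite {1}/A (ipBl (L2Z M Au2) TAu2 u2) (ipZl _ Au2 u2) (sym Au2 u2).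
    rewrite [in RHS]/A (ipBr (L2Z M u2) Tu2 Au2) (ipC _ (A u) (fun x => M * u x)).
    by rewrite (ipZl _ u2 Au2) (ipC _ u).
  have hAA : ip (A (A u)) (A u) <= k * n2 (A u) ^+ 2.
    rewrite (le_trans (ip_le_L2norm AAu2 Au2))// expr2 mulrA ler_wpM2r ?L2norm_ge0//.
    exact: nA.
  rewrite -(sqr_L2norm mu (A u)).
  have kk : 0 < k^-1 by rewrite invr_gt0.
  have h1 : k^-1 * ip (A (A u)) (A u) <= n2 (A u) ^+ 2.
    by rewrite mulrC ler_pdivrMr// mulrC.
  have h2 : k^-1 * (k^-1 * ip (A (A u)) (A u)) <= k^-1 * n2 (A u) ^+ 2.
    by rewrite ler_wpM2l// ltW.
  move=> h3; have h4 : k^-1 * n2 (A u) ^+ 2 <= ip (A u) u by lra.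
  by move: h4; rewrite mulrC ler_pdivrMr// mulrC.
pose C1 := `|C| + 1.
have C10 : 0 < C1 by rewrite /C1 ltr_wpDl.
have lowb u : L20 mu u -> ip u u = 1 -> 1 <= C1 ^+ 2 * k * (M - ip (T u) u).
  move=> u0 u1; have u2 := L20_L2 u0; have Au0 := A0 _ u0; have Au2 := L20_L2 Au0.
  have BA0 := BL20 _ Au0.
  have nu : n2 u = 1 by rewrite /L2norm u1 sqrtr1.
  have := hC _ Au0; rewrite (Lnorm2E (L20_L2 BA0)) (Lnorm2E Au2) -EFinM lee_fin.
  rewrite (L2norm_ae (L20_L2 BA0) u2 (BA _ u0)) nu => h1.
  have nA0 := L2norm_ge0 mu (A u).
  have h2 : 1 <= C1 * n2 (A u).
    by rewrite (le_trans h1)// ler_wpM2r// /C1 (le_trans (ler_norm _))// lerDl.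
  have h3 : 1 <= C1 ^+ 2 * n2 (A u) ^+ 2 by rewrite -exprMn exprn_ege1.
  rewrite (le_trans h3)// -mulrA ler_wpM2l ?sqr_ge0//.
  by have := sqA _ u0; rewrite Ape// u1 mulr1.
have ck0 : 0 < C1 ^+ 2 * k by rewrite mulr_gt0// exprn_gt0.
have : M <= M - (C1 ^+ 2 * k)^-1.
  apply: ge_sup; first by case: (numrange_sup nt).
  move=> _ [u [u0 u1] <-]; rewrite lerBrDr -lerBrDl.
  by rewrite -div1r ler_pdivrMr// mulrC lowb.
by rewrite lerDl oppr_ge0 leNgt invr_gt0 ck0.
Qed.

Lemma spectral_gap : L20_nontrivial mu ->
  sup (L20_spectrum mu T) < 1 /\
  (forall u, L20 mu u -> ip (T u) u <= sup (L20_spectrum mu T) * ip u u).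
Proof.
move=> nt; have hs : has_sup (L20_spectrum mu T).
  split; first by exists (sup numrange); exact: numrange_sup_spectrum.
  by exists b => a /spectrum_ub.
split.
  by rewrite (le_lt_trans _ b1)//; apply: ge_sup => [|a /spectrum_ub//]; case: hs.
move=> u u0; rewrite (le_trans (numrange_le nt u0))// ler_wpM2r ?ip_ge0//.
by apply: (sup_upper_bound hs); exact: numrange_sup_spectrum.
Qed.

End selfadjoint.

End variance.

(** * Lp norms *)

Section Lnorm_extra.
Context (R : realType) (d : measure_display) (D : measurableType d).
Variable mu : {measure set D -> \bar R}.
Implicit Types f g h : D -> R.
Local Open Scope ereal_scope.
Local Notation "'N_ p [ f ]" := (Lnorm mu p%:E (EFin \o f)).

Lemma measurable_norm_powR f (s : R) : measurable_fun setT f ->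
  measurable_fun setT (fun x => `|f x| `^ s)%R.
Proof.
move=> mf; apply: (@measurableT_comp _ _ _ _ _ _ (@powR R ^~ s)) => //.
exact: measurableT_comp.
Qed.

Lemma Lnorm_norm_powR f (p s : R) : (0 < p)%R -> (0 < s)%R ->
  'N_p[(fun x => `|f x| `^ s)%R] = 'N_(s * p)%R[f] `^ s.
Proof.
move=> p0 s0; rewrite unlock /Lnorm -poweRrM invfM mulrAC mulVf ?gt_eqF// mul1r.
congr (_ `^ _); apply: eq_integral => x _ /=.
by rewrite ger0_norm ?powR_ge0// powRrM.
Qed.

Lemma hoelder_gen f g (p q s : R) : measurable_fun setT f -> measurable_fun setT g ->
  (0 < p)%R -> (0 < q)%R -> (0 < s)%R -> (p^-1 + q^-1 = s^-1)%R ->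
  'N_s[(f \* g)%R] <= 'N_p[f] * 'N_q[g].
Proof.
move=> mf mg p0 q0 s0 pqs.
have ps0 : (0 < p / s)%R by rewrite divr_gt0.
have qs0 : (0 < q / s)%R by rewrite divr_gt0.
have sn0 : s != 0%R by rewrite gt_eqF.
have h := @hoelder _ _ _ mu (fun x => `|f x| `^ s)%R (fun x => `|g x| `^ s)%R (p / s)%R (q / s)%R
  (measurable_norm_powR s mf) (measurable_norm_powR s mg) ps0 qs0.
have {}h : 'N_1[((fun x => `|f x| `^ s) \* (fun x => `|g x| `^ s))%R] <=
    'N_p[f] `^ s * 'N_q[g] `^ s.
  have e : ((p / s)^-1 + (q / s)^-1 = 1)%R by rewrite !invf_div -mulrDr pqs mulfV.
  by move: (h e); rewrite !Lnorm_norm_powR// !(mulrC s) !divfK.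
have e1 : 'N_1[((fun x => `|f x| `^ s) \* (fun x => `|g x| `^ s))%R] =
    'N_s[(f \* g)%R] `^ s.
  rewrite poweR_Lnorm// Lnorm1; apply: eq_integral => x _ /=.
  by rewrite (ger0_norm (mulr_ge0 (powR_ge0 _ _) (powR_ge0 _ _))) normrM powRM.
rewrite e1 -poweRM ?Lnorm_ge0// in h.
have := gt0_ler_poweR (r := s^-1) _ _ _ h.
rewrite -!poweRrM mulfV// !poweRe1 ?mule_ge0 ?Lnorm_ge0//; apply.
- by rewrite invr_ge0 ltW.
- by rewrite in_itv/= leey poweR_ge0.
- by rewrite in_itv/= leey poweR_ge0.
Qed.

Lemma hoelder3 f g h (r q : R) : measurable_fun setT f -> measurable_fun setT g ->
  measurable_fun setT h -> (2 < r)%R -> (0 < q)%R -> (2 / r + q^-1 = 1)%R ->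
  'N_1[(fun x => f x * (g x * h x))%R] <= 'N_r[f] * ('N_r[g] * 'N_q[h]).
Proof.
move=> mf mg mh r2 q0 rq.
have r0 : (0 < r)%R by lra.
have s0 : (0 < 1 - r^-1)%R by rewrite subr_gt0 invf_lt1//; lra.
pose s := (1 - r^-1)^-1%R; have s_gt0 : (0 < s)%R by rewrite invr_gt0.
have mgh : measurable_fun setT (g \* h)%R by exact: measurable_funM.
apply: (@le_trans _ _ ('N_r[f] * 'N_s[(g \* h)%R])).
  by apply: hoelder => //; rewrite /s invrK; ring.
rewrite lee_wpmul2l ?Lnorm_ge0//; apply: hoelder_gen => //.
by rewrite /s invrK -rq; ring.
Qed.

End Lnorm_extra.

Section Lnorm_probability.
Context (R : realType) (d : measure_display) (D : measurableType d).
Variable mu : probability D R.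
Implicit Types f g h : D -> R.
Local Open Scope ereal_scope.

Lemma Lnorm_mono f (s p : R) : measurable_fun setT f -> (0 < s)%R -> (s <= p)%R ->
  'N[mu]_s%:E[EFin \o f] <= 'N[mu]_p%:E[EFin \o f].
Proof.
move=> mf s0; rewrite le_eqVlt => /predU1P[->//|sp].
have p0 : (0 < p)%R by exact: lt_trans sp.
have q0 : (0 < s^-1 - p^-1)%R by rewrite subr_gt0 ltf_pV2.
have := @hoelder_gen _ _ _ mu f (cst 1%R) p (s^-1 - p^-1)^-1%R s mf (measurable_cst _) p0 _ s0.
rewrite invr_gt0 invrK => /(_ q0) h.
have {h} := h (ltac:(by rewrite addrC subrK)).
rewrite (_ : EFin \o cst 1%R = cst 1)// Lnorm_cst1/= probability_setT poweR1r mule1.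
by rewrite (_ : (f \* cst 1%R)%R = f)//; apply/funext => x /=; rewrite mulr1.
Qed.

Lemma Lnorm_le_y f (s : R) : measurable_fun setT f -> (0 < s)%R ->
  'N[mu]_s%:E[EFin \o f] <= 'N[mu]_+oo[EFin \o f].
Proof.
move=> mf s0; rewrite unlock /Lnorm/= probability_setT lte01.
set M := (X in _ <= X).
have muT : 0 < mu [set: D] by rewrite probability_setT lte01.
have M0 : 0 <= M by apply: (ess_sup_gee muT); apply: nearW => x; exact: abse_ge0.
have [My|] := eqVneq M +oo; first by rewrite My leey.
rewrite -ltey => Mlty; have Mfin : M \is a fin_num by rewrite ge0_fin_numE.
have fM : \forall x \ae mu, (`|f x| <= fine M)%R.
  apply: filterS (ess_sup_ge mu (abse \o (EFin \o f))) => x.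
  by rewrite -/M -(fineK Mfin) /= lee_fin.
rewrite -[leRHS](poweRe1 M0) -(mulfV (x := s)) ?gt_eqF// poweRrM.
apply: gt0_ler_poweR; rewrite ?invr_ge0 ?(ltW s0) ?in_itv/= ?leey ?andbT//.
- by apply: integral_ge0 => x _; rewrite lee_fin powR_ge0.
- exact: poweR_ge0.
rewrite -(fineK Mfin) poweR_EFin.
have -> : ((fine M `^ s)%:E = \int[mu]_x (fine M `^ s)%:E).
  by rewrite integral_cst//= probability_setT mule1.
apply: ae_ge0_le_integral => //.
- exact/measurable_EFinP/measurable_norm_powR.
- by move=> x _; rewrite lee_fin powR_ge0.
apply: filterS fM => x h _; rewrite /= lee_fin.
by apply: ge0_ler_powR; rewrite ?nnegrE ?fine_ge0// ltW.
Qed.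

End Lnorm_probability.

Section Lnorm_markov.
Context (R : realType) (d : measure_display) (D : measurableType d).
Variable mu : probability D R.
Implicit Types u v w : D -> R.
Local Notation L2 := (Lfun mu 2%:E).
Local Notation n2 := (L2norm mu).

Lemma LfunP_fin (p : \bar R) u : (u \in Lfun mu p) <->
  measurable_fun setT u /\ ('N[mu]_p[EFin \o u] < +oo)%E.
Proof.
split; first by rewrite inE => /andP[]; rewrite !inE.
by move=> [m f]; rewrite inE; apply/andP; split; rewrite inE.
Qed.

Definition pnorm (r : R) u : R := fine ('N[mu]_r%:E[EFin \o u])%E.

Lemma pnorm_ge0 r u : 0 <= pnorm r u.
Proof. by rewrite /pnorm fine_ge0// Lnorm_ge0. Qed.

Lemma pnormE r u : u \in Lfun mu r%:E -> ('N[mu]_r%:E[EFin \o u] = (pnorm r u)%:E)%E.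
Proof. by move=> /LfunP_fin[_ h]; rewrite /pnorm fineK// ge0_fin_numE// Lnorm_ge0. Qed.

Lemma Lfun_le (s p : R) u : 0 < s -> s <= p -> u \in Lfun mu p%:E -> u \in Lfun mu s%:E.
Proof.
move=> s0 sp /LfunP_fin[m h]; apply/LfunP_fin; split => //.
exact: le_lt_trans (Lnorm_mono mu m s0 sp) h.
Qed.

Lemma Lfun_L2 (r : R) u : 2 <= r -> u \in Lfun mu r%:E -> u \in L2.
Proof. by move=> r2; apply: Lfun_le. Qed.

Section operator.
Variables (T : (D -> R) -> (D -> R)) (b : R).
Hypothesis hT : markov_like mu T b.

Lemma centered_op_Lnorm (r : R) u : 2 <= r -> u \in Lfun mu r%:E ->
  centered_op mu T u \in Lfun mu r%:E /\
  pnorm r (centered_op mu T u) <= 2 * b `^ (2 / r) * pnorm r u.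
Proof.
move=> r2 ur; have u2 := Lfun_L2 r2 ur; have cT2 := centered_op_L2 hT u2.
have b0 := ml_ge0 hT.
have mT := Lfun_measurable cT2.
suff h : ('N[mu]_r%:E[EFin \o centered_op mu T u] <= (2 * b `^ (2 / r) * pnorm r u)%:E)%E.
  have cTr : centered_op mu T u \in Lfun mu r%:E.
    by apply/LfunP_fin; split => //; apply: le_lt_trans h _; exact: ltry.
  by split => //; rewrite -lee_fin -pnormE.
move: r2; rewrite le_eqVlt => /predU1P[r2|r2].
  rewrite -r2 /pnorm Lnorm2E// Lnorm2E//= lee_fin divff ?pnatr_eq0// powRr1//.
  rewrite (le_trans (centered_op_gap hT u2))// -mulrA ler_peMl ?mulr_ge0 ?L2norm_ge0//.
  by rewrite ler1n.
have r0 : 0 < r by lra.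
rewrite EFinM -pnormE// unlock /Lnorm.
have h := centered_op_power hT r2 u2.
have -> : ((2 * b `^ (2 / r))%:E = (2 `^ r * b ^+ 2)%:E `^ r^-1)%E.
  rewrite poweR_EFin powRM ?powR_ge0 ?sqr_ge0// -powRrM mulfV ?gt_eqF// powRr1//.
  by rewrite -powR_mulrn// -powRrM.
rewrite -poweRM ?lee_fin ?mulr_ge0 ?powR_ge0 ?sqr_ge0 ?integral_ge0//.
apply: gt0_ler_poweR => //.
- by rewrite invr_ge0 ltW.
- by rewrite in_itv/= leey integral_ge0// => x _; rewrite lee_fin powR_ge0.
- rewrite in_itv/= leey andbT mule_ge0 ?lee_fin ?mulr_ge0 ?powR_ge0 ?sqr_ge0//.
  by apply: integral_ge0 => x _; rewrite lee_fin powR_ge0.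
- by move=> x _; exact: poweR_ge0.
Qed.

Lemma ml_Lnorm (r : R) u : 2 <= r -> L20 mu u -> u \in Lfun mu r%:E ->
  T u \in Lfun mu r%:E /\ pnorm r (T u) <= 2 * b `^ (2 / r) * pnorm r u.
Proof.
move=> r2 u0 ur; have := centered_op_Lnorm r2 ur.
rewrite (_ : centered_op mu T u = T u)//.
by apply/funext => x; rewrite /centered_op u0.2 subr0.
Qed.

End operator.

Lemma center_Lfun (r : R) u : 2 <= r -> u \in Lfun mu r%:E ->
  (fun x => u x - \int[mu]_y u y) \in Lfun mu r%:E /\
  pnorm r (fun x => u x - \int[mu]_y u y) <= 2 * pnorm r u.
Proof.
move=> r2 ur; have := centered_op_Lnorm (markov_like_id mu) r2 ur.
by rewrite powR1 mulr1.
Qed.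

Lemma hoelder3_integrable (r q : R) u v w : u \in Lfun mu r%:E -> v \in Lfun mu r%:E ->
  w \in Lfun mu q%:E -> 2 < r -> 0 < q -> 2 / r + q^-1 = 1 ->
  mu.-integrable setT (fun x => (u x * (v x * w x))%:E) /\
  `|\int[mu]_x (u x * (v x * w x))| <= pnorm r u * (pnorm r v * pnorm q w).
Proof.
move=> ur vr wq r2 q0 rq.
have mu_ := Lfun_measurable ur; have mv := Lfun_measurable vr; have mw := Lfun_measurable wq.
have h := hoelder3 mu mu_ mv mw r2 q0 rq.
rewrite (pnormE ur) (pnormE vr) (pnormE wq) -!EFinM Lnorm1 in h.
have mm : measurable_fun setT (fun x => (u x * (v x * w x))%:E).
  by apply/measurable_EFinP; apply: measurable_funM => //; exact: measurable_funM.
have ii : mu.-integrable setT (fun x => (u x * (v x * w x))%:E).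
  by apply/integrableP; split => //; apply: le_lt_trans h _; exact: ltry.
split => //; rewrite -lee_fin EFin_normr_Rintegral//.
by apply: le_trans h; exact: le_abse_integral.
Qed.

Lemma le_one_minus_powR (b t : R) : 0 <= b < 1 -> 0 < t <= 1 ->
  t * (1 - b) <= 1 - b `^ t.
Proof.
move=> /andP[b0 b1] /andP[t0 t1].
have [->|t1'] := eqVneq t 1; first by rewrite powRr1// mul1r.
have t_lt1 : t < 1 by rewrite lt_neqAle t1' t1.
have := @conjugate_powR R (b `^ t) 1 t^-1 (1 - t)^-1 (powR_ge0 _ _) ler01.
rewrite !invr_gt0 t0 subr_gt0 t_lt1 !invrK => /(_ isT isT).
rewrite addrC subrK => /(_ erefl).
rewrite mulr1 -powRrM mulfV ?gt_eqF// powRr1// powR1; lra.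
Qed.

End Lnorm_markov.

(** * Reversible kernels *)

Section reversible.
Context (R : realType) (d : measure_display) (D : measurableType d).
Variables (K : R.-pker D ~> D) (pi : probability D R).
Hypotheses (hpi : stationary K pi) (hrev : reversible K pi).
Implicit Types u v w : D -> R.
Local Notation L2 := (Lfun pi 2%:E).
Local Notation ip := (L2_inner pi).
Local Notation P := (markov_op K).

Let mK A : measurable A -> measurable_fun setT (fun x => K x A).
Proof. exact: measurable_kernel. Qed.

Lemma reversible_set A u : measurable A -> measurable_fun setT u ->
  (forall x, 0 <= u x) ->
  (\int[pi]_x ((\1_A x)%:E * \int[K x]_y (u y)%:E) =
   \int[pi]_x ((u x)%:E * K x A))%E.
Proof.
move=> mA mu u0.
have KA x : (K x A = (fine (K x A))%:E)%E.
  rewrite fineK//; exact: (fin_num_measure (kernel_prob K x) A mA).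
have mfK : measurable_fun setT (fun x => fine (K x A)).
  by apply: (measurableT_comp (fine_measurable measurableT)); exact: mK.
rewrite (@eq_kernel_integral_eval _ _ _ _ _ _ _ pi pi \1_A (fun x => fine (K x A))
  (fun x => K x) id (EFin \o u)) => //.
- by apply: eq_integral => x _; rewrite -KA muleC.
- move=> B mB; under [RHS]eq_integral do rewrite -KA.
  transitivity (\int[pi]_(x in A) K x B)%E.
    by rewrite [RHS]integral_mkcond epatch_indic; apply: eq_integral => x _; rewrite muleC.
  by rewrite -(hrev mA mB) [LHS]integral_mkcond epatch_indic.
- exact/measurable_EFinP.
Qed.

Lemma reversible_is_adjoint v : v \in L2 -> (forall x, 0 <= v x) ->
  is_adjoint K pi v (P v).
Proof.
move=> v2 v0; have mv := Lfun_measurable v2; have Pv2 := markov_op_L2 hpi v2.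
have mPv := Lfun_measurable Pv2.
split=> [//|x|u mu u0]; first exact: markov_op_ge0.
apply: (@eq_kernel_integral_eval _ _ _ _ _ _ _ pi pi v (P v) (fun x => K x) id u) => //.
- by move=> x; exact: markov_op_ge0.
- move=> A mA; rewrite -reversible_set//; apply: ae_eq_integral => //.
  + apply: emeasurable_funM; first exact/measurable_EFinP/measurable_indic.
    by apply: measurable_fun_integral_kernel => //; exact/measurable_EFinP.
  + by apply: emeasurable_funM; apply/measurable_EFinP => //; exact: measurable_indic.
  + apply: filterS (EFin_markov_op hpi v2) => x + xT => /(_ xT) <-.
    by rewrite muleC.
Qed.

Lemma reversible_ip u v : u \in L2 -> v \in L2 -> ip (P u) v = ip u (P v).
Proof.
have max0 (a : R) : 0 <= Num.max a 0 by rewrite le_max lexx orbT.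
have ge0 a c : a \in L2 -> (forall x, 0 <= a x) -> c \in L2 -> (forall x, 0 <= c x) ->
    ip (P a) c = ip a (P c).
  move=> a2 a0 c2 c0; have h := is_adjoint_pair hpi a2 (reversible_is_adjoint a2 a0) c2 c0.
  by rewrite {1}/L2_inner /Rintegral h.
have ge0l a c : a \in L2 -> (forall x, 0 <= a x) -> c \in L2 ->
    ip (P a) c = ip a (P c).
  move=> a2 a0 c2; have p2 := L2_pos c2; have m2 := L2_neg c2.
  have Pa2 := markov_op_L2 hpi a2.
  have Pp2 := markov_op_L2 hpi p2; have Pm2 := markov_op_L2 hpi m2.
  have := markov_opB hpi p2 m2; under [X in P X]eq_fun do rewrite pos_subr_neg.
  move=> h; rewrite (ip_ae a2 a2 (markov_op_L2 hpi c2) (L2B Pp2 Pm2) _ h); last exact: ae_eq_refl.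
  rewrite (ipBr Pp2 Pm2 a2) -(ge0 _ _ a2 a0 p2 (fun x => max0 _)).
  rewrite -(ge0 _ _ a2 a0 m2 (fun x => max0 _)) -(ipBr p2 m2 Pa2).
  by congr ip; apply/funext => x; rewrite pos_subr_neg.
move=> u2 v2; have p2 := L2_pos u2; have m2 := L2_neg u2.
have Pv2 := markov_op_L2 hpi v2.
have Pp2 := markov_op_L2 hpi p2; have Pm2 := markov_op_L2 hpi m2.
have := markov_opB hpi p2 m2; under [X in P X]eq_fun do rewrite pos_subr_neg.
move=> h; rewrite (ip_ae (markov_op_L2 hpi u2) (L2B Pp2 Pm2) v2 v2 h); last exact: ae_eq_refl.
rewrite (ipBl Pp2 Pm2 v2) (ge0l _ _ p2 (fun x => max0 _) v2).
rewrite (ge0l _ _ m2 (fun x => max0 _) v2) -(ipBl p2 m2 Pv2).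
by congr ip; apply/funext => x; rewrite pos_subr_neg.
Qed.

End reversible.

(** * Densities and comparison of the errors *)

Section density_facts.
Context (R : realType) (d : measure_display) (D : measurableType d).
Variables (nu pi : probability D R).
Hypothesis hnu : nu `<< pi.
Local Notation rn := (density nu pi).

Lemma density_fin_num x : rn x \is a fin_num.
Proof. exact: Radon_Nikodym_fin_num. Qed.

Lemma measurable_density : measurable_fun setT rn.
Proof. exact: measurable_int (Radon_Nikodym_integrable _). Qed.

Lemma density_ge0 : \forall x \ae pi, (0 <= rn x)%E.
Proof.
have [g [g0 ig gE]] := radon_nikodym_finite hnu.
have h := @integral_ae_eq _ _ _ pi setT measurableT rn g ig measurable_density.
apply: filterS (h _) => [x /(_ I) <-//|A _ mA].
by rewrite -gE// -(Radon_Nikodym_integral (nu := charge_of_finite_measure nu)).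
Qed.

Definition density0 x : R := `|fine (rn x)|.

Lemma density0_ge0 x : 0 <= density0 x. Proof. exact: normr_ge0. Qed.

Lemma measurable_density0 : measurable_fun setT density0.
Proof.
apply: measurableT_comp => //; apply: (measurableT_comp (fine_measurable measurableT)).
exact: measurable_density.
Qed.

Lemma density0E : density0 = (fun x => fine (rn x)) %[ae pi].
Proof. by apply: filterS density_ge0 => x h _; rewrite /density0 ger0_norm// fine_ge0. Qed.

Lemma density0_law A : measurable A ->
  (nu A = \int[pi]_x ((density0 x)%:E * (\1_A x)%:E))%E.
Proof.
move=> mA; rewrite [LHS](Radon_Nikodym_integral (nu := charge_of_finite_measure nu) hnu mA) integral_mkcond.
apply: ae_eq_integral => //.
- exact: (measurable_restrictT _ mA).1 (measurable_funTS measurable_density).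
- apply: emeasurable_funM; apply/measurable_EFinP; [exact: measurable_density0|].
  exact: measurable_indic.
apply: filterS density0E => x /(_ I) h xT.
by rewrite epatch_indic /= h fineK// density_fin_num.
Qed.

End density_facts.

Section transported_density.
Context (R : realType) (d : measure_display) (D : measurableType d).
Variables (K : R.-pker D ~> D) (nu pi : probability D R).
Hypothesis hpi : stationary K pi.
Implicit Types u v : D -> R.
Local Notation L2 := (Lfun pi 2%:E).
Local Notation ip := (L2_inner pi).
Local Notation P := (markov_op K).

Variables rho0 w : D -> R.
Hypothesis rho0_ge0 : forall x, 0 <= rho0 x.
Hypothesis rho0_meas : measurable_fun setT rho0.
Hypothesis rho0_nu : forall A, measurable A ->
  (nu A = \int[pi]_x ((rho0 x)%:E * (\1_A x)%:E))%E.
Hypothesis w2 : w \in L2.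
Hypothesis rho0E : rho0 = (fun x => w x + 1) %[ae pi].

Definition transported (a : nat) : D -> R := iter a (adjoint0 K pi) rho0.

Lemma transported_L2 a : transported a \in L2 /\ forall x, 0 <= transported a x.
Proof.
elim: a => [|a [a2 a0]]; last first.
  by have [_ h _] := adjoint0P hpi a2 a0; split => //; exact: adjoint0_L2.
by split => //; apply: (L2_ae rho0_meas _ rho0E); exact: L2D w2 (L2_cst pi 1).
Qed.

Lemma transported_adjoint a : is_adjoint K pi (transported a) (transported a.+1).
Proof. by have [a2 a0] := transported_L2 a; exact: adjoint0P. Qed.

Lemma deviation_L20 : L20 pi w.
Proof.
split=> //.
have : \int[pi]_x rho0 x = 1.
  have := rho0_nu measurableT; rewrite probability_setT => h.
  rewrite /Rintegral -[RHS]/(fine 1%E) h; congr fine.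
  by apply: eq_integral => x _; rewrite indicT mule1.
have r2 := (transported_L2 0).1.
have w12 := L2D w2 (L2_cst pi 1).
rewrite (Rintegral_ae (Lfun_measurable r2) (Lfun_measurable w12) rho0E).
rewrite RintegralD//; [|exact: L2_integrable|exact: (L2_integrable (L2_cst pi 1))].
by rewrite Rintegral_prob_cst; lra.
Qed.

Lemma transportedE a :
  transported a = (fun x => iter a (adjoint K pi) w x + 1) %[ae pi].
Proof.
have hA := markov_like_adjoint hpi.
elim: a => [//|a ih]; have [a2 a0] := transported_L2 a.
have i2 : iter a (adjoint K pi) w \in L2 by exact: (ml_L2 (markov_like_iter a hA)).
have one2 := L2_cst pi 1.
have i12 := L2D i2 one2.
apply: (ip_ext (transported_L2 a.+1).1 (L2D (ml_L2 hA i2) one2)) => z z2.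
have Pz2 := markov_op_L2 hpi z2.
rewrite [in LHS]/= (ip_adjoint0 hpi a2 a0 z2) (ipDl (ml_L2 hA i2) one2 z2).
rewrite (ip_adjoint hpi i2 z2) (ip_ae a2 i12 Pz2 Pz2 ih); last exact: ae_eq_refl.
rewrite (ipDl i2 one2 Pz2); congr (_ + _).
by rewrite !ip_one markov_op_int.
Qed.

Variables r q : R.
Hypotheses (r2 : 2 < r) (q2 : 2 <= q) (rq : 2 / r + q^-1 = 1).
Hypothesis wq : w \in Lfun pi q%:E.

Let q0 : 0 < q. Proof. exact: lt_le_trans q2. Qed.

Lemma transported_deviation_Lnorm a : iter a (adjoint K pi) w \in Lfun pi q%:E /\
  pnorm pi q (iter a (adjoint K pi) w) <= 2 * (beta pi K ^+ a) `^ (2 / q) * pnorm pi q w.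
Proof.
exact: (ml_Lnorm (markov_like_iter a (markov_like_adjoint hpi)) q2 deviation_L20 wq).
Qed.

Lemma transported_product a u v : u \in Lfun pi r%:E -> v \in Lfun pi r%:E ->
  pi.-integrable setT (fun x => (transported a x * (u x * v x))%:E) /\
  \int[pi]_x (transported a x * (u x * v x)) =
    ip u v + \int[pi]_x (u x * (v x * iter a (adjoint K pi) w x)).
Proof.
move=> ur vr; have [aq _] := transported_deviation_Lnorm a.
have u2 := Lfun_L2 (ltW r2) ur; have v2 := Lfun_L2 (ltW r2) vr.
have [i1 _] := hoelder3_integrable ur vr aq r2 q0 rq.
have i2 := L2_mul_integrable u2 v2.
have i3 := integrableD measurableT i2 i1.
have mt := Lfun_measurable (transported_L2 a).1.
have mm : measurable_fun setT (fun x => transported a x * (u x * v x)).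
  apply: measurable_funM => //.
  by apply: measurable_funM; [exact: Lfun_measurable ur|exact: Lfun_measurable vr].
have e : (fun x => transported a x * (u x * v x)) =
    (fun x => u x * v x + u x * (v x * iter a (adjoint K pi) w x)) %[ae pi].
  by apply: filterS (transportedE a) => x + xT => /(_ xT) ->; ring.
split.
  have /integrableP[m3 f3] := i3.
  apply/integrableP; split; first exact/measurable_EFinP.
  apply: le_lt_trans f3; rewrite le_eqVlt; apply/orP; left; apply/eqP.
  apply: ae_eq_integral => //.
  - by apply: measurableT_comp => //; exact/measurable_EFinP.
  - exact: measurableT_comp.
  - by apply: filterS e => x + xT => /(_ xT) /= ->.
rewrite (Rintegral_ae _ _ e)//; first by rewrite RintegralD.
by have /measurable_int/measurable_EFinP := i3.
Qed.

Lemma transported_L2_finite a u : u \in Lfun pi r%:E ->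
  (\int[pi]_x ((transported a x)%:E * (u x ^+ 2)%:E) < +oo)%E.
Proof.
move=> ur; have [/integrableP[_ h] _] := transported_product a ur ur.
apply: le_lt_trans h; apply: ge0_le_integral => //.
- by move=> x _; rewrite mule_ge0 ?lee_fin ?sqr_ge0//; apply: (transported_L2 a).2.
- apply: emeasurable_funM; apply/measurable_EFinP.
    exact: Lfun_measurable (transported_L2 a).1.
  exact: measurable_funX (Lfun_measurable ur).
- apply: measurableT_comp => //; apply/measurable_EFinP; apply: measurable_funM.
    exact: Lfun_measurable (transported_L2 a).1.
  by apply: measurable_funM; exact: Lfun_measurable ur.
- by move=> x _; rewrite -EFinM -expr2 lee_fin ler_norm.
Qed.

Lemma transported_covariance a m g : L20 pi g -> g \in Lfun pi r%:E ->
  `|\int[pi]_x (transported a x * (g x * iter m P g x)) - autocov pi P g m| <=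
  4 * pnorm pi r g ^+ 2 * pnorm pi q w *
    ((beta pi K ^+ m) `^ (2 / r) * (beta pi K ^+ a) `^ (2 / q)).
Proof.
move=> g0 gr.
have [mr mle] := ml_Lnorm (markov_like_iter m (markov_like_markov_op hpi)) (ltW r2) g0 gr.
have [aq ale] := transported_deviation_Lnorm a.
have [_ ->] := transported_product a gr mr.
rewrite /autocov (ipC pi (iter m P g)) addrAC subrr add0r.
have [_ h] := hoelder3_integrable gr mr aq r2 q0 rq.
apply: (le_trans h).
apply: (@le_trans _ _ (pnorm pi r g * ((2 * (beta pi K ^+ m) `^ (2 / r) * pnorm pi r g) *
  (2 * (beta pi K ^+ a) `^ (2 / q) * pnorm pi q w)))).
  by rewrite ler_wpM2l ?pnorm_ge0// ler_pM ?pnorm_ge0.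
by rewrite le_eqVlt; apply/orP; left; apply/eqP; ring.
Qed.

End transported_density.

Section ip_sums.
Context (R : realType) (d : measure_display) (D : measurableType d).
Variable mu : probability D R.
Local Notation L2 := (Lfun mu 2%:E).
Local Notation ip := (L2_inner mu).

Lemma ip_suml (I : Type) (s : seq I) (F : I -> D -> R) v :
  (forall i, F i \in L2) -> v \in L2 ->
  ip (fun x => \sum_(i <- s) F i x) v = \sum_(i <- s) ip (F i) v.
Proof.
move=> F2 v2; elim: s => [|i s ih].
  under [X in ip X]eq_fun do rewrite big_nil.
  rewrite big_nil /L2_inner; under eq_Rintegral do rewrite mul0r.
  exact: Rintegral_prob_cst.
under [X in ip X]eq_fun do rewrite big_cons.
by rewrite big_cons -ih (ipDl (F2 i) (L2_sum s F2) v2).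
Qed.

Lemma ip_sum (I : Type) (s : seq I) (F : I -> D -> R) : (forall i, F i \in L2) ->
  ip (fun x => \sum_(i <- s) F i x) (fun x => \sum_(i <- s) F i x) =
  \sum_(i <- s) \sum_(j <- s) ip (F i) (F j).
Proof.
move=> F2; rewrite (ip_suml s F2 (L2_sum s F2)); apply: eq_bigr => i _.
rewrite ipC (ip_suml s F2 (F2 i)); apply: eq_bigr => j _; exact: ipC.
Qed.

End ip_sums.

Section error.
Context (R : realType) (d : measure_display) (D : measurableType d).
Context (dW : measure_display) (W : measurableType dW) (Pr : probability W R).
Variables (X : nat -> {RV Pr >-> D}) (pi : probability D R) (f : D -> R).
Local Notation g := (fun x => f x - \int[pi]_y f y).

Lemma mc_error_sqr n n0 : (0 < n)%N -> (forall a, g \o X a \in Lfun Pr 2%:E) ->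
  (mc_error X pi f n n0 ^+ 2 = (n%:R ^- 2 *
    \sum_(i < n) \sum_(j < n)
      L2_inner Pr (g \o X (i + n0)%N) (g \o X (j + n0)%N))%:E)%E.
Proof.
move=> n0' gX; rewrite /mc_error unlock.
have nN : n%:R != 0 :> R by rewrite pnatr_eq0 -lt0n.
pose V w := \sum_(i < n) (g \o X (i + n0)%N) w.
have V2 : V \in Lfun Pr 2%:E by exact: (L2_sum (index_enum 'I_n) (fun i : 'I_n => gX (i + n0)%N)).
have nV2 := L2Z n%:R^-1 V2; set U := (fun x => _) in nV2.
have -> : (fun w => (`|mc_mean X f n n0 w - \int[pi]_x f x| ^+ 2)%:E) =
    (fun w => (U w * U w)%:E).
  apply/funext => w; rewrite real_normK ?num_real// expr2.
  suff -> : mc_mean X f n n0 w - \int[pi]_x f x = U w by [].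
  rewrite /U /V /mc_mean /= sumrB mulrBr; congr (_ - _).
  by rewrite sumr_const card_ord mulrnAr -mulrnAl -(mulr_natr n%:R^-1 n) mulVf// mul1r.
have -> : (\int[Pr]_w (U w * U w)%:E = (L2_inner Pr U U)%:E)%E.
  rewrite /L2_inner /Rintegral fineK//.
  exact: (integrable_fin_num measurableT (L2_mul_integrable nV2 nV2)).
rewrite poweR_EFin powR12_sqrt ?ip_ge0// -EFin_expe sqr_sqrtr ?ip_ge0//.
rewrite /U (ipZl _ V2 nV2) ipC (ipZl _ V2 V2) mulrA -expr2 exprVn.
by congr (_ * _)%:E; exact: (ip_sum (index_enum 'I_n) (fun i : 'I_n => gX (i + n0)%N)).
Qed.

End error.

Section chain_error.
Context (R : realType) (d : measure_display) (D : measurableType d).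
Variables (K : R.-pker D ~> D) (pi : probability D R).
Hypothesis hpi : stationary K pi.
Context (dW : measure_display) (W : measurableType dW) (Pr : probability W R).
Variables (X : nat -> {RV Pr >-> D}) (nu : probability D R).
Hypothesis hX : markov_chain K nu X.
Variable rho : nat -> D -> R.
Hypothesis rho_adj : forall a, is_adjoint K pi (rho a) (rho a.+1).
Hypothesis rho0_ge0 : forall x, 0 <= rho 0 x.
Hypothesis rho0_meas : measurable_fun setT (rho 0).
Hypothesis rho0_nu : forall A, measurable A ->
  (nu A = \int[pi]_x ((rho 0 x)%:E * (\1_A x)%:E))%E.
Variable f : D -> R.
Local Notation P := (markov_op K).
Local Notation g := (fun x => f x - \int[pi]_y f y).
Hypothesis gX : chain_L2 pi X g.

Lemma chain_mc_error n n0 : (0 < n)%N ->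
  (mc_error X pi f n n0 ^+ 2 = (n%:R ^- 2 *
    \sum_(i < n) \sum_(j < n)
      \int[pi]_x (rho (minn i j + n0)%N x * (g x * iter (natdist i j) P g x)))%:E)%E.
Proof.
move=> n_gt0; rewrite mc_error_sqr//; last by case: gX.
congr (_ * _)%:E; apply: eq_bigr => i _; apply: eq_bigr => j _.
have h (a b : nat) : (a <= b)%N ->
    L2_inner Pr (g \o X (a + n0)%N) (g \o X (b + n0)%N) =
    \int[pi]_x (rho (a + n0)%N x * (g x * iter (b - a) P g x)).
  move=> ab; have -> : (b + n0 = a + n0 + (b - a))%N by rewrite addnAC subnKC.
  rewrite (chain_covariance hpi hX rho_adj rho0_ge0 rho0_meas rho0_nu _ _ gX gX).
  rewrite (chain_ip hX rho_adj rho0_ge0 rho0_meas rho0_nu)//.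
  exact: (chain_L2_iter hpi hX rho_adj rho0_ge0 rho0_meas rho0_nu _ gX).
have [ij|/ltnW ji] := leqP i j.
  by rewrite h// /natdist (eqP ij) add0n.
by rewrite ipC h// /natdist (eqP ji) addn0.
Qed.

End chain_error.

Section stationary_chain_error.
Context (R : realType) (d : measure_display) (D : measurableType d).
Variables (K : R.-pker D ~> D) (pi : probability D R).
Hypothesis hpi : stationary K pi.
Context (dW : measure_display) (W : measurableType dW) (Pr : probability W R).
Variables (Y : nat -> {RV Pr >-> D}).
Hypothesis hY : markov_chain K pi Y.
Variable f : D -> R.
Hypothesis f2 : f \in Lfun pi 2%:E.
Local Notation P := (markov_op K).
Local Notation g := (fun x => f x - \int[pi]_y f y).

Lemma stationary_mc_error n : (0 < n)%N ->
  (mc_error Y pi f n 0 ^+ 2 = (n%:R ^- 2 * stationary_var pi P g n)%:E)%E.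
Proof.
move=> n0; have [g2 _] := L20_center f2.
have adj1 (a : nat) : is_adjoint K pi (cst 1 : D -> R) (cst 1).
  split=> // u mu u0; under eq_integral do rewrite mul1e.
  by under [RHS]eq_integral do rewrite mul1e; exact: integral_kernel_stationary.
have law1 A : measurable A -> (pi A = \int[pi]_x ((cst 1 x)%:E * (\1_A x)%:E))%E.
  move=> mA; under eq_integral do rewrite mul1e.
  by rewrite integral_indic// setIT.
have ge01 : forall x : D, 0 <= (cst 1 : D -> R) x by move=> x; exact: ler01.
have m1 : measurable_fun setT (cst 1 : D -> R) by exact: measurable_cst.
have gY : chain_L2 pi Y g.
  apply: (chain_L2P hY (rho := fun=> cst 1) adj1 ge01 m1 law1 g2) => a.
  under eq_integral do rewrite mul1e.
  by have /L2P[_ /(integrable_fin_num measurableT)] := g2; rewrite fin_numElt => /andP[].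
rewrite (chain_mc_error hpi hY (rho := fun=> cst 1) adj1 ge01 m1 law1 gY)//.
congr (_ * _)%:E; apply: eq_bigr => i _; apply: eq_bigr => j _.
by apply: eq_Rintegral => x _; rewrite mul1r mulrC.
Qed.

End stationary_chain_error.

Lemma powR_exprn (R : realType) (c t : R) m : 0 <= c ->
  (c ^+ m) `^ t = (c `^ t) ^+ m.
Proof.
by move=> c0; rewrite -(powR_mulrn m c0) powRAC (powR_mulrn m (powR_ge0 c t)).
Qed.

Section error_comparison.
Context (R : realType) (d : measure_display) (D : measurableType d).
Variables (K : R.-pker D ~> D) (nu pi : probability D R).
Hypotheses (hpi : stationary K pi) (hnu : nu `<< pi) (b1 : beta pi K < 1).
Context (dW : measure_display) (W : measurableType dW) (Pr : probability W R).
Variables (X : nat -> {RV Pr >-> D}).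
Hypothesis hX : markov_chain K nu X.
Variables (f : D -> R) (r q : R).
Hypotheses (r2 : 2 < r) (q2 : 2 <= q) (rq : 2 / r + q^-1 = 1).
Hypothesis fr : f \in Lfun pi r%:E.
Local Notation P := (markov_op K).
Local Notation g := (fun x => f x - \int[pi]_y f y).
Local Notation w := (fun x => fine (density nu pi x) - 1).
Hypothesis wq : w \in Lfun pi q%:E.
Local Notation b := (beta pi K).

Lemma mc_error_comparison n n0 : (0 < n)%N -> exists v : R,
  (mc_error X pi f n n0 ^+ 2 = (n%:R ^- 2 * v)%:E)%E /\
  `|v - stationary_var pi P g n| <=
    8 * r * q * pnorm pi r f ^+ 2 * pnorm pi q w * b `^ (2 / q * n0%:R) / (1 - b) ^+ 2.
Proof.
move=> n_gt0.
have b0 : 0 <= b := ml_ge0 (markov_like_markov_op hpi).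
have r0 : 0 < r by exact: lt_trans r2.
have q0 : 0 < q by exact: lt_le_trans q2.
have rn0 : r != 0 by rewrite gt_eqF.
have qn0 : q != 0 by rewrite gt_eqF.
have w2 : w \in Lfun pi 2%:E by exact: Lfun_L2 wq.
have w1E : density0 nu pi = (fun x => w x + 1) %[ae pi].
  by apply: filterS (density0E hnu) => x + xT => /(_ xT) ->; rewrite subrK.
have rge0 := density0_ge0 nu pi; have mrho := measurable_density0 hnu.
have law := density0_law hnu.
pose rho := transported K pi (density0 nu pi).
have adj : forall a, is_adjoint K pi (rho a) (rho a.+1).
  exact: (transported_adjoint hpi rge0 mrho w2 w1E).
have [gr gle] := center_Lfun (ltW r2) fr.
have g0 : L20 pi g by apply: L20_center; exact: Lfun_L2 (ltW r2) fr.
have gX : chain_L2 pi X g.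
  apply: (chain_L2P hX (rho := rho) adj rge0 mrho law g0.1) => a.
  exact: (transported_L2_finite hpi rge0 mrho law w2 w1E r2 q2 rq wq).
pose s i j := \int[pi]_x (rho (minn i j + n0)%N x * (g x * iter (natdist i j) P g x)).
exists (\sum_(i < n) \sum_(j < n) s i j); split.
  exact: (chain_mc_error hpi hX (rho := rho) adj rge0 mrho law gX).
pose x := b `^ (2 / r); pose y := b `^ (2 / q).
have tr : 0 < 2 / r <= 1 by rewrite divr_gt0//= ler_pdivrMr// mul1r ltW.
have tq : 0 < 2 / q <= 1 by rewrite divr_gt0//= ler_pdivrMr// mul1r.
have b01 : 0 <= b < 1 by rewrite b0.
have hx := le_one_minus_powR b01 tr; have hy := le_one_minus_powR b01 tq.
have b1' : 0 < 1 - b by rewrite subr_gt0.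
have x1 : 0 < 1 - x by apply: lt_le_trans hx; rewrite mulr_gt0//; case/andP: tr.
have y1 : 0 < 1 - y by apply: lt_le_trans hy; rewrite mulr_gt0//; case/andP: tq.
pose c := 4 * pnorm pi r g ^+ 2 * pnorm pi q w * y ^+ n0.
have c0 : 0 <= c by rewrite !mulr_ge0 ?sqr_ge0 ?pnorm_ge0// exprn_ge0// powR_ge0.
rewrite /stationary_var -sumrB.
apply: (@le_trans _ _ (c * (2 / ((1 - x) * (1 - y))))).
  have x01 : 0 <= x < 1 by rewrite powR_ge0 -subr_gt0.
  have y01 : 0 <= y < 1 by rewrite powR_ge0 -subr_gt0.
  apply: le_trans (ler_wpM2l c0 (double_sum_geometric n x01 y01)).
  rewrite mulr_sumr (le_trans (ler_norm_sum _ _ _))//; apply: ler_sum => i _.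
  rewrite -sumrB mulr_sumr (le_trans (ler_norm_sum _ _ _))//; apply: ler_sum => j _.
  have := transported_covariance hpi rge0 mrho law w2 w1E r2 q2 rq wq
    (minn i j + n0)%N (natdist i j) g0 gr.
  rewrite !powR_exprn//; move=> /le_trans; apply.
  by rewrite le_eqVlt; apply/orP; left; apply/eqP; rewrite /c -/x -/y exprD; ring.
have yE : b `^ (2 / q * n0%:R) = y ^+ n0.
  by rewrite powRrM powR_mulrn ?powR_ge0.
have e : 8 * r * q * pnorm pi r f ^+ 2 * pnorm pi q w * b `^ (2 / q * n0%:R) / (1 - b) ^+ 2 =
    4 * (2 * pnorm pi r f) ^+ 2 * pnorm pi q w * y ^+ n0 *
    (2 / ((2 / r * (1 - b)) * (2 / q * (1 - b)))).
  have b1n : 1 - b != 0 by rewrite gt_eqF.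
  by rewrite yE; field; rewrite ?rn0 ?qn0 ?b1n.
rewrite e; have yn0 : 0 <= y ^+ n0 by rewrite exprn_ge0// powR_ge0.
apply: ler_pM => //.
- by rewrite divr_ge0// mulr_ge0// ltW.
- rewrite /c ler_wpM2r// ler_wpM2r ?pnorm_ge0// ler_wpM2l//.
  by rewrite ler_pXn2r// nnegrE ?mulr_ge0 ?pnorm_ge0.
- have [tr0 tq0] : 0 < 2 / r * (1 - b) /\ 0 < 2 / q * (1 - b).
    by split; rewrite mulr_gt0//; [case/andP: tr|case/andP: tq].
  rewrite ler_wpM2l// lef_pV2 ?posrE ?(mulr_gt0 x1 y1) ?(mulr_gt0 tr0 tq0)//.
  by apply: ler_pM => //; exact: ltW.
Qed.

End error_comparison.

Section exponents.
Context (R : realType).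
Variable p : \bar R.
Hypothesis hp : (2%:E < p)%E.
Local Notation Q := (Num.max 2 (pratio p)).

Lemma pratio_lt4 : (p < 4%:E)%E ->
  [/\ p = (fine p)%:E, pratio p = fine p / (fine p - 2) & Q = pratio p].
Proof.
move: hp; case: p => [s| |] //=; rewrite !lte_fin => s2 s4; split => //.
by apply/max_idPr; rewrite ler_pdivlMr; lra.
Qed.

Lemma pratio_ge4 : ~~ (p < 4%:E)%E -> 1 <= pratio p /\ Q = 2.
Proof.
move: hp; case: p => [s| |] //=; rewrite ?lte_fin; last first.
  by move=> _ _; split => //; apply/max_idPl; rewrite ler1n.
move=> s2; rewrite -leNgt => s4; split; first by rewrite ler_pdivlMr; lra.
by apply/max_idPl; rewrite ler_pdivrMr; lra.
Qed.

Lemma interpolation_exponent : exists r : R,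
  [/\ 2 < r, 2 / r + Q^-1 = 1, (r%:E <= p)%E & r * Q <= 8 * pratio p].
Proof.
have [p4|p4] := boolP (p < 4%:E)%E.
  have [pE qE ->] := pratio_lt4 p4; exists (fine p).
  have : (2%:E < (fine p)%:E)%E by rewrite -pE.
  have : ((fine p)%:E < 4%:E)%E by rewrite -pE.
  rewrite !lte_fin => s4 s2; split => //; last 2 first.
  - by rewrite -pE.
  - by rewrite ler_wpM2r ?qE ?divr_ge0//; lra.
  by rewrite qE invf_div; field; rewrite gt_eqF//; lra.
have [q1 ->] := pratio_ge4 p4; exists 4.
by split; [lra|lra|rewrite leNgt|lra].
Qed.

End exponents.

Lemma cvg_EFin_rate (R : realType) (e : nat -> \bar R) (l C : R) :
  (forall n, (0 < n)%N -> exists2 a, e n = a%:E & `|a - l| <= C / n%:R) ->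
  e @ \oo --> l%:E.
Proof.
move=> h; apply/fine_cvgP; split.
  by exists 1%N => // n n1; have [c -> _] := h n n1.
apply/cvgrPdist_le => /= eps eps0; near=> n.
have n0 : (0 < n)%N by near: n; exists 1%N.
rewrite distrC /=; have [c -> /= hc] := h n n0; apply: (le_trans hc).
rewrite ler_pdivrMr ?ltr0n// -ler_pdivrMl//.
by near: n; exact: nbhs_infty_ger.
Unshelve. all: by end_near. Qed.

Theorem theorem3p41 (R : realType) (d : measure_display) (D : measurableType d)
  (K : R.-pker D ~> D) (nu pi : probability D R)
  (dW : measure_display) (W : measurableType dW) (Pr : probability W R)
  (X : nat -> {RV Pr >-> D})
  (dW' : measure_display) (W' : measurableType dW') (Pr' : probability W' R)
  (Y : nat -> {RV Pr' >-> D})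
  (p : \bar R) (f : D -> R)
  (hX : markov_chain K nu X)
  (hY : markov_chain K pi Y)
  (hpi : stationary K pi)
  (hp : (2%:E < p)%E)
  (hf : f \in Lfun pi p)
  (hnu : in_M pi (Num.max 2 (pratio p))%:E nu)
  (hgap : 0 < 1 - beta pi K) :
  [/\ forall n n0 : nat, (0 < n)%N ->
        (mc_error X pi f n n0 ^+ 2 <=
         mc_error Y pi f n 0 ^+ 2 +
         (64 * pratio p / (n%:R ^+ 2 * (1 - beta pi K) ^+ 2))%:E *
         'N[pi]_p[EFin \o f] ^+ 2 *
         (if p < 4%:E then
            (beta pi K `^ (2 * n0%:R * ((fine p - 2) / fine p)))%:E *
            'N[pi]_((pratio p)%:E)[density nu pi \- cst 1]
          else
            (beta pi K ^+ n0)%:E * 'N[pi]_(2%:E)[density nu pi \- cst 1]))%E,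
      forall n : nat, (0 < n)%N ->
        (reversible K pi -> L20_nontrivial pi ->
           (mc_error Y pi f n 0 ^+ 2 <=
            (2 / (n%:R * (1 - Lambda pi K)))%:E * 'N[pi]_p[EFin \o f] ^+ 2)%E) /\
        (~ reversible K pi ->
           (mc_error Y pi f n 0 ^+ 2 <=
            (2 / (n%:R * (1 - beta pi K)))%:E * 'N[pi]_p[EFin \o f] ^+ 2)%E)
    & forall n0 : nat, exists l : R,
        [/\ (fun n : nat => n%:R%:E * mc_error X pi f n n0 ^+ 2)%E @ \oo
              --> l%:E,
            (fun n : nat => n%:R%:E * mc_error Y pi f n 0 ^+ 2)%E @ \oo
              --> l%:E
          & reversible K pi ->
            let g := fun x => f x - \int[pi]_y f y in
            exists2 B : (D -> R) -> (D -> R),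
              L20_inverse pi (fun u x => u x - markov_op K u x) B &
              l = L2_inner pi (fun x => B g x + markov_op K (B g) x) g]].

Proof.
have b1 : beta pi K < 1 by rewrite -subr_gt0.
have b1' : 0 < 1 - beta pi K by [].
have hP := markov_like_markov_op hpi.
have [r [r2 rq rp rQ]] := interpolation_exponent hp.
set Q : R := Num.max 2 (pratio p) in hnu rq rQ.
have q2 : 2 <= Q by rewrite le_max lexx.
have [hdom hfin] := hnu.
pose w x := fine (density nu pi x) - 1.
have wE : EFin \o w = (density nu pi \- cst 1)%E.
  by apply/funext => x; rewrite /= EFinB fineK// density_fin_num.
have wQ : w \in Lfun pi Q%:E.
  have dQ : (fun x => fine (density nu pi x)) \in Lfun pi Q%:E.
    apply/LfunP_fin; split.
      exact: (measurableT_comp (fine_measurable measurableT) (measurable_density hdom)).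
    rewrite (_ : _ \o _ = density nu pi)//.
    by apply/funext => x; rewrite /= fineK// density_fin_num.
  have Q1 : (1 <= Q%:E)%E by rewrite lee_fin; apply: le_trans q2; rewrite ler1n.
  have c1 : (cst 1 : D -> R) \in Lfun pi Q%:E by exact: Lfun_cst.
  have := (Lfun_submod_closed pi Q1).2 (-1) _ _ c1 dQ.
  rewrite (_ : _ + _ = w)//; apply/funext => x.
  by rewrite -[LHS]/(-1 * 1 + fine (density nu pi x)) mulr1 addrC.
have mf := Lfun_measurable hf.
have r0 : 0 < r by exact: lt_trans r2.
have Nr (s : R) : 0 < s -> (s%:E <= p)%E ->
    ('N[pi]_s%:E[EFin \o f] <= 'N[pi]_p[EFin \o f])%E.
  move=> s0; case: (p) => [t| |]//; first by rewrite lee_fin; exact: Lnorm_mono.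
  by move=> _; exact: Lnorm_le_y.
have [_ Ffin] := (LfunP_fin pi p f).1 hf.
pose F : R := fine ('N[pi]_p[EFin \o f])%E.
have FE : ('N[pi]_p[EFin \o f] = F%:E)%E by rewrite fineK// ge0_fin_numE// Lnorm_ge0.
have fL (s : R) : 0 < s -> (s%:E <= p)%E -> f \in Lfun pi s%:E /\ pnorm pi s f <= F.
  move=> s0 sp; have h := Nr s s0 sp.
  have fs : f \in Lfun pi s%:E by apply/LfunP_fin; split => //; exact: le_lt_trans h Ffin.
  by split => //; rewrite -lee_fin -FE -pnormE.
have [fr rF] := fL r r0 rp.
have [f2 F2] := fL 2 (ltr0Sn R 1) (ltW hp).
pose g x := f x - \int[pi]_y f y.
have g0 : L20 pi g by exact: L20_center f2.
pose V := stationary_var pi (markov_op K) g.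
have YE n : (0 < n)%N -> (mc_error Y pi f n 0 ^+ 2 = (n%:R ^- 2 * V n)%:E)%E.
  exact: stationary_mc_error.
have XE n n0 : (0 < n)%N -> exists v : R,
    (mc_error X pi f n n0 ^+ 2 = (n%:R ^- 2 * v)%:E)%E /\
    `|v - V n| <= 8 * r * Q * pnorm pi r f ^+ 2 * pnorm pi Q w *
      beta pi K `^ (2 / Q * n0%:R) / (1 - beta pi K) ^+ 2.
  exact: (mc_error_comparison hpi hdom b1 hX r2 q2 rq fr wQ n0).
have ngE : L2norm pi g <= F.
  apply: le_trans F2; rewrite /pnorm Lnorm2E//; exact: L2norm_center.
have F0 : 0 <= F by exact: le_trans (L2norm_ge0 _ _) ngE.
have part2 n (L : R) : (0 < n)%N -> L < 1 -> V n <= n%:R * (2 / (1 - L)) * L2norm pi g ^+ 2 ->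
    (mc_error Y pi f n 0 ^+ 2 <=
     (2 / (n%:R * (1 - L)))%:E * 'N[pi]_p[EFin \o f] ^+ 2)%E.
  move=> n0 L1 h; rewrite YE// FE -EFin_expe -EFinM lee_fin.
  have nN : n%:R != 0 :> R by rewrite pnatr_eq0 -lt0n.
  have L0 : 1 - L != 0 by rewrite gt_eqF// subr_gt0.
  apply: (@le_trans _ _ (n%:R ^- 2 * (n%:R * (2 / (1 - L)) * F ^+ 2))).
    rewrite ler_wpM2l ?invr_ge0 ?exprn_ge0// (le_trans h)// ler_wpM2l//.
      by rewrite mulr_ge0// divr_ge0// subr_ge0 ltW.
    by rewrite ler_pXn2r ?nnegrE ?L2norm_ge0.
  by rewrite le_eqVlt; apply/orP; left; apply/eqP; field; rewrite ?nN ?L0.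
split.
- move=> n n0 n_gt0; have [v [-> hv]] := XE n n0 n_gt0.
  rewrite YE// FE -EFin_expe -EFinM.
  rewrite (_ : (if _ then _ else _)%E =
      (beta pi K `^ (2 / Q * n0%:R) * pnorm pi Q w)%:E); last first.
    rewrite -wE EFinM -pnormE//; case: ifPn => p4.
      have [pE pq QE] := pratio_lt4 hp p4; rewrite /Q QE; congr (_%:E * _)%E.
      by rewrite pq invf_div mulrAC.
    have [_ QE] := pratio_ge4 hp p4; rewrite /Q QE divff ?pnatr_eq0// mul1r.
    by rewrite powR_mulrn// (ml_ge0 hP).
  rewrite -EFinM -EFinD lee_fin.
  have nN : n%:R != 0 :> R by rewrite pnatr_eq0 -lt0n.
  set z := beta pi K `^ _ in hv *; set c := pnorm pi Q w in hv *.
  have z0 : 0 <= z by exact: powR_ge0.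
  have w0 : 0 <= c by exact: pnorm_ge0.
  apply: (@le_trans _ _ (n%:R ^- 2 * (V n + 8 * (8 * pratio p) * F ^+ 2 * c * z /
      (1 - beta pi K) ^+ 2))).
    rewrite ler_wpM2l ?invr_ge0 ?exprn_ge0//.
    rewrite -lerBlDl; apply: le_trans (ler_norm _) _; apply: le_trans hv _.
    rewrite ler_wpM2r ?invr_ge0 ?sqr_ge0// ler_wpM2r// ler_wpM2r//.
    apply: ler_pM => //; rewrite ?sqr_ge0//.
    + by rewrite !mulr_ge0 ?(ltW r0)// (le_trans _ q2).
    + by rewrite -mulrA ler_wpM2l.
    + by rewrite ler_pXn2r ?nnegrE ?pnorm_ge0.
  rewrite le_eqVlt; apply/orP; left; apply/eqP; field.
  by rewrite nN gt_eqF.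
- move=> n n_gt0; split=> [hrev nt|_]; last first.
    by apply: part2 => //; exact: (stationary_var_le hP b1).
  have sym u v : u \in Lfun pi 2%:E -> v \in Lfun pi 2%:E ->
    L2_inner pi (markov_op K u) v = L2_inner pi u (markov_op K v) by exact: reversible_ip.
  have [L1 hL] := spectral_gap hP b1 sym nt.
  by apply: part2 => //; exact: (stationary_var_le_gap hP b1 sym).
have [B] := resolvent hP b1.
rewrite (_ : (fun u x => 1 * u x - markov_op K u x) =
  (fun u x => u x - markov_op K u x)); last first.
  by apply/funext => u; apply/funext => x; rewrite mul1r.
move=> hB; have [[Bin _ _] _ BR] := hB.
pose h := B g; have h0 : L20 pi h by exact: Bin.
have pe : (fun x => h x - markov_op K h x) = g %[ae pi] by exact: BR.
pose l := 2 * L2_inner pi h g - L2_inner pi g g.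
have asym n : `|V n - n%:R * l| <= 2 * (L2norm pi h * L2norm pi g) / (1 - beta pi K).
  exact: (stationary_var_asymp hP b1 g0 h0 pe).
set C := 2 * _ / _ in asym.
move=> n0; exists l; split.
- set M := 8 * r * Q * pnorm pi r f ^+ 2 * pnorm pi Q w *
      beta pi K `^ (2 / Q * n0%:R) / (1 - beta pi K) ^+ 2.
  apply: (@cvg_EFin_rate _ _ _ (M + C)) => n n_gt0.
  have nN : n%:R != 0 :> R by rewrite pnatr_eq0 -lt0n.
  have [v [-> hv]] := XE n n0 n_gt0; exists (n%:R^-1 * v).
    by rewrite -EFinM; congr (_%:E); field.
  have -> : n%:R^-1 * v - l = (v - n%:R * l) / n%:R by field.
  rewrite normrM [X in _ * X]ger0_norm ?invr_ge0// ler_wpM2r ?invr_ge0//.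
  have -> : v - n%:R * l = (v - V n) + (V n - n%:R * l) by ring.
  by apply: (le_trans (ler_normD _ _)); exact: lerD.
- apply: (@cvg_EFin_rate _ _ _ C) => n n_gt0.
  have nN : n%:R != 0 :> R by rewrite pnatr_eq0 -lt0n.
  rewrite YE//; exists (n%:R^-1 * V n).
    by rewrite -EFinM; congr (_%:E); field.
  have -> : n%:R^-1 * V n - l = (V n - n%:R * l) / n%:R by field.
  by rewrite normrM [X in _ * X]ger0_norm ?invr_ge0// ler_wpM2r ?invr_ge0.
- move=> _; exists B => //.
  by rewrite /l -(poisson_pair hP g0 h0 pe).
Qed.
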